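(* Let $E$ be a smooth and strictly convex complex Banach space. Then $T:\mathcal{B}_0(\triangle,E)\to\mathcal{B}_0(\triangle,E)$ is a surjective linear isometry if and only if there exist a surjective linear isometry $S:E\to E$ and a disc automorphism $\sigma$ such that for every $f\in\mathcal{B}_0(\triangle,E)$ and every $z\in\triangle$, \[ Tf(z)=S\big[(f\circ\sigma)(z)-(f\circ\sigma)(0)\big].\]
   Context: $\triangle=\{z\in\mathbb{C}:|z|<1\}$. $\mathcal{B}_0(\triangle,E)$ is the Banach space of all analytic functions $f:\triangle\to E$ with $f(0)=0$ and $\lim_{|z|\to1}(1-|z|^2)\|f'(z)\|_E=0$, with norm $\|f\|=\sup_{z\in\triangle}(1-|z|^2)\|f'(z)\|_E$. A disc automorphism is a bijective analytic map of $\triangle$ onto itself. *)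

(* Defs.v *)
From Stdlib Require Import Reals Lra FunctionalExtensionality ProofIrrelevance.
From Coquelicot Require Import Coquelicot.

Open Scope R_scope.

Definition unit_disc (z : C) : Prop := Cmod z < 1.

(* Analytic means complex differentiable at every point of the disc. *)
Definition analytic_on_disc {V : NormedModule C_AbsRing} (f : C -> V) : Prop :=
  forall z : C, unit_disc z -> ex_derive (K := C_AbsRing) f z.

(* f'(z); meaningful when f is complex differentiable at z. *)
Definition vderive {V : CompleteNormedModule C_AbsRing} (f : C -> V) (z : C) : V :=
  iota (is_derive (K := C_AbsRing) f z).

Definition weighted_derive {V : CompleteNormedModule C_AbsRing}
    (f : C -> V) (z : C) : R :=
  (1 - Cmod z ^ 2) * norm (vderive f z).

Definition dual_norm {V : NormedModule C_AbsRing} (phi : V -> C) : Rbar :=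
  Lub_Rbar (fun r => exists x : V, norm x <= 1 /\ r = Cmod (phi x)).

(* Coquelicot's [is_linear] includes boundedness. *)
Definition support_functional {V : NormedModule C_AbsRing} (x : V) (phi : V -> C)
    : Prop :=
  is_linear (V := C_NormedModule) phi /\
  dual_norm phi = Finite 1 /\ phi x = RtoC (norm x).

Definition smooth (V : NormedModule C_AbsRing) : Prop :=
  forall x : V, norm x = 1 -> exists! phi : V -> C, support_functional x phi.

Definition strictly_convex (V : NormedModule C_AbsRing) : Prop :=
  forall x y : V, norm x = 1 -> norm y = 1 -> x <> y -> norm (plus x y) < 2.

(* The values of sigma outside the disc are irrelevant. *)
Definition disc_automorphism (sigma : C -> C) : Prop :=
  analytic_on_disc (V := C_NormedModule) sigma /\
  (forall z, unit_disc z -> unit_disc (sigma z)) /\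
  (forall z w, unit_disc z -> unit_disc w -> sigma z = sigma w -> z = w) /\
  (forall w, unit_disc w -> exists z, unit_disc z /\ sigma z = w).

(* The norm is a parameter because the norm of B_0 is a supremum in [Rbar]. *)
Definition surjective_linear_isometry {U : ModuleSpace C_Ring} {N : Type}
    (nrm : U -> N) (L : U -> U) : Prop :=
  (forall x y : U, L (plus x y) = plus (L x) (L y)) /\
  (forall (c : C) (x : U), L (scal c x) = scal c (L x)) /\
  (forall x : U, nrm (L x) = nrm x) /\
  (forall y : U, exists x : U, L x = y).

(* lim_{|z| -> 1} g(z) = 0 inside the disc. *)
Definition vanishes_at_circle (g : C -> R) : Prop :=
  forall eps : posreal, exists delta : posreal,
    forall z : C, unit_disc z -> 1 - delta < Cmod z -> Rabs (g z) < eps.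

(* A function on the disc is represented by its extension by zero to C, so that
   Leibniz equality on [B0 E] is equality of functions on the disc. *)
Record B0 (E : CompleteNormedModule C_AbsRing) := mkB0 {
  B0_fun :> C -> E;
  B0_off_disc : forall z : C, ~ unit_disc z -> B0_fun z = zero;
  B0_analytic : analytic_on_disc B0_fun;
  B0_at_0 : B0_fun (RtoC 0) = zero;
  B0_little : vanishes_at_circle (weighted_derive B0_fun)
}.

Arguments mkB0 {E} _ _ _ _ _.

Definition B0_norm {E : CompleteNormedModule C_AbsRing} (f : B0 E) : Rbar :=
  Lub_Rbar (fun r => exists z : C, unit_disc z /\ r = weighted_derive f z).

Section B0_module.

Context {E : CompleteNormedModule C_AbsRing}.

Lemma is_vderive_unique (f : C -> E) (z : C) (l1 l2 : E) :
  is_derive (K := C_AbsRing) f z l1 -> is_derive (K := C_AbsRing) f z l2 ->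
  l1 = l2.
Proof.
intros H1 H2.
assert (H3 := is_derive_minus _ _ _ _ _ H1 H2).
destruct H3 as [_ H3].
specialize (H3 z (fun P HP => HP)).
set (d := minus l1 l2) in *.
assert (Hd : norm d <= 0).
{ apply Rnot_lt_le; intros Hpos.
  assert (He : 0 < norm d / 2) by lra.
  specialize (H3 (mkposreal _ He)); simpl in H3.
  apply (locally_le_locally_norm (K := C_AbsRing) (V := AbsRing_NormedModule C_AbsRing)) in H3.
  destruct H3 as [r Hr].
  assert (Hr0 := cond_pos r).
  set (h := RtoC (r / 2)).
  assert (Hh : Cmod h = r / 2) by (unfold h; rewrite Cmod_R; apply Rabs_pos_eq; lra).
  assert (Hm : @minus C_AbsRing (Cplus z h) z = h).
  { unfold minus, plus, opp; simpl; ring. }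
  specialize (Hr (Cplus z h)).
  assert (Hb : ball_norm (K := C_AbsRing) (V := AbsRing_NormedModule C_AbsRing) z r (Cplus z h)).
  { unfold ball_norm; change (Cmod (@minus C_AbsRing (Cplus z h) z) < r).
    rewrite Hm, Hh; lra. }
  specialize (Hr Hb).
  unfold is_domin in Hr.
  change (@minus (AbsRing_NormedModule C_AbsRing) (Cplus z h) z)
    with (@minus C_AbsRing (Cplus z h) z) in Hr.
  rewrite Hm in Hr.
  change (@norm C_AbsRing (AbsRing_NormedModule C_AbsRing) h) with (Cmod h) in Hr.
  rewrite Hh in Hr.
  rewrite !minus_eq_zero in Hr.
  unfold minus at 1 in Hr.
  rewrite plus_zero_l, norm_opp in Hr.
  assert (Hs : norm d <= 2 / r * norm (scal (h : C_AbsRing) d)).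
  { assert (Hh0 : h <> RtoC 0).
    { intros Hc; rewrite Hc, Cmod_0 in Hh; lra. }
    assert (Heq : d = scal (Cinv h : C_AbsRing) (scal (h : C_AbsRing) d)).
    { rewrite scal_assoc.
      change (@mult C_AbsRing (Cinv h) h) with (Cmult (Cinv h) h).
      rewrite Cinv_l by exact Hh0. symmetry; apply (scal_one d). }
    rewrite Heq at 1.
    eapply Rle_trans; [apply (norm_scal (K := C_AbsRing) (V := E))|].
    change (abs (K := C_AbsRing) (Cinv h)) with (Cmod (Cinv h)).
    rewrite Cmod_inv by exact Hh0. rewrite Hh.
    right; field; lra. }
  assert (Ht : 2 / r * norm (scal (h : C_AbsRing) d) <= norm d / 2).
  { apply Rle_trans with (2 / r * (norm d / 2 * (r / 2))).
    - apply Rmult_le_compat_l; [|exact Hr].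
      apply Rlt_le, Rdiv_lt_0_compat; lra.
    - right; field; lra. }
  lra. }
assert (Hz : d = zero).
{ apply (norm_eq_zero (K := C_AbsRing) (V := E)); apply Rle_antisym; [exact Hd|apply norm_ge_0]. }
apply (plus_reg_r (G := E) (opp l2)).
rewrite plus_opp_r; exact Hz.
Qed.

Lemma vderive_unique (f : C -> E) (z : C) (l : E) :
  is_derive (K := C_AbsRing) f z l -> vderive f z = l.
Proof.
intros H; apply (iota_unique (K := C_AbsRing)); [|exact H].
intros y Hy; exact (is_vderive_unique f z y l Hy H).
Qed.

Lemma vderive_correct (f : C -> E) (z : C) :
  ex_derive (K := C_AbsRing) f z -> is_derive (K := C_AbsRing) f z (vderive f z).
Proof. intros [l Hl]; rewrite (vderive_unique _ _ _ Hl); exact Hl. Qed.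

Lemma is_vderive_plus (f g : C -> E) (z : C) (l1 l2 : E) :
  is_derive (K := C_AbsRing) f z l1 -> is_derive (K := C_AbsRing) g z l2 ->
  is_derive (K := C_AbsRing) (fun w => plus (f w) (g w)) z (plus l1 l2).
Proof. exact (is_derive_plus (K := C_AbsRing) (V := E) f g z l1 l2). Qed.

Lemma is_vderive_scal (c : C) (f : C -> E) (z : C) (l : E) :
  is_derive (K := C_AbsRing) f z l ->
  is_derive (K := C_AbsRing) (fun w => scal (c : C_AbsRing) (f w)) z
    (scal (c : C_AbsRing) l).
Proof.
intros H.
assert (Hc : forall a b : C_AbsRing, mult a b = mult b a).
{ intros a b; apply Cmult_comm. }
eapply filterdiff_ext_lin; [apply (filterdiff_scal_r_fct _ _ _ Hc H)|].
intros y; simpl; rewrite !scal_assoc; f_equal; apply Hc.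
Qed.

Lemma weight_pos (z : C) : unit_disc z -> 0 < 1 - Cmod z ^ 2.
Proof. unfold unit_disc; intros H; assert (H0 := Cmod_ge_0 z); nra. Qed.

Lemma weighted_derive_pos (f : C -> E) (z : C) :
  unit_disc z -> 0 <= weighted_derive f z.
Proof.
intros H; apply Rmult_le_pos; [apply Rlt_le, weight_pos, H|apply norm_ge_0].
Qed.

Lemma weighted_derive_plus (f g : C -> E) (z : C) :
  unit_disc z -> ex_derive (K := C_AbsRing) f z -> ex_derive (K := C_AbsRing) g z ->
  weighted_derive (fun w => plus (f w) (g w)) z
    <= weighted_derive f z + weighted_derive g z.
Proof.
intros Hz Hf Hg; unfold weighted_derive.
assert (D := vderive_unique _ _ _ (is_vderive_plus _ _ _ _ _
  (vderive_correct _ _ Hf) (vderive_correct _ _ Hg))).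
change (vderive (fun w : C => plus (f w) (g w)) z
  = plus (vderive f z) (vderive g z)) in D; rewrite D.
rewrite <- Rmult_plus_distr_l.
apply Rmult_le_compat_l; [apply Rlt_le, weight_pos, Hz|].
exact (norm_triangle (V := E) (vderive f z) (vderive g z)).
Qed.

Lemma weighted_derive_scal (c : C) (f : C -> E) (z : C) :
  unit_disc z -> ex_derive (K := C_AbsRing) f z ->
  weighted_derive (fun w => scal (c : C_AbsRing) (f w)) z
    <= Cmod c * weighted_derive f z.
Proof.
intros Hz Hf; unfold weighted_derive.
assert (D := vderive_unique _ _ _ (is_vderive_scal c _ _ _ (vderive_correct _ _ Hf))).
change (vderive (fun w : C => scal (c : C_AbsRing) (f w)) z
  = scal (c : C_AbsRing) (vderive f z)) in D; rewrite D.
rewrite <- Rmult_assoc, (Rmult_comm (Cmod c)), Rmult_assoc.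
apply Rmult_le_compat_l; [apply Rlt_le, weight_pos, Hz|].
exact (norm_scal (K := C_AbsRing) (V := E) (c : C_AbsRing) (vderive f z)).
Qed.

Lemma B0_ext (f g : B0 E) : (forall z, f z = g z) -> f = g.
Proof.
destruct f as [f f1 f2 f3 f4], g as [g g1 g2 g3 g4]; simpl; intros H.
apply functional_extensionality in H; subst g.
f_equal; apply proof_irrelevance.
Qed.

Lemma is_vderive_zero (z : C) :
  is_derive (K := C_AbsRing) (fun _ : C => (zero : E)) z zero.
Proof. apply (is_derive_const (K := C_AbsRing)). Qed.

Program Definition B0_zero : B0 E := mkB0 (fun _ => zero) _ _ _ _.
Next Obligation. intros z _; exists zero; apply is_vderive_zero. Qed.
Next Obligation.
intros eps; exists eps; intros z _ _.
unfold weighted_derive; rewrite (vderive_unique _ _ _ (is_vderive_zero z)).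
rewrite norm_zero, Rmult_0_r, Rabs_R0; apply cond_pos.
Qed.

Program Definition B0_plus (f g : B0 E) : B0 E :=
  mkB0 (fun z => plus (f z) (g z)) _ _ _ _.
Next Obligation.
rewrite (B0_off_disc _ f), (B0_off_disc _ g) by assumption; apply plus_zero_l.
Qed.
Next Obligation.
intros z Hz; exists (plus (vderive f z) (vderive g z)).
exact (is_vderive_plus _ _ _ _ _ (vderive_correct _ _ (B0_analytic _ f _ Hz))
  (vderive_correct _ _ (B0_analytic _ g _ Hz))).
Qed.
Next Obligation.
rewrite (B0_at_0 _ f), (B0_at_0 _ g); apply plus_zero_l.
Qed.
Next Obligation.
intros eps.
destruct (B0_little _ f (pos_div_2 eps)) as [d1 H1].
destruct (B0_little _ g (pos_div_2 eps)) as [d2 H2].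
assert (Hd : 0 < Rmin d1 d2) by (apply Rmin_pos; apply cond_pos).
exists (mkposreal _ Hd); simpl; intros z Hz Hz1.
assert (Ha := Rmin_l d1 d2); assert (Hb := Rmin_r d1 d2).
assert (K1 := H1 z Hz ltac:(lra)); assert (K2 := H2 z Hz ltac:(lra)).
assert (P := weighted_derive_plus f g z Hz
  (B0_analytic _ f _ Hz) (B0_analytic _ g _ Hz)).
rewrite Rabs_pos_eq in K1 by (apply weighted_derive_pos, Hz).
rewrite Rabs_pos_eq in K2 by (apply weighted_derive_pos, Hz).
rewrite Rabs_pos_eq by (apply weighted_derive_pos, Hz).
simpl in K1, K2; eapply Rle_lt_trans; [exact P|lra].
Qed.

Program Definition B0_scal (c : C) (f : B0 E) : B0 E :=
  mkB0 (fun z => scal (c : C_AbsRing) (f z)) _ _ _ _.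
Next Obligation.
rewrite (B0_off_disc _ f) by assumption; apply (scal_zero_r (K := C_AbsRing) (V := E)).
Qed.
Next Obligation.
intros z Hz; exists (scal (c : C_AbsRing) (vderive f z)).
exact (is_vderive_scal c _ _ _ (vderive_correct _ _ (B0_analytic _ f _ Hz))).
Qed.
Next Obligation. rewrite (B0_at_0 _ f); apply (scal_zero_r (K := C_AbsRing) (V := E)). Qed.
Next Obligation.
intros eps.
assert (Hc := Cmod_ge_0 c); assert (He := cond_pos eps).
assert (Hq : 0 < eps / (Cmod c + 1)) by (apply Rdiv_lt_0_compat; lra).
destruct (B0_little _ f (mkposreal _ Hq)) as [d H].
exists d; intros z Hz Hz1; specialize (H z Hz Hz1); simpl in H.
assert (P := weighted_derive_scal c f z Hz (B0_analytic _ f _ Hz)).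
assert (Hp := weighted_derive_pos f z Hz).
rewrite Rabs_pos_eq in H by exact Hp.
rewrite Rabs_pos_eq by (apply weighted_derive_pos, Hz).
eapply Rle_lt_trans; [exact P|].
apply (Rmult_lt_compat_r (Cmod c + 1)) in H; [|lra].
replace (eps / (Cmod c + 1) * (Cmod c + 1)) with (pos eps) in H by (field; lra).
nra.
Qed.

Definition B0_opp (f : B0 E) : B0 E := B0_scal (RtoC (-1)) f.

Definition B0_AbelianMonoid_mixin : AbelianMonoid.mixin_of (B0 E).
Proof.
apply (AbelianMonoid.Mixin (B0 E) B0_plus B0_zero); intros; apply B0_ext; intros w; simpl.
- apply plus_comm.
- apply plus_assoc.
- apply plus_zero_r.
Defined.

Canonical B0_AbelianMonoid :=
  AbelianMonoid.Pack (B0 E) B0_AbelianMonoid_mixin (B0 E).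

Lemma B0_plus_opp (f : B0 E) : plus f (B0_opp f) = zero.
Proof.
apply B0_ext; intros w; simpl.
assert (Hm : RtoC (-1) = (opp one : C_AbsRing)).
{ change (RtoC (-1) = Copp (RtoC 1)); rewrite <- RtoC_opp; f_equal; ring. }
rewrite Hm, (scal_opp_one (K := C_AbsRing) (V := E)).
exact (plus_opp_r (G := E) (f w)).
Qed.

Definition B0_AbelianGroup_mixin : AbelianGroup.mixin_of B0_AbelianMonoid :=
  AbelianGroup.Mixin B0_AbelianMonoid B0_opp B0_plus_opp.

Canonical B0_AbelianGroup :=
  AbelianGroup.Pack (B0 E)
    (AbelianGroup.Class _ B0_AbelianMonoid_mixin B0_AbelianGroup_mixin) (B0 E).

Definition B0_ModuleSpace_mixin : ModuleSpace.mixin_of C_Ring B0_AbelianGroup.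
Proof.
apply (ModuleSpace.Mixin C_Ring B0_AbelianGroup B0_scal);
  intros; apply B0_ext; intros w; simpl.
- apply (scal_assoc (K := C_AbsRing) (V := E)).
- apply (scal_one (K := C_AbsRing) (V := E)).
- apply (scal_distr_l (K := C_AbsRing) (V := E)).
- apply (scal_distr_r (K := C_AbsRing) (V := E)).
Defined.

Canonical B0_ModuleSpace :=
  ModuleSpace.Pack C_Ring (B0 E)
    (ModuleSpace.Class _ _ _ B0_ModuleSpace_mixin) (B0 E).

End B0_module.

(* Main.v *)
Require Import Defs.
From Stdlib Require Import Reals Lra Lia Psatz Classical ClassicalEpsilon.
From Stdlib Require Import FunctionalExtensionality List.
From Coquelicot Require Import Coquelicot.
From mathcomp Require filter.

(** Write [w_f z = (1 - |z|^2) f'(z)]; the norm of [f] is the maximum of [|w_f|].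

    Sufficiency rests on Schwarz's lemma. An automorphism of the disc is a Moebius map
    composed with a rotation ([automorphism_form]), so that it satisfies the equality
    [(1 - |z|^2) |s'(z)| = 1 - |s(z)|^2] ([schwarz_pick_equality]). For [T] of the given form
    the norm of [w_(T f)] at [z] is therefore that of [w_f] at [s z], which makes [T] an
    isometry; its inverse is of the same form.

    For necessity, the idea is that [T] preserves the points where the norm is
    differentiable. Take [f] with [w_f = peak a * u], where [u] is a unit vector: [|w_f|] has
    a strict maximum at [a]. As [E] is smooth, the norm of the Bloch space is
    differentiable at [f], with derivative [g -> Re (phi (w_g a))], where [phi] is the support
    functional of [u] ([peak_gateaux]). The norm has then the same derivative at [T f],
    read through [T]; but if [w_(T f)] attains its norm at [y], that derivative dominates an
    evaluation at [y] in the direction [w_(T f) y]. Hence [psi (w_(T g) y) = phi (w_g a)] for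
    every [g], where [psi] supports this direction ([transport]).

    The point [y] could still depend on [u]. If two directions gave distinct points [y1] and
    [y2], the sum of two support functionals would be transported to a combination of
    evaluations at [y1] and [y2]. On a finite-dimensional space the sum is a multiple of a
    support functional ([functional_on_span]), transported to an evaluation at a single
    point, and quadratic test functions distinguish the two ([transport_same_point]).
    So [y] depends on [a] only, [|w_(T g) y| = |w_g a|] for every [g] ([transport_norm]), and
    [a = s y] defines a bijection of the disc.

    Consequently [(T g)'(y) = A_y (g'(s y))] with [A_y] linear and a multiple of an isometry.
    The functions [z e] and [z^2 e / 2] give [A_y e] and [s(y) A_y e], which are derivatives:
    [s] is holomorphic, hence an automorphism, and the Schwarz-Pick equality shows that
    [A_y / s'(y)] is an isometry. It depends holomorphically on [y], so for each [e] a
    support functional at [y = 0] reaches its maximum modulus there and is constant;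
    strict convexity then makes [A_y e / s'(y)] itself constant. This is [S e], and the
    formula for [T] follows by integration ([isometry_is_transplant]).

    The function theory is built from complex differentiability alone. Goursat's
    bisection gives Cauchy's formula ([cauchy_formula]), which gives the
    differentiability of derivatives, the division by [z] and the maximum principles.
    Vector-valued functions are reached through support functionals, which compute the
    norm ([norming_exists]). All compactness arguments, including the weak-star one behind
    the differentiability of the norm of [E] ([smooth_gateaux]), are limits along one
    ultrafilter on the integers. *)


Open Scope R_scope.

(** * Limits along an ultrafilter *)

Lemma ultrafilter_exists : exists U : (nat -> Prop) -> Prop,
  (forall P Q : nat -> Prop, (forall n, P n -> Q n) -> U P -> U Q) /\
  (forall P Q, U P -> U Q -> U (fun n => P n /\ Q n)) /\
  (forall P, U P \/ U (fun n => ~ P n)) /\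
  ~ U (fun _ => False) /\
  (forall N, U (fun n => (N <= n)%nat)).
Proof.
set (F := fun P : nat -> Prop => exists N, forall n, (N <= n)%nat -> P n).
assert (HF : filter.ProperFilter F).
{ constructor.
  - intros [N HN]; exact (HN N (le_n N)).
  - constructor.
    + exists 0%nat; intros; exact I.
    + intros P Q [N HN] [M HM]; exists (N + M)%nat; intros n Hn; split;
        [apply HN | apply HM]; lia.
    + intros P Q HPQ [N HN]; exists N; intros n Hn; apply HPQ, HN, Hn. }
destruct (filter.ultraFilterLemma HF) as [G [HG HFG]].
assert (HP : filter.ProperFilter G) by (apply @filter.ultra_proper; exact HG).
assert (HF2 : filter.Filter G) by (apply @filter.filter_filter; exact HP).
exists G; repeat split.
- intros P Q H HPG; exact (@filter.filterS _ G HF2 P Q H HPG).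
- intros P Q H1 H2; exact (@filter.filterI _ G HF2 P Q H1 H2).
- intros P; exact (@filter.in_ultra_setVsetC _ G P HG).
- intros H; destruct (@filter.filter_ex _ G HP _ H) as [_ []].
- intros N; apply HFG; exists N; auto.
Qed.

(** One fixed nonprincipal ultrafilter replaces every passage to a subsequence,
    and also gives weak-star limits of bounded sequences of functionals, where
    subsequences would not suffice. *)
Definition mostly : (nat -> Prop) -> Prop :=
  proj1_sig (constructive_indefinite_description _ ultrafilter_exists).

Lemma mostly_spec :
  (forall P Q : nat -> Prop, (forall n, P n -> Q n) -> mostly P -> mostly Q) /\
  (forall P Q, mostly P -> mostly Q -> mostly (fun n => P n /\ Q n)) /\
  (forall P, mostly P \/ mostly (fun n => ~ P n)) /\
  ~ mostly (fun _ => False) /\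
  (forall N, mostly (fun n => (N <= n)%nat)).
Proof.
exact (proj2_sig (constructive_indefinite_description _ ultrafilter_exists)).
Qed.

Lemma mostly_imp (P Q : nat -> Prop) :
  (forall n, P n -> Q n) -> mostly P -> mostly Q.
Proof. apply mostly_spec. Qed.

Lemma mostly_and (P Q : nat -> Prop) :
  mostly P -> mostly Q -> mostly (fun n => P n /\ Q n).
Proof. apply mostly_spec. Qed.

Lemma mostly_or_not (P : nat -> Prop) : mostly P \/ mostly (fun n => ~ P n).
Proof. apply mostly_spec. Qed.

Lemma mostly_large (N : nat) : mostly (fun n => (N <= n)%nat).
Proof. apply mostly_spec. Qed.

Lemma mostly_ex (P : nat -> Prop) : mostly P -> exists n, P n.
Proof.
intros H; apply NNPP; intros HN.
apply (proj1 (proj2 (proj2 (proj2 mostly_spec)))).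
revert H; apply mostly_imp; intros n Hn; apply HN; exists n; exact Hn.
Qed.

Lemma mostly_all (P : nat -> Prop) : (forall n, P n) -> mostly P.
Proof.
intros H; apply (mostly_imp (fun n => (0 <= n)%nat)); [auto|apply mostly_large].
Qed.

Lemma mostly_inv_lt (eps : R) : 0 < eps -> mostly (fun n => / (INR n + 1) < eps).
Proof.
intros He; destruct (archimed_cor1 eps He) as [N [HN HN0]].
apply (mostly_imp (fun n => (N <= n)%nat)); [|apply mostly_large].
intros n Hn; eapply Rlt_trans; [|exact HN].
assert (0 < INR N) by (apply lt_0_INR; exact HN0).
assert (INR N <= INR n) by (apply le_INR; exact Hn).
apply Rinv_lt_contravar; [apply Rmult_lt_0_compat; lra|lra].
Qed.

Lemma bounded_ultralimit_R (x : nat -> R) (M : R) :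
  (forall n, Rabs (x n) <= M) ->
  exists l, forall eps, 0 < eps -> mostly (fun n => Rabs (x n - l) < eps).
Proof.
intros HM.
assert (HM' : forall n, - M <= x n <= M).
{ intros n; assert (H := HM n); revert H; unfold Rabs; destruct Rcase_abs; lra. }
set (A := fun a => mostly (fun n => a <= x n)).
assert (Hb : bound A).
{ exists M; intros a Ha; destruct (mostly_ex _ Ha) as [n Hn].
  destruct (HM' n); lra. }
assert (Hne : exists a, A a).
{ exists (- M); apply mostly_all; intros n; apply HM'. }
destruct (completeness A Hb Hne) as [l [Hl1 Hl2]].
exists l; intros eps He.
assert (H1 : mostly (fun n => l - eps < x n)).
{ apply NNPP; intros HN.
  assert (Hub : is_upper_bound A (l - eps)).
  { intros a Ha; apply Rnot_lt_le; intros Hlt; apply HN.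
    revert Ha; apply mostly_imp; intros n; lra. }
  specialize (Hl2 _ Hub); lra. }
assert (H2 : mostly (fun n => x n < l + eps)).
{ destruct (mostly_or_not (fun n => x n < l + eps)) as [H|H]; [exact H|].
  assert (Ha : A (l + eps)) by (revert H; apply mostly_imp; intros n; lra).
  specialize (Hl1 _ Ha); lra. }
generalize (mostly_and _ _ H1 H2); apply mostly_imp; intros n [Ha Hc].
apply Rabs_def1; lra.
Qed.

Definition ultralimit (x : nat -> C) (l : C) : Prop :=
  forall eps, 0 < eps -> mostly (fun n => Cmod (x n - l) < eps).

Lemma Cmod_le_abs (z : C) : Cmod z <= Rabs (fst z) + Rabs (snd z).
Proof.
assert (H : z = (RtoC (fst z) + Ci * RtoC (snd z))%C).
{ destruct z; unfold Cplus, Cmult, RtoC, Ci; simpl; f_equal; ring. }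
rewrite H at 1.
eapply Rle_trans; [apply Cmod_triangle|].
rewrite Cmod_mult, Cmod_Ci, !Cmod_R; lra.
Qed.

Lemma Cmod_triangle_minus (a b : C) : Cmod (a - b) <= Cmod a + Cmod b.
Proof.
unfold Cminus; eapply Rle_trans; [apply Cmod_triangle|rewrite Cmod_opp; lra].
Qed.

Lemma Cmod_minus_sym (a b : C) : Cmod (a - b) = Cmod (b - a).
Proof. rewrite <- Cmod_opp; f_equal; ring. Qed.

Lemma Cmod_minus_self (z : C) : Cmod (z - z) = 0.
Proof. replace (z - z)%C with (RtoC 0) by ring; apply Cmod_0. Qed.

Lemma Cminus_eq_0 (x y : C) : (x - y)%C = 0%C -> x = y.
Proof. intros H; replace x with (x - y + y)%C by ring; rewrite H; ring. Qed.

Lemma RtoC_neq_0 (r : R) : r <> 0 -> RtoC r <> 0%C.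
Proof. intros Hr H; exact (Hr (f_equal fst H)). Qed.

Lemma Cmod_minus_chain (a b c : C) : Cmod (a - c) <= Cmod (a - b) + Cmod (b - c).
Proof.
replace (a - c)%C with ((a - b) + (b - c))%C by ring; apply Cmod_triangle.
Qed.

Lemma Cmod_minus_ge (a b : C) : Cmod a - Cmod b <= Cmod (a - b).
Proof.
assert (H := Cmod_triangle (a - b) b).
replace (a - b + b)%C with a in H by ring; lra.
Qed.

Lemma Cmod_small_0 (z : C) : (forall eps, 0 < eps -> Cmod z <= eps) -> z = 0%C.
Proof.
intros H; apply Cmod_eq_0; apply Rle_antisym; [|apply Cmod_ge_0].
apply Rnot_lt_le; intros Hp; specialize (H (Cmod z / 2)); lra.
Qed.

Lemma bounded_ultralimit (x : nat -> C) (M : R) :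
  (forall n, Cmod (x n) <= M) -> exists l, ultralimit x l.
Proof.
intros HM.
assert (Hmax : forall n, Rabs (fst (x n)) <= M /\ Rabs (snd (x n)) <= M).
{ intros n; assert (H := Rmax_Cmod (x n)); assert (H2 := HM n).
  assert (H3 := Rmax_l (Rabs (fst (x n))) (Rabs (snd (x n)))).
  assert (H4 := Rmax_r (Rabs (fst (x n))) (Rabs (snd (x n)))).
  split; lra. }
destruct (bounded_ultralimit_R (fun n => fst (x n)) M) as [a Ha];
  [intros n; apply Hmax|].
destruct (bounded_ultralimit_R (fun n => snd (x n)) M) as [b Hb];
  [intros n; apply Hmax|].
exists (a, b); intros eps He.
generalize (mostly_and _ _ (Ha (eps / 2) ltac:(lra)) (Hb (eps / 2) ltac:(lra))).
apply mostly_imp; intros n [H1 H2].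
eapply Rle_lt_trans; [apply Cmod_le_abs|].
destruct (x n) as [u v]; simpl in *; unfold Rminus in *; lra.
Qed.

Lemma ultralimit_unique (x : nat -> C) (l m : C) :
  ultralimit x l -> ultralimit x m -> l = m.
Proof.
intros Hl Hm.
apply Cminus_eq_0, Cmod_small_0; intros eps He.
destruct (mostly_ex _ (mostly_and _ _ (Hl (eps / 2) ltac:(lra))
  (Hm (eps / 2) ltac:(lra)))) as [n [H1 H2]].
eapply Rle_trans; [apply (Cmod_minus_chain l (x n) m)|].
rewrite (Cmod_minus_sym l); lra.
Qed.

Lemma ultralimit_plus (x y : nat -> C) (l m : C) :
  ultralimit x l -> ultralimit y m -> ultralimit (fun n => x n + y n)%C (l + m)%C.
Proof.
intros Hl Hm eps He.
generalize (mostly_and _ _ (Hl (eps / 2) ltac:(lra)) (Hm (eps / 2) ltac:(lra))).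
apply mostly_imp; intros n [H1 H2].
replace (x n + y n - (l + m))%C with ((x n - l) + (y n - m))%C by ring.
eapply Rle_lt_trans; [apply Cmod_triangle|lra].
Qed.

Lemma ultralimit_scal (c : C) (x : nat -> C) (l : C) :
  ultralimit x l -> ultralimit (fun n => c * x n)%C (c * l)%C.
Proof.
intros Hl eps He; assert (Hc := Cmod_ge_0 c).
assert (Hq : 0 < eps / (Cmod c + 1)) by (apply Rdiv_lt_0_compat; lra).
generalize (Hl _ Hq); apply mostly_imp; intros n H1.
replace (c * x n - c * l)%C with (c * (x n - l))%C by ring; rewrite Cmod_mult.
apply (Rmult_lt_compat_r (Cmod c + 1)) in H1; [|lra].
replace (eps / (Cmod c + 1) * (Cmod c + 1)) with eps in H1 by (field; lra).
assert (H2 := Cmod_ge_0 (x n - l)); nra.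
Qed.

Lemma ultralimit_bound (x : nat -> C) (l : C) (M : R) :
  mostly (fun n => Cmod (x n) <= M) -> ultralimit x l -> Cmod l <= M.
Proof.
intros HM Hl; apply Rnot_lt_le; intros Hlt.
destruct (mostly_ex _ (mostly_and _ _ HM (Hl (Cmod l - M) ltac:(lra))))
  as [n [H1 H2]].
assert (H3 := Cmod_minus_ge l (x n)); rewrite Cmod_minus_sym in H3; lra.
Qed.

(** A maximizing sequence has an ultralimit, at which continuity gives the
    maximum; the supremum is a priori allowed to be infinite. *)
Lemma max_on_disc (g : C -> R) (r : R) : 0 <= r ->
  (forall z, Cmod z <= r -> forall eps, 0 < eps -> exists delta, 0 < delta /\
    forall w, Cmod w <= r -> Cmod (w - z) < delta -> Rabs (g w - g z) < eps) ->
  exists z, Cmod z <= r /\ forall w, Cmod w <= r -> g w <= g z.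
Proof.
intros Hr Hg.
set (A := fun x => exists z, Cmod z <= r /\ x = g z).
assert (HA : is_lub_Rbar A (Lub_Rbar A)) by apply Lub_Rbar_correct.
set (L := Lub_Rbar A) in *; destruct HA as [HA1 HA2].
assert (Hex : forall n : nat, exists z, Cmod z <= r /\
  Rbar_lt (match L with Finite l => Finite (l - / (INR n + 1)) | p_infty => INR n
           | m_infty => m_infty end) (g z)).
{ intros n; apply NNPP; intros HN.
  assert (Hub : is_ub_Rbar A (match L with Finite l => Finite (l - / (INR n + 1))
           | p_infty => INR n | m_infty => m_infty end)).
  { intros x [z [Hz ->]]; apply Rbar_not_lt_le; intros Hlt; apply HN.
    exists z; split; assumption. }
  specialize (HA2 _ Hub).
  destruct L as [l| |]; simpl in HA2; [|contradiction|].
  - assert (0 < / (INR n + 1)) by (apply Rinv_0_lt_compat; assert (H := pos_INR n); lra).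
    lra.
  - assert (H0 : A (g 0%C)) by (exists 0%C; rewrite Cmod_0; auto).
    apply HA1 in H0; exact H0. }
destruct (choice _ Hex) as [x Hx].
destruct (bounded_ultralimit x r) as [z Hz]; [intros n; apply Hx|].
assert (Hzr : Cmod z <= r).
{ apply (ultralimit_bound x); [apply mostly_all; intros n; apply Hx|exact Hz]. }
exists z; split; [exact Hzr|]; intros w Hw.
assert (Hwl : Rbar_le (g w) L) by (apply HA1; exists w; auto).
apply le_epsilon; intros eps He.
destruct (Hg z Hzr (eps / 2) ltac:(lra)) as [d [Hd Hd2]].
assert (Hc : mostly (fun n => g (x n) < g z + eps / 2)).
{ generalize (Hz d Hd); apply mostly_imp; intros n Hn.
  specialize (Hd2 (x n) (proj1 (Hx n)) Hn); apply Rabs_def2 in Hd2; lra. }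
destruct L as [l| |].
- destruct (mostly_ex _ (mostly_and _ _ Hc (mostly_inv_lt (eps / 2) ltac:(lra))))
    as [n [H1 H2]].
  assert (H3 := proj2 (Hx n)); simpl in H3, Hwl; lra.
- assert (HN : mostly (fun n => g z + eps / 2 <= INR n)).
  { destruct (nfloor_ex (Rabs (g z + eps / 2)) (Rabs_pos _)) as [N [_ HN]].
    apply (mostly_imp (fun n => (S N <= n)%nat)); [|apply mostly_large].
    intros n Hn; apply le_INR in Hn; rewrite S_INR in Hn.
    assert (H := Rle_abs (g z + eps / 2)); lra. }
  destruct (mostly_ex _ (mostly_and _ _ Hc HN)) as [n [H1 H2]].
  assert (H3 := proj2 (Hx n)); simpl in H3; lra.
- contradiction.
Qed.

(** * Complex derivatives *)

Lemma is_derive_C_iff {V : NormedModule C_AbsRing} (f : C -> V) (z : C) (l : V) :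
  is_derive (K := C_AbsRing) f z l <->
  forall eps, 0 < eps -> exists delta, 0 < delta /\ forall w, Cmod (w - z) < delta ->
    norm (minus (minus (f w) (f z)) (scal ((w - z)%C : C_AbsRing) l))
      <= eps * Cmod (w - z).
Proof.
split.
- intros [_ H] eps He.
  specialize (H z (fun P HP => HP) (mkposreal _ He)); simpl in H.
  apply (locally_le_locally_norm (K := C_AbsRing)
    (V := AbsRing_NormedModule C_AbsRing)) in H.
  destruct H as [d Hd]; exists d; split; [apply cond_pos|].
  intros w Hw; exact (Hd w Hw).
- intros H; split; [apply is_linear_scal_l|].
  intros x Hx eps.
  apply (is_filter_lim_locally_unique (K := C_AbsRing)
    (V := AbsRing_NormedModule C_AbsRing)) in Hx; subst x.
  apply (locally_le_locally_norm (K := C_AbsRing)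
    (V := AbsRing_NormedModule C_AbsRing)).
  destruct (H eps (cond_pos eps)) as [d [Hd H2]].
  exists (mkposreal d Hd); intros w Hw; exact (H2 w Hw).
Qed.

Definition cder (f : C -> C) (z l : C) : Prop :=
  forall eps, 0 < eps -> exists delta, 0 < delta /\ forall w, Cmod (w - z) < delta ->
    Cmod (f w - f z - l * (w - z)) <= eps * Cmod (w - z).

Lemma is_derive_C_cder (f : C -> C) (z l : C) :
  is_derive (K := C_AbsRing) (V := C_NormedModule) f z l <-> cder f z l.
Proof.
assert (E : forall w, @norm C_AbsRing C_NormedModule
    (minus (minus (f w) (f z)) (scal ((w - z)%C : C_AbsRing) l))
  = Cmod (f w - f z - l * (w - z))).
{ intros w.
  change (Cmod (f w - f z - (w - z) * l) = Cmod (f w - f z - l * (w - z))).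
  f_equal; ring. }
split.
- intros H eps He; destruct (proj1 (is_derive_C_iff _ _ _) H eps He) as [d [Hd H2]].
  exists d; split; [exact Hd|]; intros w Hw; rewrite <- E; apply H2, Hw.
- intros H; apply is_derive_C_iff; intros eps He.
  destruct (H eps He) as [d [Hd H2]].
  exists d; split; [exact Hd|]; intros w Hw; rewrite E; apply H2, Hw.
Qed.

Definition ccont (f : C -> C) (z : C) : Prop :=
  forall eps, 0 < eps -> exists delta, 0 < delta /\ forall w, Cmod (w - z) < delta ->
    Cmod (f w - f z) < eps.

Lemma ccont_bounded (f : C -> C) (z : C) : ccont f z ->
  exists delta, 0 < delta /\ forall w, Cmod (w - z) < delta ->
    Cmod (f w) <= Cmod (f z) + 1.
Proof.
intros H; destruct (H 1 Rlt_0_1) as [d [Hd H1]]; exists d; split; [exact Hd|].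
intros w Hw; specialize (H1 w Hw); assert (H2 := Cmod_minus_ge (f w) (f z)); lra.
Qed.

Lemma ccont_ext_loc (f g : C -> C) (z : C) :
  (exists delta, 0 < delta /\ forall w, Cmod (w - z) < delta -> f w = g w) ->
  ccont f z -> ccont g z.
Proof.
intros [d [Hd H]] Hf eps He; destruct (Hf eps He) as [d2 [Hd2 H2]].
exists (Rmin d d2); split; [apply Rmin_pos; assumption|]; intros w Hw.
rewrite <- !H.
- apply H2; eapply Rlt_le_trans; [exact Hw|apply Rmin_r].
- rewrite Cmod_minus_self; exact Hd.
- eapply Rlt_le_trans; [exact Hw|apply Rmin_l].
Qed.

(** Derivatives are handled through the continuous slope of Caratheodory, which
    turns the rules of calculus into rules for continuous functions. *)
Lemma cder_slope (f : C -> C) (z l : C) :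
  cder f z l <-> exists q : C -> C, ccont q z /\ q z = l /\
    forall w, (f w = f z + q w * (w - z))%C.
Proof.
split.
- intros H.
  exists (fun w => if excluded_middle_informative (w = z) then l
                   else ((f w - f z) / (w - z))%C).
  repeat split.
  + intros eps He.
    destruct (H (eps / 2) ltac:(lra)) as [d [Hd H2]].
    exists d; split; [exact Hd|]; intros w Hw.
    destruct (excluded_middle_informative (z = z)) as [_|n]; [|now elim n].
    destruct (excluded_middle_informative (w = z)) as [->|n].
    * rewrite Cmod_minus_self; exact He.
    * assert (Hne : (w - z)%C <> 0%C).
      { intros E; apply n; replace w with (w - z + z)%C by ring; rewrite E; ring. }
      replace ((f w - f z) / (w - z) - l)%C
        with ((f w - f z - l * (w - z)) / (w - z))%C by (field; exact Hne).
      rewrite Cmod_div by exact Hne.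
      assert (Hp := proj1 (Cmod_gt_0 _) Hne).
      specialize (H2 w Hw).
      apply Rle_lt_trans with (eps / 2); [|lra].
      apply Rmult_le_reg_r with (Cmod (w - z)); [exact Hp|].
      replace (Cmod (f w - f z - l * (w - z)) / Cmod (w - z) * Cmod (w - z))
        with (Cmod (f w - f z - l * (w - z))) by (field; lra).
      exact H2.
  + destruct (excluded_middle_informative (z = z)) as [_|n]; [reflexivity|now elim n].
  + intros w; destruct (excluded_middle_informative (w = z)) as [->|n]; [ring|].
    assert (Hne : (w - z)%C <> 0%C) by (intros E; apply n, Cminus_eq_0, E).
    field; exact Hne.
- intros [q [Hq [<- Hf]]] eps He; destruct (Hq eps He) as [d [Hd H2]].
  exists d; split; [exact Hd|]; intros w Hw.
  replace (f w - f z - q z * (w - z))%C with ((q w - q z) * (w - z))%C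
    by (rewrite (Hf w); ring).
  rewrite Cmod_mult; apply Rmult_le_compat_r; [apply Cmod_ge_0|].
  apply Rlt_le, H2, Hw.
Qed.

Lemma ccont_const (c z : C) : ccont (fun _ => c) z.
Proof.
intros eps He; exists 1; split; [lra|]; intros w _.
rewrite Cmod_minus_self; exact He.
Qed.

Lemma ccont_id (z : C) : ccont (fun w => w) z.
Proof. intros eps He; exists eps; split; auto. Qed.

Lemma ccont_plus (f g : C -> C) (z : C) :
  ccont f z -> ccont g z -> ccont (fun w => f w + g w)%C z.
Proof.
intros Hf Hg eps He.
destruct (Hf (eps / 2) ltac:(lra)) as [d1 [Hd1 H1]].
destruct (Hg (eps / 2) ltac:(lra)) as [d2 [Hd2 H2]].
exists (Rmin d1 d2); split; [apply Rmin_pos; assumption|]; intros w Hw.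
specialize (H1 w (Rlt_le_trans _ _ _ Hw (Rmin_l _ _))).
specialize (H2 w (Rlt_le_trans _ _ _ Hw (Rmin_r _ _))).
replace (f w + g w - (f z + g z))%C with ((f w - f z) + (g w - g z))%C by ring.
eapply Rle_lt_trans; [apply Cmod_triangle|lra].
Qed.

Lemma ccont_mult (f g : C -> C) (z : C) :
  ccont f z -> ccont g z -> ccont (fun w => f w * g w)%C z.
Proof.
intros Hf Hg eps He.
destruct (ccont_bounded f z Hf) as [d0 [Hd0 H0]].
set (A := Cmod (f z) + 1) in *; set (B := Cmod (g z) + 1).
assert (HA : 0 < A) by (unfold A; assert (H := Cmod_ge_0 (f z)); lra).
assert (HB : 0 < B) by (unfold B; assert (H := Cmod_ge_0 (g z)); lra).
assert (HeA : 0 < eps / (2 * A)) by (apply Rdiv_lt_0_compat; lra).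
assert (HeB : 0 < eps / (2 * B)) by (apply Rdiv_lt_0_compat; lra).
destruct (Hf _ HeB) as [d1 [Hd1 H1]].
destruct (Hg _ HeA) as [d2 [Hd2 H2]].
exists (Rmin d0 (Rmin d1 d2)); split; [repeat apply Rmin_pos; assumption|].
intros w Hw.
assert (K0 := Rmin_l d0 (Rmin d1 d2)); assert (K1 := Rmin_r d0 (Rmin d1 d2)).
assert (K2 := Rmin_l d1 d2); assert (K3 := Rmin_r d1 d2).
specialize (H0 w ltac:(lra)); specialize (H1 w ltac:(lra)); specialize (H2 w ltac:(lra)).
replace (f w * g w - f z * g z)%C
  with (f w * (g w - g z) + (f w - f z) * g z)%C by ring.
eapply Rle_lt_trans; [apply Cmod_triangle|]; rewrite !Cmod_mult.
assert (Hgz : Cmod (g z) <= B) by (unfold B; lra).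
assert (P1 : Cmod (f w) * Cmod (g w - g z) <= A * Cmod (g w - g z))
  by (apply Rmult_le_compat_r; [apply Cmod_ge_0|exact H0]).
assert (P2 : A * Cmod (g w - g z) < A * (eps / (2 * A)))
  by (apply Rmult_lt_compat_l; assumption).
assert (P3 : Cmod (f w - f z) * Cmod (g z) <= Cmod (f w - f z) * B)
  by (apply Rmult_le_compat_l; [apply Cmod_ge_0|exact Hgz]).
assert (P4 : Cmod (f w - f z) * B < eps / (2 * B) * B)
  by (apply Rmult_lt_compat_r; assumption).
replace (A * (eps / (2 * A))) with (eps / 2) in P2 by (field; lra).
replace (eps / (2 * B) * B) with (eps / 2) in P4 by (field; lra).
lra.
Qed.

Lemma ccont_comp (f g : C -> C) (z : C) :
  ccont f z -> ccont g (f z) -> ccont (fun w => g (f w)) z.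
Proof.
intros Hf Hg eps He; destruct (Hg eps He) as [d1 [Hd1 H1]].
destruct (Hf d1 Hd1) as [d2 [Hd2 H2]]; exists d2; split; auto.
Qed.

Lemma ccont_inv (z : C) : z <> 0%C -> ccont Cinv z.
Proof.
intros Hz eps He; assert (Hp := proj1 (Cmod_gt_0 _) Hz).
set (m := Cmod z) in *.
assert (Hd : 0 < Rmin (m / 2) (eps * m * m / 4)).
{ apply Rmin_pos; [lra|]. repeat apply Rmult_lt_0_compat; lra. }
exists (Rmin (m / 2) (eps * m * m / 4)); split; [exact Hd|]; intros w Hw.
assert (K1 := Rmin_l (m / 2) (eps * m * m / 4)).
assert (K2 := Rmin_r (m / 2) (eps * m * m / 4)).
assert (Hwm : m / 2 <= Cmod w).
{ assert (H := Cmod_minus_ge z w); rewrite Cmod_minus_sym in H; unfold m in *; lra. }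
assert (Hw0 : w <> 0%C) by (intros E; rewrite E, Cmod_0 in Hwm; lra).
replace (/ w - / z)%C with (- ((w - z) / (w * z)))%C by (field; split; assumption).
rewrite Cmod_opp, Cmod_div, Cmod_mult by (apply Cmult_neq_0; assumption).
fold m.
apply Rmult_lt_reg_r with (Cmod w * m); [apply Rmult_lt_0_compat; lra|].
replace (Cmod (w - z) / (Cmod w * m) * (Cmod w * m)) with (Cmod (w - z))
  by (field; split; lra).
apply Rlt_le_trans with (eps * (m / 2 * m)); [|].
- replace (eps * (m / 2 * m)) with (2 * (eps * m * m / 4)) by field.
  assert (0 < eps * m * m / 4) by (repeat apply Rmult_lt_0_compat; lra); lra.
- apply Rmult_le_compat_l; [lra|]; apply Rmult_le_compat_r; lra.
Qed.

Lemma cder_ccont (f : C -> C) (z l : C) : cder f z l -> ccont f z.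
Proof.
intros H; apply cder_slope in H; destruct H as [q [Hq [_ Hf]]].
apply (ccont_ext_loc (fun w => f z + q w * (w - z))%C).
{ exists 1; split; [lra|]; intros w _; symmetry; apply Hf. }
apply ccont_plus; [apply ccont_const|].
apply ccont_mult; [exact Hq|].
apply (ccont_plus (fun w => w) (fun _ => - z)%C); [apply ccont_id|apply ccont_const].
Qed.

Lemma cder_ext_loc (f g : C -> C) (z l : C) :
  (exists delta, 0 < delta /\ forall w, Cmod (w - z) < delta -> f w = g w) ->
  cder f z l -> cder g z l.
Proof.
intros [d [Hd H]] Hf eps He; destruct (Hf eps He) as [d2 [Hd2 H2]].
exists (Rmin d d2); split; [apply Rmin_pos; assumption|]; intros w Hw.
rewrite <- !H.
- apply H2; eapply Rlt_le_trans; [exact Hw|apply Rmin_r].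
- rewrite Cmod_minus_self; exact Hd.
- eapply Rlt_le_trans; [exact Hw|apply Rmin_l].
Qed.

Lemma cder_unique (f : C -> C) (z l m : C) : cder f z l -> cder f z m -> l = m.
Proof.
intros Hl Hm.
apply Cminus_eq_0, Cmod_small_0; intros eps He.
destruct (Hl (eps / 2) ltac:(lra)) as [d1 [Hd1 H1]].
destruct (Hm (eps / 2) ltac:(lra)) as [d2 [Hd2 H2]].
set (d := Rmin d1 d2 / 2).
assert (K1 := Rmin_l d1 d2); assert (K2 := Rmin_r d1 d2).
assert (Hd : 0 < d) by (unfold d; assert (0 < Rmin d1 d2) by (apply Rmin_pos; lra); lra).
assert (Hz : Cmod (z + RtoC d - z) = d).
{ replace (z + RtoC d - z)%C with (RtoC d) by ring.
  rewrite Cmod_R; apply Rabs_pos_eq; lra. }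
specialize (H1 (z + RtoC d)%C); specialize (H2 (z + RtoC d)%C).
rewrite Hz in H1, H2.
specialize (H1 ltac:(unfold d in *; lra)); specialize (H2 ltac:(unfold d in *; lra)).
set (D := (f (z + RtoC d) - f z)%C) in *.
apply Rmult_le_reg_r with d; [exact Hd|].
assert (E : Cmod (l - m) * d = Cmod ((D - m * (z + RtoC d - z)) - (D - l * (z + RtoC d - z)))).
{ rewrite <- Hz at 1; rewrite <- Cmod_mult; f_equal; ring. }
rewrite E; eapply Rle_trans; [apply Cmod_triangle_minus|lra].
Qed.

Lemma cder_const (c z : C) : cder (fun _ => c) z 0%C.
Proof.
intros eps He; exists 1; split; [lra|]; intros w _.
replace (c - c - 0 * (w - z))%C with (RtoC 0) by ring; rewrite Cmod_0.
apply Rmult_le_pos; [lra|apply Cmod_ge_0].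
Qed.

Lemma cder_id (z : C) : cder (fun w => w) z 1%C.
Proof.
intros eps He; exists 1; split; [lra|]; intros w _.
replace (w - z - 1 * (w - z))%C with (RtoC 0) by ring; rewrite Cmod_0.
apply Rmult_le_pos; [lra|apply Cmod_ge_0].
Qed.

Lemma cder_plus (f g : C -> C) (z l m : C) :
  cder f z l -> cder g z m -> cder (fun w => f w + g w)%C z (l + m)%C.
Proof.
intros Hf Hg; apply cder_slope in Hf; apply cder_slope in Hg; apply cder_slope.
destruct Hf as [p [Hp [Ep Hf]]], Hg as [q [Hq [Eq Hg]]].
exists (fun w => p w + q w)%C; repeat split.
- apply ccont_plus; assumption.
- rewrite Ep, Eq; reflexivity.
- intros w; rewrite (Hf w), (Hg w); ring.
Qed.

Lemma cder_mult (f g : C -> C) (z l m : C) :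
  cder f z l -> cder g z m -> cder (fun w => f w * g w)%C z (l * g z + f z * m)%C.
Proof.
intros Hf Hg; assert (Hc := cder_ccont _ _ _ Hg).
apply cder_slope in Hf; apply cder_slope in Hg; apply cder_slope.
destruct Hf as [p [Hp [Ep Hf]]], Hg as [q [Hq [Eq Hg]]].
exists (fun w => p w * g w + f z * q w)%C; repeat split.
- apply ccont_plus; apply ccont_mult; auto using ccont_const.
- rewrite Ep, Eq; reflexivity.
- intros w; rewrite (Hf w), (Hg w); ring.
Qed.

Lemma cder_scal (c : C) (f : C -> C) (z l : C) :
  cder f z l -> cder (fun w => c * f w)%C z (c * l)%C.
Proof.
intros H; replace (c * l)%C with (0 * f z + c * l)%C by ring.
apply cder_mult; [apply cder_const|exact H].
Qed.

Lemma cder_comp (f g : C -> C) (z l m : C) :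
  cder f z l -> cder g (f z) m -> cder (fun w => g (f w)) z (m * l)%C.
Proof.
intros Hf Hg; assert (Hc := cder_ccont _ _ _ Hf).
apply cder_slope in Hf; apply cder_slope in Hg; apply cder_slope.
destruct Hf as [p [Hp [Ep Hf]]], Hg as [q [Hq [Eq Hg]]].
exists (fun w => q (f w) * p w)%C; repeat split.
- apply ccont_mult; [apply (ccont_comp f q)|]; assumption.
- rewrite Ep, Eq; reflexivity.
- intros w; rewrite (Hg (f w)), (Hf w); ring.
Qed.

Lemma cder_inv (f : C -> C) (z l : C) :
  f z <> 0%C -> cder f z l -> cder (fun w => / f w)%C z (- l / (f z * f z))%C.
Proof.
intros Hz Hf; replace (- l / (f z * f z))%C with (- / (f z * f z) * l)%C
  by (field; exact Hz).
apply (cder_comp f Cinv); [exact Hf|].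
set (b := f z) in *.
assert (H0 := ccont_inv b Hz).
(* Off the point 0 the inverse is [/ b] plus its slope [- (/ w * / b)] times [w - b]. *)
apply (cder_ext_loc (fun w => / b + - (/ w * / b) * (w - b))%C).
{ exists (Cmod b); split; [apply Cmod_gt_0; exact Hz|]; intros w Hw.
  assert (Hw0 : w <> 0%C).
  { intros ->; replace (0 - b)%C with (- b)%C in Hw by ring.
    rewrite Cmod_opp in Hw; lra. }
  field; split; assumption. }
apply cder_slope; exists (fun w => - (/ w * / b))%C; repeat split.
- apply (ccont_ext_loc (fun w => - / b * / w)%C).
  { exists 1; split; [lra|]; intros; ring. }
  apply ccont_mult; [apply ccont_const|exact H0].
- field; exact Hz.
- intros w; ring.
Qed.

Definition holo (f : C -> C) : Prop :=
  forall z, unit_disc z -> exists l, cder f z l.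

Lemma holo_analytic (f : C -> C) :
  holo f <-> analytic_on_disc (V := C_NormedModule) f.
Proof.
split; intros H z Hz; destruct (H z Hz) as [l Hl]; exists l;
  apply is_derive_C_cder; exact Hl.
Qed.

Lemma holo_const (c : C) : holo (fun _ => c).
Proof. intros z _; exists 0%C; apply cder_const. Qed.

Lemma holo_mult (f g : C -> C) : holo f -> holo g -> holo (fun w => f w * g w)%C.
Proof.
intros Hf Hg z Hz; destruct (Hf z Hz) as [l Hl], (Hg z Hz) as [m Hm].
eexists; apply cder_mult; eassumption.
Qed.

Lemma holo_inv (f : C -> C) :
  (forall z, unit_disc z -> f z <> 0%C) -> holo f -> holo (fun w => / f w)%C.
Proof.
intros H0 Hf z Hz; destruct (Hf z Hz) as [l Hl].
eexists; apply cder_inv; [apply H0, Hz|exact Hl].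
Qed.

Lemma holo_comp (f g : C -> C) :
  (forall z, unit_disc z -> unit_disc (f z)) -> holo f -> holo g ->
  holo (fun w => g (f w)).
Proof.
intros H0 Hf Hg z Hz; destruct (Hf z Hz) as [l Hl], (Hg _ (H0 z Hz)) as [m Hm].
eexists; apply cder_comp; eassumption.
Qed.

Lemma unit_disc_nbhd (z : C) : unit_disc z ->
  exists delta, 0 < delta /\ forall w, Cmod (w - z) < delta -> unit_disc w.
Proof.
unfold unit_disc; intros Hz; exists (1 - Cmod z); split; [lra|]; intros w Hw.
assert (H := Cmod_minus_ge w z); lra.
Qed.

Lemma holo_ext (f g : C -> C) :
  (forall z, unit_disc z -> f z = g z) -> holo f -> holo g.
Proof.
intros E Hf z Hz; destruct (Hf z Hz) as [l Hl]; exists l.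
destruct (unit_disc_nbhd z Hz) as [d [Hd H]].
apply (cder_ext_loc f); [|exact Hl].
exists d; split; [exact Hd|]; intros w Hw; apply E, H, Hw.
Qed.

(** * Integrals of complex functions of a real variable *)

(** Continuity on the line is continuity on the plane of a function of the real part,
    so that it inherits the rules of the plane. *)
Definition rcont (f : R -> C) (t : R) : Prop := ccont (fun z => f (fst z)) (RtoC t).

Lemma rcont_iff (f : R -> C) (t : R) : rcont f t <->
  forall eps, 0 < eps -> exists delta, 0 < delta /\ forall s, Rabs (s - t) < delta ->
    Cmod (f s - f t) < eps.
Proof.
split; intros H eps He; destruct (H eps He) as [d [Hd H1]]; exists d; (split; [exact Hd|]).
- intros s Hs; apply (H1 (RtoC s)); rewrite <- RtoC_minus, Cmod_R; exact Hs.
- intros z Hz; apply H1; eapply Rle_lt_trans; [|exact Hz]; apply (re_le_Cmod (z - RtoC t)).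
Qed.

Lemma rcont_pair (a b : R -> R) (t : R) :
  continuous a t -> continuous b t -> rcont (fun s => (a s, b s)) t.
Proof.
intros Ha Hb; apply rcont_iff; intros eps He.
assert (He2 : 0 < eps / 2) by lra.
destruct (proj1 (filterlim_locally a (a t)) Ha (mkposreal _ He2)) as [d1 H1].
destruct (proj1 (filterlim_locally b (b t)) Hb (mkposreal _ He2)) as [d2 H2].
exists (Rmin d1 d2); split; [apply Rmin_pos; apply cond_pos|]; intros s Hs.
specialize (H1 s (Rlt_le_trans _ _ _ Hs (Rmin_l _ _))).
specialize (H2 s (Rlt_le_trans _ _ _ Hs (Rmin_r _ _))).
change (Rabs (a s - a t) < eps / 2) in H1.
change (Rabs (b s - b t) < eps / 2) in H2.
eapply Rle_lt_trans; [apply Cmod_le_abs|].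
simpl; unfold Rminus in *; lra.
Qed.

(** The common form of the continuity of the components and of the modulus. *)
Lemma rcont_continuous (f : R -> C) (g : C -> R) (t : R) :
  (forall z w, Rabs (g z - g w) <= Cmod (z - w)) -> rcont f t ->
  continuous (fun s => g (f s)) t.
Proof.
intros Hg H; apply filterlim_locally; intros eps.
destruct (proj1 (rcont_iff f t) H eps (cond_pos eps)) as [d [Hd H1]].
exists (mkposreal d Hd); intros s Hs; specialize (H1 s Hs).
change (Rabs (g (f s) - g (f t)) < eps).
eapply Rle_lt_trans; [apply Hg|exact H1].
Qed.

Lemma rcont_fst (f : R -> C) (t : R) : rcont f t -> continuous (fun s => fst (f s)) t.
Proof. apply rcont_continuous; intros z w; apply (re_le_Cmod (z - w)). Qed.

Lemma rcont_snd (f : R -> C) (t : R) : rcont f t -> continuous (fun s => snd (f s)) t.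
Proof.
apply rcont_continuous; intros z w.
eapply Rle_trans; [|apply Rmax_Cmod]; apply Rmax_r.
Qed.

Lemma rcont_comp (f : R -> C) (g : C -> C) (t : R) :
  rcont f t -> ccont g (f t) -> rcont (fun s => g (f s)) t.
Proof. apply (ccont_comp (fun z => f (fst z)) g). Qed.

Lemma rcont_const (c : C) (t : R) : rcont (fun _ => c) t.
Proof. apply ccont_const. Qed.

Lemma rcont_plus (f g : R -> C) (t : R) :
  rcont f t -> rcont g t -> rcont (fun s => f s + g s)%C t.
Proof. apply (ccont_plus (fun z => f (fst z)) (fun z => g (fst z))). Qed.

Lemma rcont_mult (f g : R -> C) (t : R) :
  rcont f t -> rcont g t -> rcont (fun s => f s * g s)%C t.
Proof. apply (ccont_mult (fun z => f (fst z)) (fun z => g (fst z))). Qed.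

Lemma rcont_scal (c : C) (f : R -> C) (t : R) :
  rcont f t -> rcont (fun s => c * f s)%C t.
Proof. apply rcont_mult, rcont_const. Qed.

Lemma rcont_minus (f g : R -> C) (t : R) :
  rcont f t -> rcont g t -> rcont (fun s => f s - g s)%C t.
Proof.
intros Hf Hg; apply rcont_plus; [exact Hf|].
apply (rcont_comp g Copp); [exact Hg|].
intros eps He; exists eps; split; [exact He|]; intros w Hw.
replace (- w - - g t)%C with (- (w - g t))%C by ring; rewrite Cmod_opp; exact Hw.
Qed.

Lemma rcont_inv (f : R -> C) (t : R) :
  f t <> 0%C -> rcont f t -> rcont (fun s => / f s)%C t.
Proof.
intros H0 Hf; apply (rcont_comp f Cinv); [exact Hf|apply ccont_inv, H0].
Qed.

Definition cint (f : R -> C) (a b : R) : C :=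
  (RInt (fun t => fst (f t)) a b, RInt (fun t => snd (f t)) a b).

Definition cont_on (f : R -> C) (a b : R) : Prop := forall t, a <= t <= b -> rcont f t.

Lemma cont_on_fst (f : R -> C) (a b : R) :
  a <= b -> cont_on f a b -> ex_RInt (fun t => fst (f t)) a b.
Proof.
intros Hab H; apply (ex_RInt_continuous (V := R_CompleteNormedModule)).
intros t; rewrite Rmin_left, Rmax_right by exact Hab; intros Ht.
apply rcont_fst, H, Ht.
Qed.

Lemma cont_on_snd (f : R -> C) (a b : R) :
  a <= b -> cont_on f a b -> ex_RInt (fun t => snd (f t)) a b.
Proof.
intros Hab H; apply (ex_RInt_continuous (V := R_CompleteNormedModule)).
intros t; rewrite Rmin_left, Rmax_right by exact Hab; intros Ht.
apply rcont_snd, H, Ht.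
Qed.

Lemma cont_on_sub (f : R -> C) (a b c d : R) :
  cont_on f a b -> a <= c -> d <= b -> cont_on f c d.
Proof. intros H Hac Hdb t Ht; apply H; lra. Qed.

Lemma cint_ext (f g : R -> C) (a b : R) : a <= b ->
  (forall t, a <= t <= b -> f t = g t) -> cint f a b = cint g a b.
Proof.
intros Hab H; unfold cint; f_equal; apply RInt_ext; intros t;
  rewrite Rmin_left, Rmax_right by exact Hab; intros Ht; rewrite H; auto; lra.
Qed.

Lemma cint_chasles (f : R -> C) (a b c : R) : a <= b -> b <= c ->
  cont_on f a c -> cint f a c = (cint f a b + cint f b c)%C.
Proof.
intros Hab Hbc H.
assert (H1 : cont_on f a b) by (apply (cont_on_sub f a c); auto; lra).
assert (H2 : cont_on f b c) by (apply (cont_on_sub f a c); auto; lra).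
unfold cint, Cplus; simpl; f_equal; symmetry;
  apply (RInt_Chasles (V := R_CompleteNormedModule));
  auto using cont_on_fst, cont_on_snd.
Qed.

Lemma cint_plus (f g : R -> C) (a b : R) : a <= b ->
  cont_on f a b -> cont_on g a b ->
  cint (fun t => f t + g t)%C a b = (cint f a b + cint g a b)%C.
Proof.
intros Hab Hf Hg; unfold cint, Cplus; simpl; f_equal;
  apply (RInt_plus (V := R_CompleteNormedModule));
  auto using cont_on_fst, cont_on_snd.
Qed.

Lemma cint_scal (c : C) (f : R -> C) (a b : R) : a <= b -> cont_on f a b ->
  cint (fun t => c * f t)%C a b = (c * cint f a b)%C.
Proof.
intros Hab Hf.
assert (H1 := cont_on_fst f a b Hab Hf); assert (H2 := cont_on_snd f a b Hab Hf).
destruct c as [p q]; unfold cint, Cmult; simpl; f_equal.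
- rewrite (RInt_minus (V := R_CompleteNormedModule)
    (fun t => p * fst (f t)) (fun t => q * snd (f t)));
    try (apply (ex_RInt_scal (V := R_CompleteNormedModule)); assumption).
  rewrite !(RInt_scal (V := R_CompleteNormedModule)) by assumption; reflexivity.
- rewrite (RInt_plus (V := R_CompleteNormedModule)
    (fun t => p * snd (f t)) (fun t => q * fst (f t)));
    try (apply (ex_RInt_scal (V := R_CompleteNormedModule)); assumption).
  rewrite !(RInt_scal (V := R_CompleteNormedModule)) by assumption; reflexivity.
Qed.

Lemma cont_on_scal (c : C) (f : R -> C) (a b : R) :
  cont_on f a b -> cont_on (fun t => c * f t)%C a b.
Proof. intros H t Ht; apply rcont_scal, H, Ht. Qed.

Lemma cont_on_minus (f g : R -> C) (a b : R) :
  cont_on f a b -> cont_on g a b -> cont_on (fun t => f t - g t)%C a b.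
Proof. intros H H1 t Ht; apply rcont_minus; auto. Qed.

Lemma cint_minus (f g : R -> C) (a b : R) : a <= b ->
  cont_on f a b -> cont_on g a b ->
  cint (fun t => f t - g t)%C a b = (cint f a b - cint g a b)%C.
Proof.
intros Hab Hf Hg; unfold cint, Cminus, Copp, Cplus; simpl; f_equal;
  apply (RInt_minus (V := R_CompleteNormedModule));
  auto using cont_on_fst, cont_on_snd.
Qed.

(** Rotating the integral onto the positive axis reduces the triangle inequality
    to the monotonicity of a real integral. *)
Lemma cint_bound (f : R -> C) (a b M : R) : a <= b -> cont_on f a b ->
  (forall t, a <= t <= b -> Cmod (f t) <= M) -> Cmod (cint f a b) <= M * (b - a).
Proof.
intros Hab Hf HM.
assert (HM0 : 0 <= M) by (eapply Rle_trans; [apply Cmod_ge_0|apply (HM a); lra]).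
destruct (classic (cint f a b = 0%C)) as [E|Hne].
{ rewrite E, Cmod_0; apply Rmult_le_pos; lra. }
set (I := cint f a b) in *.
assert (Hp := proj1 (Cmod_gt_0 _) Hne).
set (c := (Cconj I / RtoC (Cmod I))%C).
assert (HI0 : RtoC (Cmod I) <> 0%C).
{ intros E; apply (f_equal fst) in E; simpl in E; lra. }
assert (Hc : Cmod c = 1).
{ unfold c; rewrite Cmod_div by exact HI0.
  rewrite Cmod_conj, Cmod_R, Rabs_pos_eq by lra; field; lra. }
assert (HcI : (c * I)%C = RtoC (Cmod I)).
{ unfold c; replace (Cconj I / RtoC (Cmod I) * I)%C
    with ((I * Cconj I) / RtoC (Cmod I))%C by (field; exact HI0).
  rewrite <- Cmod2_conj.
  replace (RtoC (Cmod I ^ 2)) with (RtoC (Cmod I) * RtoC (Cmod I))%C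
    by (rewrite <- RtoC_mult; f_equal; ring).
  field; exact HI0. }
assert (E := cint_scal c f a b Hab Hf); fold I in E; rewrite HcI in E.
apply (f_equal fst) in E; simpl in E.
rewrite <- E.
assert (HcM : RInt (fun _ => M) a b = M * (b - a)).
{ rewrite RInt_const; unfold scal; simpl; unfold mult; simpl; ring. }
rewrite <- HcM.
apply RInt_le; [exact Hab| |apply ex_RInt_const|].
- apply (cont_on_fst (fun t => c * f t)%C a b Hab), cont_on_scal, Hf.
- intros t Ht.
  change (fst (c * f t)%C <= M).
  eapply Rle_trans; [apply Rle_abs|].
  eapply Rle_trans; [apply (re_le_Cmod (c * f t))|].
  rewrite Cmod_mult, Hc, Rmult_1_l; apply HM; lra.
Qed.

Lemma cint_ftc (F f : R -> C) (a b : R) : a <= b -> cont_on f a b ->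
  (forall t, a <= t <= b -> is_derive (fun s => fst (F s)) t (fst (f t))) ->
  (forall t, a <= t <= b -> is_derive (fun s => snd (F s)) t (snd (f t))) ->
  cint f a b = (F b - F a)%C.
Proof.
intros Hab Hf H1 H2.
assert (E1 : is_RInt (fun t => fst (f t)) a b (fst (F b) - fst (F a))).
{ apply (is_RInt_derive (V := R_CompleteNormedModule) (fun t => fst (F t)));
    intros t; rewrite Rmin_left, Rmax_right by exact Hab; intros Ht;
    [apply H1, Ht|apply rcont_fst, Hf, Ht]. }
assert (E2 : is_RInt (fun t => snd (f t)) a b (snd (F b) - snd (F a))).
{ apply (is_RInt_derive (V := R_CompleteNormedModule) (fun t => snd (F t)));
    intros t; rewrite Rmin_left, Rmax_right by exact Hab; intros Ht;
    [apply H2, Ht|apply rcont_snd, Hf, Ht]. }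
unfold cint; rewrite (is_RInt_unique _ _ _ _ E1), (is_RInt_unique _ _ _ _ E2).
reflexivity.
Qed.

(** * Goursat's bisection *)

Lemma nested_intervals (u v : nat -> R) :
  (forall n, u n <= u (S n)) -> (forall n, v (S n) <= v n) -> (forall n, u n <= v n) ->
  exists t, forall n, u n <= t <= v n.
Proof.
intros Hu Hv Huv.
assert (Hu' : forall k n, u n <= u (k + n)%nat).
{ induction k; intros n; simpl; [lra|]; eapply Rle_trans; [apply IHk|apply Hu]. }
assert (Hv' : forall k n, v (k + n)%nat <= v n).
{ induction k; intros n; simpl; [lra|]; eapply Rle_trans; [apply Hv|apply IHk]. }
assert (Hc : forall m n, u m <= v n).
{ intros m n; eapply Rle_trans; [apply (Hu' n m)|].
  eapply Rle_trans; [apply Huv|]; rewrite Nat.add_comm; apply Hv'. }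
destruct (completeness (fun x => exists n, x = u n)) as [t [H1 H2]].
- exists (v 0%nat); intros x [n ->]; apply Hc.
- exists (u 0%nat), 0%nat; reflexivity.
- exists t; intros n; split; [apply H1; exists n; reflexivity|].
  apply H2; intros x [m ->]; apply Hc.
Qed.

(** Goursat's argument for a rectangle functional, which is thus available for
    the curvilinear cells of any parametrization. *)
Lemma bisection (D : R -> R -> R -> R -> C) (a b c d : R) :
  a <= b -> c <= d ->
  (forall t1 t t2 s1 s2, a <= t1 -> t1 <= t -> t <= t2 -> t2 <= b ->
    c <= s1 -> s1 <= s2 -> s2 <= d ->
    D t1 t2 s1 s2 = (D t1 t s1 s2 + D t t2 s1 s2)%C) ->
  (forall t1 t2 s1 s s2, a <= t1 -> t1 <= t2 -> t2 <= b ->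
    c <= s1 -> s1 <= s -> s <= s2 -> s2 <= d ->
    D t1 t2 s1 s2 = (D t1 t2 s1 s + D t1 t2 s s2)%C) ->
  (forall t s, a <= t <= b -> c <= s <= d -> forall eps, 0 < eps ->
    exists delta, 0 < delta /\ forall t1 t2 s1 s2,
      a <= t1 -> t1 <= t -> t <= t2 -> t2 <= b ->
      c <= s1 -> s1 <= s -> s <= s2 -> s2 <= d ->
      t2 - t1 < delta -> s2 - s1 < delta ->
      Cmod (D t1 t2 s1 s2) <= eps * ((t2 - t1) + (s2 - s1)) ^ 2) ->
  D a b c d = 0%C.
Proof.
intros Hab Hcd Ht Hs Hloc.
set (cell := (R * R * R * R)%type).
set (val := fun q : cell => let '(t1, t2, s1, s2) := q in
  a <= t1 /\ t1 <= t2 /\ t2 <= b /\ c <= s1 /\ s1 <= s2 /\ s2 <= d).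
set (Dq := fun q : cell => let '(t1, t2, s1, s2) := q in D t1 t2 s1 s2).
set (sub := fun q q' : cell => let '(t1, t2, s1, s2) := q in
  let '(t1', t2', s1', s2') := q' in
  t1 <= t1' /\ t2' <= t2 /\ s1 <= s1' /\ s2' <= s2 /\
  t2' - t1' = (t2 - t1) / 2 /\ s2' - s1' = (s2 - s1) / 2).
assert (Hstep : forall q, exists q', val q -> val q' /\ sub q q' /\
  Cmod (Dq q) <= 4 * Cmod (Dq q')).
{ intros [[[t1 t2] s1] s2].
  set (t := (t1 + t2) / 2); set (s := (s1 + s2) / 2).
  apply NNPP; intros HN.
  assert (HN' : forall q', val (t1, t2, s1, s2) /\ (val q' -> sub (t1, t2, s1, s2) q' ->
    4 * Cmod (Dq q') < Cmod (Dq (t1, t2, s1, s2)))).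
  { intros q'; split.
    - apply NNPP; intros K; apply HN; exists q'; intros K2; contradiction.
    - intros K1 K2; apply Rnot_le_lt; intros K3; apply HN; exists q'; auto. }
  clear HN; assert (HV := proj1 (HN' (t1, t2, s1, s2))).
  destruct HV as [V1 [V2 [V3 [V4 [V5 V6]]]]].
  assert (Q1 := proj2 (HN' (t1, t, s1, s))); assert (Q2 := proj2 (HN' (t1, t, s, s2))).
  assert (Q3 := proj2 (HN' (t, t2, s1, s))); assert (Q4 := proj2 (HN' (t, t2, s, s2))).
  unfold val, sub, Dq in Q1, Q2, Q3, Q4.
  specialize (Q1 ltac:(unfold t, s in *; lra) ltac:(unfold t, s in *; lra)).
  specialize (Q2 ltac:(unfold t, s in *; lra) ltac:(unfold t, s in *; lra)).
  specialize (Q3 ltac:(unfold t, s in *; lra) ltac:(unfold t, s in *; lra)).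
  specialize (Q4 ltac:(unfold t, s in *; lra) ltac:(unfold t, s in *; lra)).
  assert (E : D t1 t2 s1 s2 = ((D t1 t s1 s + D t1 t s s2) + (D t t2 s1 s + D t t2 s s2))%C).
  { rewrite (Ht t1 t t2 s1 s2) by (unfold t in *; lra).
    rewrite (Hs t1 t s1 s s2) by (unfold t, s in *; lra).
    rewrite (Hs t t2 s1 s s2) by (unfold t, s in *; lra); reflexivity. }
  assert (T0 := Cmod_triangle (D t1 t s1 s + D t1 t s s2) (D t t2 s1 s + D t t2 s s2)).
  assert (T1 := Cmod_triangle (D t1 t s1 s) (D t1 t s s2)).
  assert (T2 := Cmod_triangle (D t t2 s1 s) (D t t2 s s2)).
  rewrite <- E in T0; lra. }
destruct (choice _ Hstep) as [next Hnext].
set (q := fun n => Nat.iter n next ((a, b, c, d) : cell)).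
assert (HV : forall n, val (q n)).
{ induction n; simpl; [lra|]; apply Hnext, IHn. }
assert (HS : forall n, sub (q n) (q (S n))) by (intros n; apply Hnext, HV).
assert (HD : forall n, Cmod (D a b c d) <= 4 ^ n * Cmod (Dq (q n))).
{ induction n; [simpl; lra|].
  assert (H := proj2 (proj2 (Hnext (q n) (HV n)))).
  change (next (q n)) with (q (S n)) in H.
  eapply Rle_trans; [exact IHn|].
  apply Rle_trans with (4 ^ n * (4 * Cmod (Dq (q (S n))))); [|simpl; lra].
  apply Rmult_le_compat_l; [apply pow_le; lra|exact H]. }
set (t1 := fun n => fst (fst (fst (q n)))); set (t2 := fun n => snd (fst (fst (q n)))).
set (s1 := fun n => snd (fst (q n))); set (s2 := fun n => snd (q n)).
assert (Hq : forall n, q n = (t1 n, t2 n, s1 n, s2 n)).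
{ intros n; unfold t1, t2, s1, s2; destruct (q n) as [[[? ?] ?] ?]; reflexivity. }
assert (HV' : forall n, a <= t1 n /\ t1 n <= t2 n /\ t2 n <= b /\
  c <= s1 n /\ s1 n <= s2 n /\ s2 n <= d).
{ intros n; assert (H := HV n); rewrite Hq in H; exact H. }
assert (HS' : forall n, t1 n <= t1 (S n) /\ t2 (S n) <= t2 n /\
  s1 n <= s1 (S n) /\ s2 (S n) <= s2 n /\
  t2 (S n) - t1 (S n) = (t2 n - t1 n) / 2 /\ s2 (S n) - s1 (S n) = (s2 n - s1 n) / 2).
{ intros n; assert (H := HS n); rewrite !Hq in H; exact H. }
destruct (nested_intervals t1 t2) as [t Htn]; try (intros n; apply HS'); [apply HV'|].
destruct (nested_intervals s1 s2) as [s Hsn]; try (intros n; apply HS'); [apply HV'|].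
assert (W1 : forall n, t2 n - t1 n = (b - a) / 2 ^ n).
{ induction n; [simpl; unfold t2, t1; simpl; field|].
  assert (H := HS' n); replace (t2 (S n) - t1 (S n)) with ((t2 n - t1 n) / 2) by lra.
  rewrite IHn; simpl; field; apply pow_nonzero; lra. }
assert (W2 : forall n, s2 n - s1 n = (d - c) / 2 ^ n).
{ induction n; [simpl; unfold s2, s1; simpl; field|].
  assert (H := HS' n); replace (s2 (S n) - s1 (S n)) with ((s2 n - s1 n) / 2) by lra.
  rewrite IHn; simpl; field; apply pow_nonzero; lra. }
set (L := (b - a) + (d - c)).
assert (HL : 0 <= L) by (unfold L; lra).
apply Cmod_eq_0; apply Rle_antisym; [|apply Cmod_ge_0].
apply Rnot_lt_le; intros Hpos; set (eta := Cmod (D a b c d)) in *.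
assert (He : 0 < eta / (L ^ 2 + 1)) by (apply Rdiv_lt_0_compat; nra).
destruct (Hloc t s) with (eps := eta / (L ^ 2 + 1)) as [del [Hdel H]].
{ assert (H1 := Htn 0%nat); assert (H2 := HV' 0%nat); lra. }
{ assert (H1 := Hsn 0%nat); assert (H2 := HV' 0%nat); lra. }
{ exact He. }
destruct (nfloor_ex (L / del)) as [N [_ HN]].
{ apply Rmult_le_pos; [exact HL|apply Rlt_le, Rinv_0_lt_compat, Hdel]. }
assert (H2N : INR N + 1 <= 2 ^ N).
{ clear; induction N; [simpl; lra|]; rewrite S_INR; simpl.
  assert (1 <= 2 ^ N) by (apply pow_R1_Rle; lra); lra. }
assert (Hp2 : 0 < 2 ^ N) by (apply pow_lt; lra).
assert (HLd : L / 2 ^ N < del).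
{ apply Rmult_lt_reg_r with (2 ^ N); [exact Hp2|].
  replace (L / 2 ^ N * 2 ^ N) with L by (field; lra).
  apply Rlt_le_trans with (del * (INR N + 1)).
  - apply (Rmult_lt_compat_r del) in HN; [|exact Hdel].
    replace (L / del * del) with L in HN by (field; lra); lra.
  - apply Rmult_le_compat_l; lra. }
assert (Hw : (t2 N - t1 N) + (s2 N - s1 N) = L / 2 ^ N).
{ rewrite W1, W2; unfold L; field; lra. }
assert (HH := HV' N); assert (Ht1 := Htn N); assert (Hs1 := Hsn N).
specialize (H (t1 N) (t2 N) (s1 N) (s2 N)).
specialize (H ltac:(lra) ltac:(lra) ltac:(lra) ltac:(lra) ltac:(lra) ltac:(lra)
  ltac:(lra) ltac:(lra) ltac:(lra) ltac:(lra)).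
rewrite Hw in H.
assert (HDN := HD N); rewrite Hq in HDN; unfold Dq in HDN; fold eta in HDN.
assert (H4 : 4 ^ N = 2 ^ N * 2 ^ N) by (rewrite <- Rpow_mult_distr; f_equal; lra).
assert (HB : eta <= eta / (L ^ 2 + 1) * L ^ 2).
{ eapply Rle_trans; [exact HDN|].
  apply Rle_trans with (4 ^ N * (eta / (L ^ 2 + 1) * (L / 2 ^ N) ^ 2)).
  - apply Rmult_le_compat_l; [apply pow_le; lra|exact H].
  - rewrite H4; right; field; split; nra. }
assert (HB2 : eta / (L ^ 2 + 1) * L ^ 2 = eta - eta / (L ^ 2 + 1)) by (field; nra).
lra.
Qed.

(** * Cauchy's formula *)

Lemma lipschitz_of_derive (g g' : R -> R) (M a b : R) :
  (forall x, Rmin a b <= x <= Rmax a b -> is_derive g x (g' x)) ->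
  (forall x, Rmin a b <= x <= Rmax a b -> Rabs (g' x) <= M) ->
  Rabs (g b - g a) <= M * Rabs (b - a).
Proof.
intros H1 H2.
destruct (MVT_gen g a b g') as [c [Hc E]].
- intros x Hx; apply H1; lra.
- intros x Hx; apply continuity_pt_filterlim, (ex_derive_continuous g x).
  exists (g' x); apply H1, Hx.
- rewrite E, Rabs_mult; apply Rmult_le_compat_r; [apply Rabs_pos|apply H2, Hc].
Qed.

Definition circ (r th : R) : C := (r * cos th, r * sin th).

Lemma Cmod_circ (r th : R) : 0 <= r -> Cmod (circ r th) = r.
Proof.
intros Hr; unfold circ, Cmod; simpl.
replace (r * cos th * (r * cos th * 1) + r * sin th * (r * sin th * 1))
  with (r * r * ((sin th)² + (cos th)²)) by (unfold Rsqr; ring).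
rewrite sin2_cos2, Rmult_1_r; apply sqrt_square, Hr.
Qed.

Lemma circ_period (r : R) : circ r (2 * PI) = circ r 0.
Proof. unfold circ; rewrite cos_2PI, sin_2PI, cos_0, sin_0; reflexivity. Qed.

Lemma rcont_circ (r th : R) : rcont (circ r) th.
Proof.
apply rcont_pair;
  [apply (ex_derive_continuous (fun x => r * cos x))
  |apply (ex_derive_continuous (fun x => r * sin x))]; auto_derive; exact I.
Qed.

Lemma circ_lipschitz (r a b : R) : 0 <= r <= 1 ->
  Cmod (circ r b - circ r a) <= 2 * Rabs (b - a).
Proof.
intros Hr; eapply Rle_trans; [apply Cmod_le_abs|]; simpl.
assert (H1 : Rabs (r * cos b - r * cos a) <= 1 * Rabs (b - a)).
{ apply (lipschitz_of_derive (fun x => r * cos x) (fun x => - r * sin x)).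
  - intros x _; auto_derive; [exact I|ring].
  - intros x _; rewrite Rabs_mult, Rabs_Ropp, (Rabs_pos_eq r) by lra.
    assert (H := SIN_bound x); assert (Rabs (sin x) <= 1) by (apply Rabs_le; lra).
    assert (Hp := Rabs_pos (sin x)); nra. }
assert (H2 : Rabs (r * sin b - r * sin a) <= 1 * Rabs (b - a)).
{ apply (lipschitz_of_derive (fun x => r * sin x) (fun x => r * cos x)).
  - intros x _; auto_derive; [exact I|ring].
  - intros x _; rewrite Rabs_mult, (Rabs_pos_eq r) by lra.
    assert (H := COS_bound x); assert (Rabs (cos x) <= 1) by (apply Rabs_le; lra).
    assert (Hp := Rabs_pos (cos x)); nra. }
unfold Rminus in *; lra.
Qed.

Lemma exp_lipschitz (a b : R) : a <= 0 -> b <= 0 -> Rabs (exp b - exp a) <= Rabs (b - a).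
Proof.
intros Ha Hb.
rewrite <- (Rmult_1_l (Rabs (b - a))).
apply (lipschitz_of_derive exp exp).
- intros x _; apply is_derive_exp.
- intros x [_ Hx]; rewrite Rabs_pos_eq by apply Rlt_le, exp_pos.
  rewrite <- exp_0; assert (Hx0 : x <= 0) by (revert Hx; apply Rmax_case; lra).
  destruct Hx0 as [Hx0| ->]; [apply Rlt_le, exp_increasing, Hx0|lra].
Qed.

Lemma circ_minus_neq (r th : R) (w : C) : 0 <= r -> Cmod w < r -> (circ r th - w)%C <> 0%C.
Proof.
intros Hr Hw E; assert (H := Cmod_minus_ge (circ r th) w).
rewrite E, Cmod_0, Cmod_circ in H by exact Hr; lra.
Qed.

Lemma circ_minus_ge (r th : R) (w : C) : 0 <= r -> r - Cmod w <= Cmod (circ r th - w).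
Proof.
intros Hr; assert (H := Cmod_minus_ge (circ r th) w); rewrite Cmod_circ in H by exact Hr.
exact H.
Qed.

Section Cauchy.

Context (f : C -> C) (Hf : holo f) (r : R) (w : C).
Context (Hw : Cmod w < r) (Hr : r < 1).

(** The homothety of center [w] and ratio [exp t] shrinks the circle onto [w]. *)
Let shrink (t th : R) : C := (w + RtoC (exp t) * (circ r th - w))%C.

Let kern (th : R) : C := (Ci * circ r th * / (circ r th - w))%C.

(** The integral of [f z / (z - w)] along the boundary of a cell: in these
    coordinates [dz / (z - w)] is [dt] on the radial sides and [kern th dth] on
    the others. *)
Let cell (t1 t2 s1 s2 : R) : C :=
  (cint (fun th => (f (shrink t2 th) - f (shrink t1 th)) * kern th) s1 s2
   - cint (fun t => f (shrink t s2) - f (shrink t s1)) t1 t2)%C.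

Let r_pos : 0 <= r.
Proof. assert (H := Cmod_ge_0 w); lra. Qed.

Lemma shrink_disc (t th : R) : t <= 0 -> Cmod (shrink t th) <= r.
Proof.
intros Ht; unfold shrink.
replace (w + RtoC (exp t) * (circ r th - w))%C
  with (RtoC (1 - exp t) * w + RtoC (exp t) * circ r th)%C
  by (rewrite RtoC_minus; ring).
assert (He : 0 < exp t <= 1).
{ split; [apply exp_pos|]. rewrite <- exp_0.
  destruct Ht as [Ht| ->]; [apply Rlt_le, exp_increasing, Ht|lra]. }
eapply Rle_trans; [apply Cmod_triangle|].
rewrite !Cmod_mult, !Cmod_R, Cmod_circ, !Rabs_pos_eq by (assumption || lra); nra.
Qed.

Lemma shrink_lipschitz (t t' th th' : R) : t <= 0 -> t' <= 0 ->
  Cmod (shrink t' th' - shrink t th) <= 2 * (Rabs (t' - t) + Rabs (th' - th)).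
Proof.
intros Ht Ht'; unfold shrink.
replace (w + RtoC (exp t') * (circ r th' - w) - (w + RtoC (exp t) * (circ r th - w)))%C
  with (RtoC (exp t' - exp t) * (circ r th' - w) + RtoC (exp t) * (circ r th' - circ r th))%C
  by (rewrite RtoC_minus; ring).
eapply Rle_trans; [apply Cmod_triangle|]; rewrite !Cmod_mult, !Cmod_R.
assert (H1 := exp_lipschitz t t' Ht Ht').
assert (H2 : Cmod (circ r th' - circ r th) <= 2 * Rabs (th' - th))
  by (apply circ_lipschitz; lra).
assert (H3 : Cmod (circ r th' - w) <= 2).
{ eapply Rle_trans; [apply Cmod_triangle_minus|]; rewrite Cmod_circ by exact r_pos; lra. }
assert (H4 : Rabs (exp t) <= 1).
{ rewrite Rabs_pos_eq by apply Rlt_le, exp_pos; rewrite <- exp_0.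
  destruct Ht as [Ht| ->]; [apply Rlt_le, exp_increasing, Ht|lra]. }
assert (P1 := Rabs_pos (exp t' - exp t)); assert (P2 := Rabs_pos (t' - t)).
assert (P3 := Cmod_ge_0 (circ r th' - w)); assert (P4 := Rabs_pos (exp t)).
assert (P5 := Cmod_ge_0 (circ r th' - circ r th)); assert (P6 := Rabs_pos (th' - th)).
assert (Q1 : Rabs (exp t' - exp t) * Cmod (circ r th' - w) <= Rabs (t' - t) * 2)
  by (apply Rmult_le_compat; assumption).
assert (Q2 : Rabs (exp t) * Cmod (circ r th' - circ r th) <= 1 * (2 * Rabs (th' - th)))
  by (apply Rmult_le_compat; assumption).
lra.
Qed.

Lemma rcont_kern (th : R) : rcont kern th.
Proof.
unfold kern; apply rcont_mult; [apply rcont_scal, rcont_circ|].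
apply rcont_inv; [apply circ_minus_neq; [exact r_pos|exact Hw]|].
apply rcont_minus; [apply rcont_circ|apply rcont_const].
Qed.

Lemma kern_bound (th : R) : Cmod (kern th) <= / (r - Cmod w).
Proof.
unfold kern; rewrite !Cmod_mult, Cmod_Ci, Cmod_circ by exact r_pos.
rewrite Cmod_inv by (apply circ_minus_neq; [exact r_pos|exact Hw]).
assert (H := circ_minus_ge r th w r_pos).
assert (H2 : / Cmod (circ r th - w) <= / (r - Cmod w))
  by (apply Rinv_le_contravar; lra).
assert (H3 : 0 < / Cmod (circ r th - w)) by (apply Rinv_0_lt_compat; lra).
nra.
Qed.

Lemma f_ccont (z : C) : Cmod z <= r -> ccont f z.
Proof.
intros Hz; destruct (Hf z) as [l Hl]; [unfold unit_disc; lra|].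
exact (cder_ccont _ _ _ Hl).
Qed.

Lemma rcont_shrink_th (t th : R) : t <= 0 -> rcont (fun s => f (shrink t s)) th.
Proof.
intros Ht; apply (rcont_comp (shrink t) f); [|apply f_ccont, shrink_disc, Ht].
unfold shrink; apply (rcont_plus (fun _ => w)); [apply rcont_const|].
apply rcont_scal, rcont_minus; [apply rcont_circ|apply rcont_const].
Qed.

Lemma rcont_shrink_t (t th : R) : t <= 0 -> rcont (fun s => f (shrink s th)) t.
Proof.
intros Ht; apply (rcont_comp (fun s => shrink s th) f); [|apply f_ccont, shrink_disc, Ht].
unfold shrink; apply (rcont_plus (fun _ => w)); [apply rcont_const|].
apply rcont_mult; [|apply rcont_const].
apply rcont_pair; [apply continuous_exp|apply continuous_const].
Qed.

(** Goursat's estimate. Affine functions of [z] contribute the same [X] to both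
    integrals of the cell, so only the error of the linear approximation of [f] at
    the given point remains: small compared with the diameter of the cell, on sides
    whose length is of the order of this diameter. *)
Lemma cell_local (t s : R) : t <= 0 -> forall eps, 0 < eps ->
  exists delta, 0 < delta /\ forall t1 t2 s1 s2,
    t1 <= t -> t <= t2 -> t2 <= 0 -> s1 <= s -> s <= s2 ->
    t2 - t1 < delta -> s2 - s1 < delta ->
    Cmod (cell t1 t2 s1 s2) <= eps * ((t2 - t1) + (s2 - s1)) ^ 2.
Proof.
intros Ht eps He.
assert (Hp : unit_disc (shrink t s)).
{ unfold unit_disc; assert (H := shrink_disc t s Ht); lra. }
set (K := / (r - Cmod w)).
assert (HK : 0 < K) by (apply Rinv_0_lt_compat; lra).
destruct (Hf _ Hp) as [l Hl].
set (e := eps / (4 * (K + 1))).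
assert (He' : 0 < e) by (apply Rdiv_lt_0_compat; lra).
destruct (Hl e He') as [d [Hd H]].
exists (d / 4); split; [lra|]; intros t1 t2 s1 s2 A1 A2 A3 A4 A5 A6 A7.
set (S := (t2 - t1) + (s2 - s1)).
set (rho := fun z => (f z - f (shrink t s) - l * (z - shrink t s))%C).
assert (Hrho : forall t' s', t1 <= t' <= t2 -> s1 <= s' <= s2 ->
  Cmod (rho (shrink t' s')) <= e * (2 * S)).
{ intros t' s' B1 B2.
  assert (HL : Cmod (shrink t' s' - shrink t s) <= 2 * S).
  { eapply Rle_trans; [apply shrink_lipschitz; lra|].
    apply Rmult_le_compat_l; [lra|]; unfold S.
    apply Rplus_le_compat; apply Rabs_le; lra. }
  unfold rho; eapply Rle_trans; [apply H; unfold S in *; lra|].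
  apply Rmult_le_compat_l; [lra|exact HL]. }
set (X := (l * RtoC (exp t2 - exp t1) * (circ r s2 - circ r s1))%C).
set (h1 := fun th => ((l * RtoC (exp t2 - exp t1)) * (Ci * circ r th))%C).
set (h2 := fun v => ((l * (circ r s2 - circ r s1)) * RtoC (exp v))%C).
assert (Ch1 : cont_on h1 s1 s2).
{ intros th _; unfold h1; apply rcont_scal, rcont_scal, rcont_circ. }
assert (Cexp : cont_on (fun v => RtoC (exp v)) t1 t2).
{ intros v _; apply rcont_pair; [apply continuous_exp|apply continuous_const]. }
assert (Ch2 : cont_on h2 t1 t2) by (apply cont_on_scal, Cexp).
assert (E1 : cint h1 s1 s2 = X).
{ unfold h1; rewrite cint_scal; [|lra|intros th _; apply rcont_scal, rcont_circ].
  rewrite (cint_ftc (circ r)); [unfold X; ring|lra| | |].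
  - intros th _; apply rcont_scal, rcont_circ.
  - intros th _; simpl; auto_derive; [exact I|ring].
  - intros th _; simpl; auto_derive; [exact I|ring]. }
assert (E2 : cint h2 t1 t2 = X).
{ unfold h2; rewrite cint_scal by (lra || exact Cexp).
  rewrite (cint_ftc (fun v => RtoC (exp v))); [|lra|exact Cexp| |].
  - rewrite <- RtoC_minus; unfold X; ring.
  - intros th _; simpl; apply is_derive_exp.
  - intros th _; simpl; apply (is_derive_const (K := R_AbsRing) (V := R_NormedModule) 0). }
set (F1 := fun th => ((f (shrink t2 th) - f (shrink t1 th)) * kern th)%C).
set (F2 := fun v => (f (shrink v s2) - f (shrink v s1))%C).
assert (CF1 : cont_on F1 s1 s2).
{ intros th _; apply rcont_mult; [|apply rcont_kern].
  apply rcont_minus; apply rcont_shrink_th; lra. }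
assert (CF2 : cont_on F2 t1 t2).
{ intros v Hv; apply rcont_minus; apply rcont_shrink_t; lra. }
assert (E : cell t1 t2 s1 s2
  = (cint (fun th => F1 th - h1 th) s1 s2 - cint (fun v => F2 v - h2 v) t1 t2)%C).
{ rewrite !cint_minus by (lra || assumption); rewrite E1, E2.
  unfold cell, F1, F2; ring. }
assert (HS : 0 <= S) by (unfold S; lra).
assert (B1 : Cmod (cint (fun th => F1 th - h1 th)%C s1 s2) <= e * (4 * S) * K * (s2 - s1)).
{ apply cint_bound; [lra|apply cont_on_minus; assumption|].
  intros th Hth.
  assert (EE : (F1 th - h1 th)%C
    = ((rho (shrink t2 th) - rho (shrink t1 th)) * kern th)%C).
  { unfold F1, h1, rho, kern, shrink; rewrite RtoC_minus; field.
    apply circ_minus_neq; [exact r_pos|exact Hw]. }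
  rewrite EE, Cmod_mult; apply Rmult_le_compat; try apply Cmod_ge_0; [|apply kern_bound].
  eapply Rle_trans; [apply Cmod_triangle_minus|].
  assert (R1 := Hrho t2 th ltac:(lra) Hth); assert (R2 := Hrho t1 th ltac:(lra) Hth); lra. }
assert (B2 : Cmod (cint (fun v => F2 v - h2 v)%C t1 t2) <= e * (4 * S) * (t2 - t1)).
{ apply cint_bound; [lra|apply cont_on_minus; assumption|].
  intros v Hv.
  assert (EE : (F2 v - h2 v)%C = (rho (shrink v s2) - rho (shrink v s1))%C).
  { unfold F2, h2, rho, shrink; ring. }
  rewrite EE; eapply Rle_trans; [apply Cmod_triangle_minus|].
  assert (R1 := Hrho v s2 Hv ltac:(lra)); assert (R2 := Hrho v s1 Hv ltac:(lra)); lra. }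
rewrite E; eapply Rle_trans; [apply Cmod_triangle_minus|].
assert (HeE : eps = e * (4 * (K + 1))) by (unfold e; field; lra).
rewrite HeE.
apply Rle_trans with (e * 4 * S * (K * (s2 - s1) + (t2 - t1))); [lra|].
replace (e * (4 * (K + 1)) * S ^ 2) with (e * 4 * S * ((K + 1) * S)) by ring.
assert (HeS : 0 <= e * S) by (apply Rmult_le_pos; lra).
apply Rmult_le_compat_l; [lra|].
assert (HKt : 0 <= K * (t2 - t1)) by (apply Rmult_le_pos; lra).
unfold S; lra.
Qed.

Lemma cell_zero (T : R) : T <= 0 -> cell T 0 0 (2 * PI) = 0%C.
Proof.
intros HT; assert (HPI := PI_RGT_0).
assert (C1 : forall t1 t2 s1 s2, t1 <= 0 -> t2 <= 0 ->
  cont_on (fun th => (f (shrink t2 th) - f (shrink t1 th)) * kern th)%C s1 s2).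
{ intros t1 t2 s1 s2 A1 A2 th _; apply rcont_mult; [|apply rcont_kern].
  apply rcont_minus; apply rcont_shrink_th; assumption. }
assert (C2 : forall t1 t2 s1 s2, t2 <= 0 ->
  cont_on (fun v => f (shrink v s2) - f (shrink v s1))%C t1 t2).
{ intros t1 t2 s1 s2 A v Hv; apply rcont_minus; apply rcont_shrink_t; lra. }
apply (bisection cell); [exact HT|lra| | |].
- intros t1 t t2 s1 s2 A1 A2 A3 A4 A5 A6 A7; unfold cell.
  rewrite (cint_chasles (fun t0 => f (shrink t0 s2) - f (shrink t0 s1))%C t1 t t2)
    by (assumption || apply C2; lra).
  rewrite (cint_ext (fun th => (f (shrink t2 th) - f (shrink t1 th)) * kern th)%C
    (fun th => (f (shrink t th) - f (shrink t1 th)) * kern th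
             + (f (shrink t2 th) - f (shrink t th)) * kern th)%C)
    by (try lra; intros; ring).
  rewrite cint_plus by (lra || apply C1; lra); ring.
- intros t1 t2 s1 s s2 A1 A2 A3 A4 A5 A6 A7; unfold cell.
  rewrite (cint_chasles _ s1 s s2) by (assumption || apply C1; lra).
  rewrite (cint_ext (fun v => f (shrink v s2) - f (shrink v s1))%C
    (fun v => (f (shrink v s) - f (shrink v s1)) + (f (shrink v s2) - f (shrink v s)))%C)
    by (try lra; intros; ring).
  rewrite cint_plus by (lra || apply C2; lra); ring.
- intros t s A B eps He.
  destruct (cell_local t s ltac:(lra) eps He) as [d [Hd H]].
  exists d; split; [exact Hd|]; intros; apply H; lra.
Qed.

(** The radial sides of the cells cancel by periodicity, so the integral is the same
    on all the circles shrinking to [w], where it tends to the right-hand side. *)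
Lemma cauchy_kern :
  cint (fun th => f (circ r th) * kern th)%C 0 (2 * PI)
  = (f w * cint kern 0 (2 * PI))%C.
Proof.
assert (HPI := PI_RGT_0).
set (K := / (r - Cmod w)).
assert (HK : 0 < K) by (apply Rinv_0_lt_compat; lra).
assert (Ck : cont_on kern 0 (2 * PI)) by (intros th _; apply rcont_kern).
assert (C0 : forall t, t <= 0 -> cont_on (fun th => f (shrink t th) * kern th)%C 0 (2 * PI)).
{ intros t Ht th _; apply rcont_mult; [apply rcont_shrink_th, Ht|apply rcont_kern]. }
assert (E0 : cint (fun th => f (circ r th) * kern th)%C 0 (2 * PI)
  = cint (fun th => f (shrink 0 th) * kern th)%C 0 (2 * PI)).
{ apply cint_ext; [lra|]; intros th _; unfold shrink; rewrite exp_0.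
  do 2 f_equal; ring. }
rewrite E0.
match goal with |- ?a = ?b => replace a with (a - b + b)%C by ring end.
match goal with |- (?a + ?b)%C = _ => assert (Z : a = 0%C); [|rewrite Z; ring] end.
apply Cmod_small_0; intros eps He.
assert (He' : 0 < eps / (K * (2 * PI))) by (apply Rdiv_lt_0_compat; nra).
destruct (f_ccont w ltac:(lra) _ He') as [d [Hd H]].
set (T := Rmin 0 (ln (d / 4))).
assert (HT : T <= 0) by apply Rmin_l.
assert (HTe : exp T <= d / 4).
{ rewrite <- (exp_ln (d / 4)) by lra.
  destruct (Rmin_r 0 (ln (d / 4))) as [L|L]; [apply Rlt_le, exp_increasing, L|].
  unfold T; rewrite L; lra. }
assert (HS := cell_zero T HT); unfold cell in HS.
assert (Z : cint (fun t => f (shrink t (2 * PI)) - f (shrink t 0))%C T 0 = 0%C).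
{ rewrite (cint_ext _ (fun _ => RtoC 0)) by (try lra; intros; unfold shrink;
    rewrite circ_period; ring).
  unfold cint; simpl; rewrite !RInt_const; unfold scal; simpl; unfold mult; simpl.
  rewrite Rmult_0_r; reflexivity. }
rewrite Z in HS.
assert (E : (cint (fun th => f (shrink 0 th) * kern th) 0 (2 * PI)
  - f w * cint kern 0 (2 * PI))%C
  = cint (fun th => (f (shrink T th) - f w) * kern th)%C 0 (2 * PI)).
{ rewrite (cint_ext (fun th => (f (shrink T th) - f w) * kern th)%C
    (fun th => (f (shrink 0 th) * kern th - f w * kern th)
      - (f (shrink 0 th) - f (shrink T th)) * kern th)%C)
    by (try lra; intros; ring).
  rewrite cint_minus; [|lra| |].
  - rewrite cint_minus, cint_scal; try lra; auto using cont_on_scal with real.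
    replace (cint (fun t : R => (f (shrink 0 t) - f (shrink T t)) * kern t)%C 0 (2 * PI))
      with (RtoC 0).
    + ring.
    + rewrite <- HS; ring.
  - apply cont_on_minus; [apply C0; lra|apply cont_on_scal, Ck].
  - intros th _; apply rcont_mult; [|apply rcont_kern].
    apply rcont_minus; apply rcont_shrink_th; lra. }
rewrite E.
replace eps with (eps / (K * (2 * PI)) * K * (2 * PI - 0)) by (field; split; lra).
apply cint_bound; [lra| |].
- intros th _; apply rcont_mult; [|apply rcont_kern].
  apply rcont_minus; [apply rcont_shrink_th, HT|apply rcont_const].
- intros th _; rewrite Cmod_mult; apply Rmult_le_compat; try apply Cmod_ge_0;
    [|apply kern_bound].
  apply Rlt_le, H; unfold shrink.
  replace (w + RtoC (exp T) * (circ r th - w) - w)%C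
    with (RtoC (exp T) * (circ r th - w))%C by ring.
  rewrite Cmod_mult, Cmod_R, Rabs_pos_eq by apply Rlt_le, exp_pos.
  assert (H3 : Cmod (circ r th - w) <= 2).
  { eapply Rle_trans; [apply Cmod_triangle_minus|]; rewrite Cmod_circ by exact r_pos; lra. }
  assert (H4 := exp_pos T); assert (H5 := Cmod_ge_0 (circ r th - w)); nra.
Qed.

End Cauchy.

Lemma cder_ray (f : C -> C) (b l : C) (t : R) : cder f (RtoC t * b)%C l ->
  is_derive (fun s => fst (f (RtoC s * b)%C)) t (fst (l * b)%C) /\
  is_derive (fun s => snd (f (RtoC s * b)%C)) t (snd (l * b)%C).
Proof.
intros H.
assert (K : forall eps, 0 < eps -> exists delta : posreal, forall h, h <> 0 ->
  Rabs h < delta ->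
  Cmod (f (RtoC (t + h) * b)%C - f (RtoC t * b)%C - RtoC h * (l * b))%C < eps * Rabs h).
{ intros eps He; assert (Hb := Cmod_ge_0 b).
  assert (He' : 0 < eps / (Cmod b + 1)) by (apply Rdiv_lt_0_compat; lra).
  destruct (H _ He') as [d [Hd H1]].
  assert (Hd' : 0 < d / (Cmod b + 1)) by (apply Rdiv_lt_0_compat; lra).
  exists (mkposreal _ Hd'); simpl; intros h Hh Hhd.
  assert (Hp : 0 < Rabs h) by (apply Rabs_pos_lt, Hh).
  assert (E : (RtoC (t + h) * b - RtoC t * b)%C = (RtoC h * b)%C)
    by (rewrite RtoC_plus; ring).
  specialize (H1 (RtoC (t + h) * b)%C); rewrite E, Cmod_mult, Cmod_R in H1.
  replace (RtoC h * (l * b))%C with (l * (RtoC h * b))%C by ring.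
  apply (Rmult_lt_compat_r (Cmod b + 1)) in Hhd; [|lra].
  replace (d / (Cmod b + 1) * (Cmod b + 1)) with d in Hhd by (field; lra).
  eapply Rle_lt_trans; [apply H1; nra|].
  apply Rlt_le_trans with (eps / (Cmod b + 1) * (Rabs h * (Cmod b + 1))).
  - apply Rmult_lt_compat_l; [exact He'|]; nra.
  - right; field; lra. }
split; apply is_derive_Reals; intros eps He; destruct (K eps He) as [d Hd];
  exists d; intros h Hh Hhd; specialize (Hd h Hh Hhd);
  assert (Hp : 0 < Rabs h) by (apply Rabs_pos_lt, Hh);
  apply Rmult_lt_reg_r with (Rabs h); auto;
  rewrite <- Rabs_mult; eapply Rle_lt_trans; [|exact Hd| |exact Hd].
- eapply Rle_trans; [|apply Rmax_Cmod]; eapply Rle_trans; [|apply Rmax_l].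
  right; f_equal; unfold Cminus, Cplus, Copp, Cmult, RtoC; simpl; field; exact Hh.
- eapply Rle_trans; [|apply Rmax_Cmod]; eapply Rle_trans; [|apply Rmax_r].
  right; f_equal; unfold Cminus, Cplus, Copp, Cmult, RtoC; simpl; field; exact Hh.
Qed.

Lemma cder_zero_const (f : C -> C) (r : R) :
  (forall z, Cmod z < r -> cder f z 0%C) -> forall z, Cmod z < r -> f z = f 0%C.
Proof.
intros H z Hz.
assert (K : forall t, Rmin 0 1 <= t <= Rmax 0 1 -> cder f (RtoC t * z)%C 0%C).
{ intros t; rewrite Rmin_left, Rmax_right by lra; intros Ht; apply H.
  rewrite Cmod_mult, Cmod_R, Rabs_pos_eq by lra; assert (K := Cmod_ge_0 z); nra. }
assert (E1 : (RtoC 1 * z)%C = z) by ring; assert (E0 : (RtoC 0 * z)%C = 0%C) by ring.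
assert (H1 := lipschitz_of_derive (fun s => fst (f (RtoC s * z)%C)) (fun _ => 0) 0 0 1).
assert (H2 := lipschitz_of_derive (fun s => snd (f (RtoC s * z)%C)) (fun _ => 0) 0 0 1).
cbv beta in H1, H2; rewrite E0, E1 in H1, H2.
assert (Hfst : fst (f z) - fst (f 0%C) = 0).
{ apply Rabs_eq_0, Rle_antisym; [|apply Rabs_pos].
  eapply Rle_trans; [apply H1|lra].
  - intros t Ht; assert (D := proj1 (cder_ray f z 0%C t (K t Ht))).
    replace (fst (0 * z)%C) with 0 in D by (simpl; ring); exact D.
  - intros; rewrite Rabs_R0; lra. }
assert (Hsnd : snd (f z) - snd (f 0%C) = 0).
{ apply Rabs_eq_0, Rle_antisym; [|apply Rabs_pos].
  eapply Rle_trans; [apply H2|lra].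
  - intros t Ht; assert (D := proj2 (cder_ray f z 0%C t (K t Ht))).
    replace (snd (0 * z)%C) with 0 in D by (simpl; ring); exact D.
  - intros; rewrite Rabs_R0; lra. }
destruct (f z) as [a b], (f 0%C) as [c d]; simpl in *; f_equal; lra.
Qed.

Lemma cder_cint (K : C -> R -> C) (K1 : R -> C) (z : C) (a b d B : R) :
  a <= b -> 0 < d ->
  (forall w, Cmod (w - z) < d -> cont_on (K w) a b) -> cont_on K1 a b ->
  (forall w t, Cmod (w - z) < d -> a <= t <= b ->
    Cmod (K w t - K z t - K1 t * (w - z)) <= B * Cmod (w - z) ^ 2) ->
  cder (fun w => cint (K w) a b) z (cint K1 a b).
Proof.
intros Hab Hd HK HK1 HB eps He.
assert (HB' := Rabs_pos B).
assert (HQ : 0 < (Rabs B + 1) * (b - a + 1)) by (apply Rmult_lt_0_compat; lra).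
assert (He' : 0 < eps / ((Rabs B + 1) * (b - a + 1))) by (apply Rdiv_lt_0_compat; lra).
exists (Rmin d (eps / ((Rabs B + 1) * (b - a + 1)))); split; [apply Rmin_pos; assumption|].
intros w Hw.
assert (H1 := Rlt_le_trans _ _ _ Hw (Rmin_l _ _)).
assert (H2 := Rlt_le_trans _ _ _ Hw (Rmin_r _ _)).
assert (Hzz : Cmod (z - z) < d)
  by (rewrite Cmod_minus_self; exact Hd).
assert (E : (cint (K w) a b - cint (K z) a b - cint K1 a b * (w - z))%C
  = cint (fun t => K w t - K z t - (w - z) * K1 t)%C a b).
{ rewrite cint_minus, cint_minus, cint_scal; auto using cont_on_minus, cont_on_scal.
  ring. }
rewrite E.
assert (Hn := Cmod_ge_0 (w - z)).
eapply Rle_trans.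
- apply (cint_bound _ a b (B * Cmod (w - z) ^ 2) Hab).
  + auto using cont_on_minus, cont_on_scal.
  + intros t Ht; replace ((w - z) * K1 t)%C with (K1 t * (w - z))%C by ring; auto.
- assert (HBle := Rle_abs B).
  apply Rle_trans with (Cmod (w - z) * ((Rabs B + 1) * (b - a + 1) * Cmod (w - z))).
  + assert (0 <= Cmod (w - z) ^ 2) by nra.
    replace (Cmod (w - z) * ((Rabs B + 1) * (b - a + 1) * Cmod (w - z)))
      with ((Rabs B + 1) * (b - a + 1) * Cmod (w - z) ^ 2) by ring.
    replace (B * Cmod (w - z) ^ 2 * (b - a)) with (B * (b - a) * Cmod (w - z) ^ 2) by ring.
    apply Rmult_le_compat_r; [assumption|].
    apply Rle_trans with ((Rabs B + 1) * (b - a));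
      [apply Rmult_le_compat_r; lra|apply Rmult_le_compat_l; lra].
  + rewrite (Rmult_comm eps); apply Rmult_le_compat_l; [exact Hn|].
    apply (Rmult_lt_compat_l ((Rabs B + 1) * (b - a + 1))) in H2; [|exact HQ].
    replace ((Rabs B + 1) * (b - a + 1) * (eps / ((Rabs B + 1) * (b - a + 1)))) with eps in H2
      by (field; split; lra).
    lra.
Qed.

Lemma cont_on_circ_kernel (h : R -> C) (r : R) (w : C) : Cmod w < r ->
  cont_on h 0 (2 * PI) ->
  cont_on (fun th => h th * / (circ r th - w))%C 0 (2 * PI).
Proof.
intros Hw Hh th Hth; assert (H0 := Cmod_ge_0 w).
apply rcont_mult; [apply Hh, Hth|].
apply rcont_inv; [apply circ_minus_neq; lra|].
apply rcont_minus; [apply rcont_circ|apply rcont_const].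
Qed.

Lemma disc_half (r : R) (z w : C) : Cmod (w - z) < (r - Cmod z) / 2 -> Cmod w < r.
Proof.
intros H; assert (H1 := Cmod_minus_ge w z); assert (H2 := Cmod_ge_0 (w - z)); lra.
Qed.

Section CauchyType.

Context (h : R -> C) (r M : R) (z : C) (Hz : Cmod z < r).
Context (Hh : cont_on h 0 (2 * PI)).
Context (HM : forall th, 0 <= th <= 2 * PI -> Cmod (h th) <= M).

Let d : R := r - Cmod z.

Let d_pos : 0 < d.
Proof. unfold d; lra. Qed.

Let far (w : C) (th : R) : Cmod (w - z) < d / 2 ->
  d / 2 <= Cmod (circ r th - w) /\ (circ r th - w)%C <> 0%C.
Proof.
intros Hw; assert (H0 := Cmod_ge_0 z); assert (Hw' := disc_half r z w Hw).
assert (H1 := Cmod_minus_ge w z).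
assert (H := circ_minus_ge r th w ltac:(lra)); unfold d in *.
split; [lra|apply circ_minus_neq; lra].
Qed.

Lemma Cmod_div_le (a b : C) (A m : R) :
  0 < m -> b <> 0%C -> Cmod a <= A -> m <= Cmod b -> Cmod (a / b) <= A / m.
Proof.
intros Hm Hb Ha Hmb; rewrite Cmod_div by exact Hb.
assert (H0 := Cmod_ge_0 a).
apply Rmult_le_compat; [exact H0|apply Rlt_le, Rinv_0_lt_compat; lra|exact Ha|].
apply Rinv_le_contravar; lra.
Qed.

Lemma cder_cauchy_type_1 :
  cder (fun w => cint (fun th => h th * / (circ r th - w))%C 0 (2 * PI)) z
    (cint (fun th => h th * / (circ r th - z) * / (circ r th - z))%C 0 (2 * PI)).
Proof.
assert (HPI := PI_RGT_0).
apply (cder_cint (fun w th => h th * / (circ r th - w))%C _ z 0 (2 * PI) (d / 2)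
  (M / ((d / 2) * (d / 2) * (d / 2)))); [lra|lra| | |].
- intros w Hw; apply cont_on_circ_kernel; [apply (disc_half r z), Hw|exact Hh].
- do 2 (apply (cont_on_circ_kernel _ r z Hz)); exact Hh.
- intros w th Hw Hth.
  destruct (far w th Hw) as [F1 F2].
  destruct (far z th) as [F3 F4].
  { rewrite Cmod_minus_self; lra. }
  set (x := (circ r th - z)%C) in *; set (y := (circ r th - w)%C) in *.
  assert (E : (h th * / y - h th * / x - h th * / x * / x * (w - z))%C
    = (h th / (x * x * y) * ((w - z) * (w - z)))%C).
  { replace (w - z)%C with (x - y)%C by (unfold x, y; ring); field; split; assumption. }
  rewrite E, Cmod_mult, (Cmod_mult (w - z)).
  replace (Cmod (w - z) ^ 2) with (Cmod (w - z) * Cmod (w - z)) by ring.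
  apply Rmult_le_compat_r; [apply Rmult_le_pos; apply Cmod_ge_0|].
  apply Cmod_div_le; [|repeat apply Cmult_neq_0; assumption|apply HM, Hth|].
  + repeat apply Rmult_lt_0_compat; lra.
  + rewrite !Cmod_mult; repeat apply Rmult_le_compat; try lra;
      apply Rmult_le_pos; lra.
Qed.

(** The case needed to differentiate a derivative once more. *)
Lemma cder_cauchy_type_2 :
  cder (fun w => cint (fun th => h th * / (circ r th - w) * / (circ r th - w))%C 0 (2 * PI)) z
    (cint (fun th => RtoC 2 * (h th * / (circ r th - z) * / (circ r th - z)
       * / (circ r th - z)))%C 0 (2 * PI)).
Proof.
assert (HPI := PI_RGT_0); assert (Hr := Cmod_ge_0 z).
set (m := d / 2).
apply (cder_cint (fun w th => h th * / (circ r th - w) * / (circ r th - w))%C _ z 0 (2 * PI)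
  m (M * (8 * r) / (m * m * m * m * m))); [lra|unfold m; lra| | |].
- intros w Hw; do 2 (apply (cont_on_circ_kernel _ r w (disc_half r z w Hw))); exact Hh.
- apply cont_on_scal; do 3 (apply (cont_on_circ_kernel _ r z Hz)); exact Hh.
- intros w th Hw Hth.
  destruct (far w th Hw) as [F1 F2].
  destruct (far z th) as [F3 F4].
  { rewrite Cmod_minus_self; lra. }
  set (x := (circ r th - z)%C) in *; set (y := (circ r th - w)%C) in *.
  assert (E : (h th * / y * / y - h th * / x * / x
      - RtoC 2 * (h th * / x * / x * / x) * (w - z))%C
    = (h th * (x + RtoC 2 * y) / (x * x * x * y * y) * ((w - z) * (w - z)))%C).
  { replace (w - z)%C with (x - y)%C by (unfold x, y; ring); field; split; assumption. }
  rewrite E, Cmod_mult, (Cmod_mult (w - z)).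
  replace (Cmod (w - z) ^ 2) with (Cmod (w - z) * Cmod (w - z)) by ring.
  apply Rmult_le_compat_r; [apply Rmult_le_pos; apply Cmod_ge_0|].
  assert (Hm : 0 < m) by (unfold m; lra).
  apply Cmod_div_le; [|repeat apply Cmult_neq_0; assumption| |].
  + repeat apply Rmult_lt_0_compat; lra.
  + rewrite Cmod_mult; apply Rmult_le_compat; try apply Cmod_ge_0; [apply HM, Hth|].
    assert (Hw' := disc_half r z w Hw).
    eapply Rle_trans; [apply Cmod_triangle|]; rewrite Cmod_mult, Cmod_R, Rabs_pos_eq by lra.
    assert (X : Cmod x <= 2 * r).
    { unfold x; eapply Rle_trans; [apply Cmod_triangle_minus|]; rewrite Cmod_circ; lra. }
    assert (Y : Cmod y <= 2 * r).
    { unfold y; eapply Rle_trans; [apply Cmod_triangle_minus|]; rewrite Cmod_circ; lra. }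
    lra.
  + rewrite !Cmod_mult; fold m in F1, F3.
    repeat apply Rmult_le_compat; try lra; repeat apply Rmult_le_pos; lra.
Qed.

End CauchyType.

(** The integral is constant in [w] since its derivative is the integral of an
    exact derivative; at [w = 0] the integrand is [1]. *)
Lemma cint_circ_kernel (r : R) (w : C) : Cmod w < r ->
  cint (fun th => circ r th * / (circ r th - w))%C 0 (2 * PI) = RtoC (2 * PI).
Proof.
intros Hw; assert (HPI := PI_RGT_0); assert (H0 := Cmod_ge_0 w).
rewrite (cder_zero_const (fun w => cint (fun th => circ r th * / (circ r th - w))%C 0 (2 * PI)) r);
  [| |exact Hw].
- rewrite (cint_ext _ (fun _ => RtoC 1)).
  + unfold cint; simpl; rewrite !RInt_const; unfold scal; simpl; unfold mult; simpl.
    unfold RtoC; f_equal; ring.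
  + lra.
  + intros th _.
    assert (Hn : circ r th <> 0%C).
    { intros E; assert (K := Cmod_circ r th ltac:(lra)); rewrite E, Cmod_0 in K; lra. }
    replace (circ r th - 0)%C with (circ r th) by ring; field; exact Hn.
- intros z Hz.
  assert (Hc : cont_on (circ r) 0 (2 * PI)) by (intros th _; apply rcont_circ).
  assert (E : cint (fun th => circ r th * / (circ r th - z) * / (circ r th - z))%C 0 (2 * PI)
    = 0%C).
  { destruct z as [p q].
    assert (Hne : forall t, (r * cos t - p) ^ 2 + (r * sin t - q) ^ 2 <> 0).
    { intros t K; apply (circ_minus_neq r t (p, q) ltac:(lra) Hz).
      destruct (Rplus_sqr_eq_0 (r * cos t + - p) (r * sin t + - q)) as [K1 K2];
        [rewrite <- K; unfold Rsqr; ring|].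
      unfold circ, Cminus, Cplus, Copp; simpl; rewrite K1, K2; reflexivity. }
    rewrite (cint_ftc (fun t =>
      ((r * sin t - q) / ((r * cos t - p) ^ 2 + (r * sin t - q) ^ 2),
       (r * cos t - p) / ((r * cos t - p) ^ 2 + (r * sin t - q) ^ 2)))).
    - rewrite cos_2PI, sin_2PI, cos_0, sin_0; ring.
    - lra.
    - do 2 (apply (cont_on_circ_kernel _ r (p, q) Hz)); exact Hc.
    - intros t _; cbn [fst snd]; auto_derive.
      + specialize (Hne t); simpl in Hne; exact Hne.
      + simpl; specialize (Hne t); simpl in Hne; field.
        intros K; apply Hne; rewrite <- K; ring.
    - intros t _; cbn [fst snd]; auto_derive.
      + specialize (Hne t); simpl in Hne; exact Hne.
      + simpl; specialize (Hne t); simpl in Hne; field.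
        intros K; apply Hne; rewrite <- K; ring. }
  rewrite <- E.
  apply (cder_cauchy_type_1 (circ r) r r z Hz Hc).
  intros th _; rewrite Cmod_circ; lra.
Qed.

Lemma cauchy_formula (f : C -> C) (r : R) (w : C) : holo f -> Cmod w < r -> r < 1 ->
  (RtoC (2 * PI) * f w)%C
  = cint (fun th => f (circ r th) * circ r th * / (circ r th - w))%C 0 (2 * PI).
Proof.
intros Hf Hw Hr; assert (HPI := PI_RGT_0); assert (H0 := Cmod_ge_0 w).
assert (E := cauchy_kern f Hf r w Hw Hr).
assert (Hc : cont_on (circ r) 0 (2 * PI)) by (intros th _; apply rcont_circ).
assert (Hfc : cont_on (fun th => f (circ r th) * circ r th)%C 0 (2 * PI)).
{ intros th _; apply rcont_mult; [|apply rcont_circ].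
  apply (rcont_comp (circ r) f); [apply rcont_circ|].
  destruct (Hf (circ r th)) as [l Hl]; [unfold unit_disc; rewrite Cmod_circ; lra|].
  exact (cder_ccont _ _ _ Hl). }
rewrite (cint_ext _ (fun th => Ci * (f (circ r th) * circ r th * / (circ r th - w)))%C) in E
  by (try lra; intros; ring).
rewrite (cint_ext (fun th => Ci * circ r th * / (circ r th - w))%C
  (fun th => Ci * (circ r th * / (circ r th - w)))%C) in E by (try lra; intros; ring).
rewrite !cint_scal in E by (try lra; apply cont_on_circ_kernel; assumption).
rewrite cint_circ_kernel in E by exact Hw.
assert (HCi : (Ci * Ci = - (1))%C) by (unfold Ci, Cmult, Copp, RtoC; simpl; f_equal; ring).
set (J := cint _ _ _) in *.
replace J with (- (Ci * Ci) * J)%C by (rewrite HCi; ring).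
replace (- (Ci * Ci) * J)%C with (- Ci * (Ci * J))%C by ring.
rewrite E; replace (- Ci * (f w * (Ci * RtoC (2 * PI))))%C
  with (- (Ci * Ci) * (RtoC (2 * PI) * f w))%C by ring.
rewrite HCi; ring.
Qed.

(** * Consequences of Cauchy's formula *)

Lemma cont_circ_holo (f : C -> C) (r : R) (a b : R) : holo f -> 0 <= r < 1 ->
  cont_on (fun th => f (circ r th)) a b.
Proof.
intros Hf Hr th _; apply (rcont_comp (circ r) f); [apply rcont_circ|].
destruct (Hf (circ r th)) as [l Hl]; [unfold unit_disc; rewrite Cmod_circ; lra|].
exact (cder_ccont _ _ _ Hl).
Qed.

Lemma cont_on_mult (f g : R -> C) (a b : R) :
  cont_on f a b -> cont_on g a b -> cont_on (fun t => f t * g t)%C a b.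
Proof. intros Hf Hg t Ht; apply rcont_mult; auto. Qed.

Lemma cont_on_circ (r a b : R) : cont_on (circ r) a b.
Proof. intros t _; apply rcont_circ. Qed.

Lemma continuous_bounded (g : R -> R) (a b : R) : a <= b ->
  (forall t, a <= t <= b -> continuous g t) ->
  exists M, forall t, a <= t <= b -> g t <= M.
Proof.
intros Hab Hg; destruct (continuity_ab_maj g a b Hab) as [x [Hx _]].
- intros t Ht; apply continuity_pt_filterlim, Hg, Ht.
- exists (g x); exact Hx.
Qed.

Lemma cont_on_Cmod (f : R -> C) (a b t : R) : cont_on f a b -> a <= t <= b ->
  continuous (fun s => Cmod (f s)) t.
Proof.
intros Hf Ht; apply rcont_continuous; [|apply Hf, Ht]; intros z w.
assert (H1 := Cmod_minus_ge z w); assert (H2 := Cmod_minus_ge w z).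
rewrite (Cmod_minus_sym w) in H2; apply Rabs_le; lra.
Qed.

Lemma cont_on_bounded (f : R -> C) (a b : R) : a <= b -> cont_on f a b ->
  exists M, forall t, a <= t <= b -> Cmod (f t) <= M.
Proof.
intros Hab Hf; apply continuous_bounded; [exact Hab|].
intros t Ht; exact (cont_on_Cmod f a b t Hf Ht).
Qed.

Lemma RtoC_2PI_neq : RtoC (2 * PI) <> 0%C.
Proof. apply RtoC_neq_0; assert (H := PI_RGT_0); lra. Qed.

Lemma cauchy_formula_derive (f : C -> C) (r : R) (w : C) :
  holo f -> Cmod w < r -> r < 1 ->
  cder f w (/ RtoC (2 * PI) * cint (fun th =>
    f (circ r th) * circ r th * / (circ r th - w) * / (circ r th - w)) 0 (2 * PI))%C.
Proof.
intros Hf Hw Hr; assert (HPI := PI_RGT_0); assert (H0 := Cmod_ge_0 w).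
set (h := fun th => (f (circ r th) * circ r th)%C).
assert (Hh : cont_on h 0 (2 * PI)).
{ apply cont_on_mult; [apply cont_circ_holo; [exact Hf|lra]|apply cont_on_circ]. }
destruct (cont_on_bounded h 0 (2 * PI) ltac:(lra) Hh) as [M HM].
apply (cder_ext_loc (fun w => / RtoC (2 * PI) *
  cint (fun th => h th * / (circ r th - w)) 0 (2 * PI))%C).
- exists (r - Cmod w); split; [lra|]; intros v Hv.
  assert (Hvr : Cmod v < r) by (assert (K := Cmod_minus_ge v w); lra).
  unfold h; rewrite <- (cauchy_formula f r v Hf Hvr Hr); field; apply RtoC_2PI_neq.
- apply cder_scal; exact (cder_cauchy_type_1 h r M w Hw Hh HM).
Qed.

Definition deriv (f : C -> C) (z : C) : C := epsilon (inhabits (RtoC 0)) (cder f z).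

Lemma deriv_spec (f : C -> C) (z : C) : holo f -> unit_disc z -> cder f z (deriv f z).
Proof. intros Hf Hz; exact (epsilon_spec (inhabits (RtoC 0)) (cder f z) (Hf z Hz)). Qed.

Lemma deriv_unique (f : C -> C) (z l : C) : cder f z l -> deriv f z = l.
Proof.
intros H; apply (cder_unique f z); [|exact H].
exact (epsilon_spec (inhabits (RtoC 0)) (cder f z) (ex_intro _ l H)).
Qed.

Lemma between_1 (w : C) : unit_disc w -> exists r, Cmod w < r /\ r < 1.
Proof. unfold unit_disc; intros H; exists ((Cmod w + 1) / 2); lra. Qed.

Lemma holo_deriv (f : C -> C) : holo f -> holo (deriv f).
Proof.
intros Hf z Hz; destruct (between_1 z Hz) as [r [Hzr Hr]].
assert (HPI := PI_RGT_0); assert (H0 := Cmod_ge_0 z).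
set (h := fun th => (f (circ r th) * circ r th)%C).
assert (Hh : cont_on h 0 (2 * PI)).
{ apply cont_on_mult; [apply cont_circ_holo; [exact Hf|lra]|apply cont_on_circ]. }
destruct (cont_on_bounded h 0 (2 * PI) ltac:(lra) Hh) as [M HM].
eexists; apply (cder_ext_loc (fun w => / RtoC (2 * PI) *
  cint (fun th => h th * / (circ r th - w) * / (circ r th - w)) 0 (2 * PI))%C).
- exists (r - Cmod z); split; [lra|]; intros v Hv.
  assert (Hvr : Cmod v < r) by (assert (K := Cmod_minus_ge v z); lra).
  symmetry; apply deriv_unique; exact (cauchy_formula_derive f r v Hf Hvr Hr).
- apply cder_scal; exact (cder_cauchy_type_2 h r M z Hzr Hh HM).
Qed.

(** The constant depends on [f] through its bound on a circle only: this
    uniformity transfers the continuity of the derivative to vector-valued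
    functions. *)
Lemma deriv_lipschitz (f : C -> C) (r rho M : R) (v w : C) :
  holo f -> 0 <= rho -> rho < r -> r < 1 -> Cmod v <= rho -> Cmod w <= rho ->
  (forall th, 0 <= th <= 2 * PI -> Cmod (f (circ r th)) <= M) ->
  Cmod (deriv f v - deriv f w) <= M * 4 / (r - rho) ^ 4 * Cmod (v - w).
Proof.
intros Hf Hrho Hr0 Hr Hv Hw HM; assert (HPI := PI_RGT_0).
rewrite (deriv_unique f v _ (cauchy_formula_derive f r v Hf ltac:(lra) Hr)).
rewrite (deriv_unique f w _ (cauchy_formula_derive f r w Hf ltac:(lra) Hr)).
set (h := fun th => (f (circ r th) * circ r th)%C).
assert (Hh : cont_on h 0 (2 * PI)).
{ apply cont_on_mult; [apply cont_circ_holo; [exact Hf|lra]|apply cont_on_circ]. }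
set (k := fun w th => (h th * / (circ r th - w) * / (circ r th - w))%C).
change (Cmod (/ RtoC (2 * PI) * cint (k v) 0 (2 * PI) - / RtoC (2 * PI) * cint (k w) 0 (2 * PI))
  <= M * 4 / (r - rho) ^ 4 * Cmod (v - w)).
assert (Hk : forall u, Cmod u <= rho -> cont_on (k u) 0 (2 * PI)).
{ intros u Hu; do 2 (apply (cont_on_circ_kernel _ r u ltac:(lra))); exact Hh. }
replace (/ RtoC (2 * PI) * cint (k v) 0 (2 * PI) - / RtoC (2 * PI) * cint (k w) 0 (2 * PI))%C
  with (/ RtoC (2 * PI) * (cint (k v) 0 (2 * PI) - cint (k w) 0 (2 * PI)))%C by ring.
rewrite <- cint_minus by (lra || auto).
rewrite Cmod_mult, Cmod_inv, Cmod_R, Rabs_pos_eq by (lra || apply RtoC_2PI_neq).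
set (B := M * 4 / (r - rho) ^ 4 * Cmod (v - w)).
apply Rmult_le_reg_l with (2 * PI); [lra|].
rewrite <- Rmult_assoc, Rinv_r, Rmult_1_l by lra.
replace (2 * PI * B) with (B * (2 * PI - 0)) by ring.
apply cint_bound; [lra|apply cont_on_minus; auto|].
intros th Hth; unfold k.
assert (Hx := circ_minus_ge r th v ltac:(lra)); assert (Hy := circ_minus_ge r th w ltac:(lra)).
assert (Hx0 := circ_minus_neq r th v ltac:(lra) ltac:(lra)).
assert (Hy0 := circ_minus_neq r th w ltac:(lra) ltac:(lra)).
set (x := (circ r th - v)%C) in *; set (y := (circ r th - w)%C) in *.
assert (E : (h th * / x * / x - h th * / y * / y)%C
  = (h th * (x + y) / (x * x * y * y) * (v - w))%C).
{ replace (v - w)%C with (y - x)%C by (unfold x, y; ring); field; split; assumption. }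
rewrite E, Cmod_mult; unfold B; apply Rmult_le_compat_r; [apply Cmod_ge_0|].
assert (Hm : 0 < r - rho) by lra.
apply Cmod_div_le; [apply pow_lt, Hm|repeat apply Cmult_neq_0; assumption| |].
- unfold h; rewrite !Cmod_mult, Cmod_circ by lra.
  assert (Hf0 := Cmod_ge_0 (f (circ r th))); specialize (HM th Hth).
  assert (Hxy : Cmod (x + y) <= 4).
  { eapply Rle_trans; [apply Cmod_triangle|]; unfold x, y.
    assert (T1 := Cmod_triangle_minus (circ r th) v).
    assert (T2 := Cmod_triangle_minus (circ r th) w).
    rewrite Cmod_circ in T1, T2 by lra; lra. }
  apply Rmult_le_compat; [apply Rmult_le_pos; lra|apply Cmod_ge_0| |exact Hxy].
  rewrite <- (Rmult_1_r M); apply Rmult_le_compat; lra.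
- rewrite !Cmod_mult.
  replace ((r - rho) ^ 4) with ((r - rho) * (r - rho) * (r - rho) * (r - rho)) by ring.
  repeat apply Rmult_le_compat; try lra; repeat apply Rmult_le_pos; lra.
Qed.

(** Since [c / (c - w) = 1 + w / (c - w)] on the circle and the mean of [f] is
    [f 0 = 0], Cauchy's formula for [f w] has a factor [w]; the other factor is an
    integral that is differentiable at [0] too. *)
Lemma holo_divide (f : C -> C) : holo f -> f 0%C = 0%C ->
  exists s, holo s /\ forall z, unit_disc z -> (f z = z * s z)%C.
Proof.
intros Hf Hf0; assert (HPI := PI_RGT_0).
set (r := 1 / 2).
set (h := fun th => f (circ r th)).
assert (Hh : cont_on h 0 (2 * PI)) by (apply cont_circ_holo; [exact Hf|unfold r; lra]).
destruct (cont_on_bounded h 0 (2 * PI) ltac:(lra) Hh) as [M HM].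
set (g := fun w => (/ RtoC (2 * PI) * cint (fun th => h th * / (circ r th - w)) 0 (2 * PI))%C).
assert (Hg : forall w, Cmod w < r -> (f w = w * g w)%C).
{ intros w Hw; assert (H0 := Cmod_ge_0 w).
  assert (E1 := cauchy_formula f r w Hf Hw ltac:(unfold r; lra)).
  assert (E0 := cauchy_formula f r 0%C Hf ltac:(rewrite Cmod_0; unfold r; lra)
    ltac:(unfold r; lra)).
  rewrite Hf0, Cmult_0_r in E0.
  rewrite (cint_ext _ h) in E0; [|lra|].
  2:{ intros th _; assert (Hn := circ_minus_neq r th 0%C ltac:(unfold r; lra)
        ltac:(rewrite Cmod_0; unfold r; lra)).
      unfold h; replace (circ r th - 0)%C with (circ r th) in * by ring.
      field; exact Hn. }
  rewrite (cint_ext _ (fun th => h th + w * (h th * / (circ r th - w)))%C) in E1; [|lra|].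
  2:{ intros th _; assert (Hn := circ_minus_neq r th w ltac:(unfold r; lra) Hw).
      unfold h; field; exact Hn. }
  assert (Hk := cont_on_circ_kernel h r w Hw Hh).
  rewrite cint_plus, <- E0, cint_scal in E1 by (lra || auto using cont_on_scal).
  unfold g.
  replace (f w) with (/ RtoC (2 * PI) * (RtoC (2 * PI) * f w))%C
    by (field; apply RtoC_2PI_neq).
  rewrite E1; ring. }
exists (fun w => if Rlt_dec (Cmod w) r then g w else (f w / w)%C); split.
- intros z Hz; destruct (Rlt_dec (Cmod z) r) as [Hzr|Hzr].
  + eexists; apply (cder_ext_loc g).
    * exists (r - Cmod z); split; [lra|]; intros w Hw.
      assert (K := Cmod_minus_ge w z).
      destruct (Rlt_dec (Cmod w) r); [reflexivity|lra].
    * apply cder_scal; exact (cder_cauchy_type_1 h r M z Hzr Hh HM).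
  + assert (Hz0 : z <> 0%C) by (intros E; apply Hzr; rewrite E, Cmod_0; unfold r; lra).
    destruct (Hf z Hz) as [l Hl].
    eexists; apply (cder_ext_loc (fun w => f w * / w)%C).
    * exists (Cmod z); split; [apply Cmod_gt_0, Hz0|]; intros w Hw.
      assert (Hw0 : w <> 0%C).
      { intros ->; replace (0 - z)%C with (- z)%C in Hw by ring; rewrite Cmod_opp in Hw; lra. }
      destruct (Rlt_dec (Cmod w) r); [|reflexivity].
      rewrite Hg by assumption; field; exact Hw0.
    * apply cder_mult; [exact Hl|apply (cder_inv (fun w => w)); [exact Hz0|apply cder_id]].
- intros z Hz; destruct (Rlt_dec (Cmod z) r) as [Hzr|Hzr]; [apply Hg, Hzr|].
  assert (Hz0 : z <> 0%C) by (intros E; apply Hzr; rewrite E, Cmod_0; unfold r; lra).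
  field; exact Hz0.
Qed.

Lemma mean_value (f : C -> C) (r : R) : holo f -> 0 < r < 1 ->
  (RtoC (2 * PI) * f 0)%C = cint (fun th => f (circ r th)) 0 (2 * PI).
Proof.
intros Hf Hr; assert (HPI := PI_RGT_0).
rewrite (cauchy_formula f r 0%C Hf) by (rewrite ?Cmod_0; lra).
apply cint_ext; [lra|]; intros th _.
assert (Hn := circ_minus_neq r th 0%C ltac:(lra) ltac:(rewrite Cmod_0; lra)).
replace (circ r th - 0)%C with (circ r th) in * by ring; field; exact Hn.
Qed.

Lemma mean_value_bound (f : C -> C) (r M : R) : holo f -> 0 < r < 1 ->
  (forall th, 0 <= th <= 2 * PI -> Cmod (f (circ r th)) <= M) -> Cmod (f 0%C) <= M.
Proof.
intros Hf Hr HM; assert (HPI := PI_RGT_0).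
apply Rmult_le_reg_l with (2 * PI); [lra|].
replace (2 * PI * Cmod (f 0%C)) with (Cmod (RtoC (2 * PI) * f 0%C))
  by (rewrite Cmod_mult, Cmod_R, Rabs_pos_eq by lra; reflexivity).
rewrite (mean_value f r Hf Hr).
replace (2 * PI * M) with (M * (2 * PI - 0)) by ring.
apply cint_bound; [lra|apply cont_circ_holo; [exact Hf|lra]|exact HM].
Qed.

Lemma holo_pow (f : C -> C) (n : nat) : holo f -> holo (fun z => f z ^ n)%C.
Proof.
intros Hf; induction n; simpl.
- apply holo_const.
- apply (holo_mult f (fun z => f z ^ n)%C Hf IHn).
Qed.

Lemma pow_bounded_le_1 (x A : R) : 0 <= x -> (forall n, x ^ n <= A) -> x <= 1.
Proof.
intros Hx HA; apply Rnot_lt_le; intros Hlt.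
destruct (Pow_x_infinity x) with (b := A + 1) as [N HN].
{ rewrite Rabs_pos_eq; lra. }
specialize (HN N (le_n N)); specialize (HA N).
rewrite Rabs_pos_eq in HN by (apply pow_le, Hx); lra.
Qed.

(** Cauchy's formula for the powers of [f] loses a constant factor, which
    disappears in the limit of the roots. *)
Lemma max_modulus_circ (f : C -> C) (r M : R) (w : C) : holo f -> Cmod w < r -> r < 1 ->
  0 < M -> (forall th, 0 <= th <= 2 * PI -> Cmod (f (circ r th)) <= M) ->
  Cmod (f w) <= M.
Proof.
intros Hf Hw Hr HM0 HM; assert (HPI := PI_RGT_0); assert (H0 := Cmod_ge_0 w).
assert (H1 : Cmod (f w) / M <= 1).
{ apply (pow_bounded_le_1 _ (/ (r - Cmod w))).
  { apply Rmult_le_pos; [apply Cmod_ge_0|apply Rlt_le, Rinv_0_lt_compat, HM0]. }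
  intros n.
  assert (E := cauchy_formula (fun z => f z ^ n)%C r w (holo_pow f n Hf) Hw Hr).
  assert (B : Cmod (cint (fun th => f (circ r th) ^ n * circ r th * / (circ r th - w))%C 0 (2 * PI))
    <= M ^ n * / (r - Cmod w) * (2 * PI - 0)).
  { apply cint_bound; [lra| |].
    - apply cont_on_circ_kernel; [exact Hw|].
      apply cont_on_mult; [|apply cont_on_circ].
      apply (cont_circ_holo (fun z => f z ^ n)%C); [apply holo_pow, Hf|lra].
    - intros th Hth; rewrite !Cmod_mult, Cmod_pow, Cmod_circ by lra.
      rewrite Cmod_inv by (apply circ_minus_neq; lra).
      assert (K := circ_minus_ge r th w ltac:(lra)).
      assert (P : Cmod (f (circ r th)) ^ n <= M ^ n)
        by (apply pow_incr; split; [apply Cmod_ge_0|apply HM, Hth]).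
      assert (P0 : 0 <= Cmod (f (circ r th)) ^ n) by apply pow_le, Cmod_ge_0.
      apply Rmult_le_compat; [apply Rmult_le_pos; lra| | |].
      + apply Rlt_le, Rinv_0_lt_compat; lra.
      + rewrite <- (Rmult_1_r (M ^ n)); apply Rmult_le_compat; lra.
      + apply Rinv_le_contravar; lra. }
  rewrite <- E, Cmod_mult, Cmod_R, Rabs_pos_eq, Cmod_pow in B by lra.
  assert (HMn : 0 < M ^ n) by apply pow_lt, HM0.
  unfold Rdiv; rewrite Rpow_mult_distr, pow_inv.
  apply Rmult_le_reg_l with (M ^ n * (2 * PI)); [apply Rmult_lt_0_compat; lra|].
  replace (M ^ n * (2 * PI) * (Cmod (f w) ^ n * / M ^ n)) with (2 * PI * Cmod (f w) ^ n)
    by (field; lra).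
  lra. }
apply Rmult_le_reg_r with (/ M); [apply Rinv_0_lt_compat, HM0|].
rewrite Rinv_r by lra; exact H1.
Qed.

Lemma max_modulus_limsup (f : C -> C) : holo f ->
  (forall eps, 0 < eps -> exists rho, rho < 1 /\
    forall z, unit_disc z -> rho < Cmod z -> Cmod (f z) <= 1 + eps) ->
  forall z, unit_disc z -> Cmod (f z) <= 1.
Proof.
intros Hf H z Hz; apply le_epsilon; intros eps He.
destruct (H eps He) as [rho [Hrho H1]]; unfold unit_disc in Hz.
set (r := (1 + Rmax rho (Cmod z)) / 2).
assert (K1 := Rmax_l rho (Cmod z)); assert (K2 := Rmax_r rho (Cmod z)).
assert (K3 : Rmax rho (Cmod z) < 1) by (apply Rmax_lub_lt; assumption).
assert (H0 := Cmod_ge_0 z).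
apply (max_modulus_circ f r); [exact Hf|unfold r; lra|unfold r; lra|lra|].
intros th _; apply H1; [unfold unit_disc|]; rewrite Cmod_circ; unfold r; lra.
Qed.

Lemma RInt_nonneg_zero (g : R -> R) (a b c : R) :
  (forall x, continuous g x) -> (forall x, 0 <= g x) -> a < c < b ->
  RInt g a b = 0 -> g c = 0.
Proof.
intros Hc Hp Hac H.
destruct (Hp c) as [Hlt|Heq]; [|auto].
assert (Hex : forall x y, ex_RInt g x y).
{ intros x y; apply (ex_RInt_continuous (V := R_CompleteNormedModule)); auto. }
destruct (proj1 (filterlim_locally g (g c)) (Hc c) (mkposreal _ Hlt)) as [d Hd].
set (e := Rmin d (Rmin (c - a) (b - c)) / 2).
assert (Hm : 0 < Rmin d (Rmin (c - a) (b - c))).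
{ repeat apply Rmin_pos; try lra; apply cond_pos. }
assert (M1 := Rmin_l d (Rmin (c - a) (b - c))).
assert (M2 := Rmin_r d (Rmin (c - a) (b - c))).
assert (M3 := Rmin_l (c - a) (b - c)); assert (M4 := Rmin_r (c - a) (b - c)).
assert (P : 0 < RInt g (c - e) (c + e)).
{ apply RInt_gt_0; [unfold e; lra| |intros; apply Hc].
  intros x Hx; assert (Hb : Rabs (x - c) < d) by (apply Rabs_def1; unfold e in *; lra).
  specialize (Hd x Hb); change (Rabs (g x - g c) < g c) in Hd.
  apply Rabs_def2 in Hd; lra. }
assert (P1 : 0 <= RInt g a (c - e)).
{ apply RInt_ge_0; [unfold e; lra|apply Hex|intros; apply Hp]. }
assert (P2 : 0 <= RInt g (c + e) b).
{ apply RInt_ge_0; [unfold e; lra|apply Hex|intros; apply Hp]. }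
assert (E1 := RInt_Chasles (V := R_CompleteNormedModule) g a (c - e) (c + e) (Hex _ _) (Hex _ _)).
assert (E2 := RInt_Chasles (V := R_CompleteNormedModule) g a (c + e) b (Hex _ _) (Hex _ _)).
change (RInt g a (c - e) + RInt g (c - e) (c + e) = RInt g a (c + e)) in E1.
change (RInt g a (c + e) + RInt g (c + e) b = RInt g a b) in E2.
lra.
Qed.

Lemma Cmod_le_fst (z : C) : Cmod z <= fst z -> z = RtoC (fst z).
Proof.
intros H; destruct z as [a b]; simpl in H; unfold RtoC; f_equal.
assert (H0 := Cmod_ge_0 (a, b)); assert (E := Cmod2_alt (a, b)); simpl in E; simpl; nra.
Qed.

(** At a maximum, the mean value of [f] on each circle about [0] is [f 0] while no
    value exceeds [f 0] in modulus, which forces all of them to equal [f 0]. *)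
Lemma strong_max_modulus_0 (f : C -> C) : holo f ->
  (forall z, unit_disc z -> Cmod (f z) <= Cmod (f 0%C)) ->
  forall z, unit_disc z -> f z = f 0%C.
Proof.
intros Hf HM z Hz; assert (HPI := PI_RGT_0).
destruct (classic (f 0%C = 0%C)) as [E0|Hne].
{ specialize (HM z Hz); rewrite E0, Cmod_0 in HM; rewrite E0; apply Cmod_eq_0.
  apply Rle_antisym; [exact HM|apply Cmod_ge_0]. }
destruct (between_1 z Hz) as [r [Hzr Hr]].
assert (H0 := Cmod_ge_0 z); assert (Hm := proj1 (Cmod_gt_0 _) Hne).
assert (Hrc : RtoC r <> 0%C) by (apply RtoC_neq_0; lra).
(* A rotation puts [z] at the angle [PI], inside the interval of integration. *)
set (F := fun x => (/ f 0 * f (x * (- z / RtoC r)))%C).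
assert (Hb : Cmod (- z / RtoC r) < 1).
{ rewrite Cmod_div, Cmod_opp, Cmod_R, Rabs_pos_eq by (lra || exact Hrc).
  apply Rmult_lt_reg_r with r; [lra|].
  unfold Rdiv; rewrite Rmult_assoc, Rinv_l by lra; lra. }
assert (Hdisc : forall x, unit_disc x -> unit_disc (x * (- z / RtoC r))%C).
{ unfold unit_disc; intros x Hx; rewrite Cmod_mult.
  assert (K1 := Cmod_ge_0 x); assert (K2 := Cmod_ge_0 (- z / RtoC r)); nra. }
assert (HF : holo F).
{ apply (holo_mult (fun _ => / f 0)%C); [apply holo_const|].
  apply (holo_comp (fun x => x * (- z / RtoC r))%C f); [exact Hdisc| |exact Hf].
  intros x _; eexists; apply cder_mult; [apply cder_id|apply cder_const]. }
assert (HF0 : F 0%C = 1%C).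
{ unfold F; replace (0 * (- z / RtoC r))%C with (RtoC 0) by ring; field; exact Hne. }
assert (HF1 : forall x, unit_disc x -> Cmod (F x) <= 1).
{ intros x Hx; unfold F; rewrite Cmod_mult, Cmod_inv by exact Hne.
  apply Rmult_le_reg_l with (Cmod (f 0%C)); [exact Hm|].
  rewrite <- Rmult_assoc, Rinv_r, Rmult_1_l, Rmult_1_r by lra.
  apply HM, Hdisc, Hx. }
assert (Hcd : forall th, unit_disc (circ r th))
  by (intros th; unfold unit_disc; rewrite Cmod_circ; lra).
assert (HC : forall th, rcont (fun th => F (circ r th)) th).
{ intros th; apply (cont_circ_holo F r (th - 1) (th + 1) HF); lra. }
assert (E := mean_value F r HF ltac:(lra)); rewrite HF0 in E.
apply (f_equal fst) in E.
change (fst (RtoC (2 * PI) * 1)%C = RInt (fun th => fst (F (circ r th))) 0 (2 * PI)) in E.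
replace (fst (RtoC (2 * PI) * 1)%C) with (2 * PI) in E by (simpl; ring).
assert (Hz1 : 1 - fst (F (circ r PI)) = 0).
{ apply (RInt_nonneg_zero (fun th => 1 - fst (F (circ r th))) 0 (2 * PI)).
  - intros x; apply (continuous_minus (V := R_NormedModule) (fun _ => 1)
      (fun th => fst (F (circ r th)))); [apply continuous_const|apply rcont_fst, HC].
  - intros x; assert (K := HF1 _ (Hcd x)).
    assert (K2 := re_le_Cmod (F (circ r x))); apply Rabs_le_between in K2.
    unfold Re in K2; lra.
  - lra.
  - rewrite (RInt_minus (V := R_CompleteNormedModule) (fun _ => 1)
      (fun th => fst (F (circ r th)))).
    + rewrite RInt_const, <- E; unfold scal, minus, plus, opp; simpl.
      unfold mult; simpl; ring.
    + apply ex_RInt_const.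
    + apply (cont_on_fst (fun th => F (circ r th)) 0 (2 * PI)); [lra|].
      intros th _; apply HC. }
assert (E1 : F (circ r PI) = 1%C).
{ rewrite (Cmod_le_fst (F (circ r PI))); [f_equal; lra|].
  replace (fst (F (circ r PI))) with 1 by lra; apply HF1, Hcd. }
assert (Epi : circ r PI = (- RtoC r)%C).
{ unfold circ; rewrite cos_PI, sin_PI; unfold Copp, RtoC; simpl; f_equal; ring. }
rewrite Epi in E1; unfold F in E1.
replace (- RtoC r * (- z / RtoC r))%C with z in E1 by (field; exact Hrc).
replace (f z) with (f 0%C * (/ f 0%C * f z))%C by (field; exact Hne).
rewrite E1; ring.
Qed.

(** * Automorphisms of the disc *)

Definition mob (a z : C) : C := ((z - a) / (1 - Cconj a * z))%C.

Lemma mob_den_pos (a z : C) : unit_disc a -> unit_disc z ->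
  1 - Cmod a <= Cmod (1 - Cconj a * z).
Proof.
unfold unit_disc; intros Ha Hz.
assert (H := Cmod_minus_ge 1 (Cconj a * z)%C).
rewrite Cmod_1, Cmod_mult, Cmod_conj in H.
assert (H1 := Cmod_ge_0 a); assert (H2 := Cmod_ge_0 z); nra.
Qed.

Lemma mob_den_neq (a z : C) : unit_disc a -> unit_disc z -> (1 - Cconj a * z)%C <> 0%C.
Proof.
intros Ha Hz; assert (H := mob_den_pos a z Ha Hz); unfold unit_disc in Ha.
apply Cmod_gt_0; lra.
Qed.

Lemma mob_identity (a z : C) :
  Cmod (1 - Cconj a * z) ^ 2 - Cmod (z - a) ^ 2 = (1 - Cmod a ^ 2) * (1 - Cmod z ^ 2).
Proof. rewrite !Cmod2_alt; destruct a, z; simpl; ring. Qed.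

Lemma mob_weight (a z : C) : unit_disc a -> unit_disc z ->
  1 - Cmod (mob a z) ^ 2
  = (1 - Cmod a ^ 2) * (1 - Cmod z ^ 2) / Cmod (1 - Cconj a * z) ^ 2.
Proof.
intros Ha Hz; assert (H := mob_den_neq a z Ha Hz).
unfold mob; rewrite Cmod_div by exact H.
rewrite <- mob_identity; field; apply Rgt_not_eq, Cmod_gt_0, H.
Qed.

Lemma unit_disc_sqr (z : C) : unit_disc z <-> 0 < 1 - Cmod z ^ 2.
Proof. unfold unit_disc; assert (H := Cmod_ge_0 z); split; intros; nra. Qed.

Lemma mob_disc (a z : C) : unit_disc a -> unit_disc z -> unit_disc (mob a z).
Proof.
intros Ha Hz; apply unit_disc_sqr; rewrite mob_weight by assumption.
assert (H := proj1 (Cmod_gt_0 _) (mob_den_neq a z Ha Hz)).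
apply Rdiv_lt_0_compat; [|apply pow_lt, H].
apply Rmult_lt_0_compat; apply unit_disc_sqr; assumption.
Qed.

Lemma unit_disc_opp (a : C) : unit_disc a -> unit_disc (- a)%C.
Proof. unfold unit_disc; rewrite Cmod_opp; auto. Qed.

Lemma unit_disc_0 : unit_disc 0%C.
Proof. unfold unit_disc; rewrite Cmod_0; lra. Qed.

Lemma one_minus_norm_neq (a : C) : unit_disc a -> (1 - Cconj a * a)%C <> 0%C.
Proof. intros Ha; apply mob_den_neq; exact Ha. Qed.

Lemma mob_opp_mob (a z : C) : unit_disc a -> unit_disc z -> mob (- a) (mob a z) = z.
Proof.
intros Ha Hz; assert (H := mob_den_neq a z Ha Hz); assert (H2 := one_minus_norm_neq a Ha).
unfold mob; rewrite Copp_conj; field.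
split; [exact H|].
replace (1 - Cconj a * z - - Cconj a * (z - a))%C with (1 - Cconj a * a)%C by ring.
exact H2.
Qed.

Lemma mob_mob_opp (a z : C) : unit_disc a -> unit_disc z -> mob a (mob (- a) z) = z.
Proof.
intros Ha Hz; rewrite <- (mob_opp_mob (- a) z) at 2; [|apply unit_disc_opp, Ha|exact Hz].
f_equal; ring.
Qed.

Lemma mob_self (a : C) : mob a a = 0%C.
Proof. unfold mob; replace (a - a)%C with (RtoC 0) by ring; unfold Cdiv; ring. Qed.

Lemma cder_mob (a z : C) : unit_disc a -> unit_disc z ->
  cder (mob a) z ((1 - Cconj a * a) / ((1 - Cconj a * z) * (1 - Cconj a * z)))%C.
Proof.
intros Ha Hz; assert (H := mob_den_neq a z Ha Hz).
assert (H1 : cder (fun w => w - a)%C z (1 + 0)%C)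
  by (apply (cder_plus (fun w => w) (fun _ => - a)%C); [apply cder_id|apply cder_const]).
assert (H2 : cder (fun w => 1 - Cconj a * w)%C z (0 + - Cconj a * 1)%C).
{ apply (cder_ext_loc (fun w => 1 + - Cconj a * w)%C).
  { exists 1; split; [lra|]; intros; ring. }
  apply (cder_plus (fun _ => RtoC 1)); [apply cder_const|apply cder_scal, cder_id]. }
assert (H3 := cder_mult _ _ _ _ _ H1 (cder_inv (fun w => 1 - Cconj a * w)%C z _ H H2)).
replace ((1 - Cconj a * a) / ((1 - Cconj a * z) * (1 - Cconj a * z)))%C
  with ((1 + 0) * / (1 - Cconj a * z) + (z - a) *
    (- (0 + - Cconj a * 1) / ((1 - Cconj a * z) * (1 - Cconj a * z))))%C
  by (field; exact H).
exact H3.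
Qed.

Lemma holo_mob (a : C) : unit_disc a -> holo (mob a).
Proof. intros Ha z Hz; eexists; apply cder_mob; assumption. Qed.

Definition holo_injective (f : C -> C) : Prop :=
  forall z w, unit_disc z -> unit_disc w -> f z = f w -> z = w.

(** If [w] near [f a] were not attained near [a], then [1 / (f - w)] would be
    larger at [a] than on a circle about [a]. *)
Lemma injective_open (f : C -> C) (a : C) (rho : R) : holo f -> holo_injective f ->
  0 < rho -> Cmod a + rho < 1 ->
  exists m, 0 < m /\ forall w, Cmod (w - f a) < m ->
    exists z, Cmod (z - a) < rho /\ f z = w.
Proof.
intros Hf Hi Hrho Ha; assert (HPI := PI_RGT_0).
set (p := fun x => (a + RtoC rho * x)%C).
assert (Hp : forall x, unit_disc x -> unit_disc (p x)).
{ unfold unit_disc, p; intros x Hx; eapply Rle_lt_trans; [apply Cmod_triangle|].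
  rewrite Cmod_mult, Cmod_R, Rabs_pos_eq by lra; assert (H := Cmod_ge_0 x); nra. }
assert (Hph : holo p).
{ intros x _; eexists; apply cder_plus; [apply cder_const|apply cder_scal, cder_id]. }
assert (Hfp : holo (fun x => f (p x))) by (apply (holo_comp p f); assumption).
assert (Hp0 : p 0%C = a) by (unfold p; ring).
assert (Hcirc : forall th, unit_disc (circ (1 / 2) th))
  by (intros th; unfold unit_disc; rewrite Cmod_circ; lra).
destruct (continuity_ab_min (fun th => Cmod (f (p (circ (1 / 2) th)) - f a)) 0 (2 * PI))
  as [th0 [Hmin _]]; [lra| |].
{ intros th Hth; apply continuity_pt_filterlim.
  apply (cont_on_Cmod (fun th => f (p (circ (1 / 2) th)) - f a)%C 0 (2 * PI)); [|exact Hth].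
  apply cont_on_minus; [|intros t _; apply rcont_const].
  apply (cont_circ_holo (fun x => f (p x))); [exact Hfp|lra]. }
set (m := Cmod (f (p (circ (1 / 2) th0)) - f a)) in *.
assert (Hm : 0 < m).
{ apply Cmod_gt_0; intros E.
  assert (E2 : p (circ (1 / 2) th0) = a).
  { apply Hi; [apply Hp, Hcirc|unfold unit_disc; lra|].
    apply Cminus_eq_0, E. }
  assert (E3 : (RtoC rho * circ (1 / 2) th0)%C = 0%C).
  { replace (RtoC rho * circ (1 / 2) th0)%C with (p (circ (1 / 2) th0) - a)%C
      by (unfold p; ring); rewrite E2; ring. }
  apply (f_equal Cmod) in E3; rewrite Cmod_mult, Cmod_R, Cmod_circ, Cmod_0, Rabs_pos_eq in E3
    by lra; lra. }
exists (m / 2); split; [lra|]; intros w Hw.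
apply NNPP; intros HN.
assert (Hne : forall x, unit_disc x -> (f (p x) - w)%C <> 0%C).
{ intros x Hx E; apply HN; exists (p x); split.
  - unfold p; replace (a + RtoC rho * x - a)%C with (RtoC rho * x)%C by ring.
    unfold unit_disc in Hx; rewrite Cmod_mult, Cmod_R, Rabs_pos_eq by lra; nra.
  - apply Cminus_eq_0, E. }
assert (Hw0 := Hne 0%C unit_disc_0); rewrite Hp0 in Hw0.
assert (H := mean_value_bound (fun x => / (f (p x) - w))%C (1 / 2) (/ (m / 2))).
cbv beta in H; rewrite Hp0, Cmod_inv in H by exact Hw0.
assert (Hb : / Cmod (f a - w) <= / (m / 2)).
{ apply H; [|lra|].
  - apply (holo_inv (fun x => f (p x) - w)%C); [exact Hne|].
    intros x Hx; destruct (Hfp x Hx) as [l Hl]; eexists.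
    apply (cder_plus (fun x => f (p x)) (fun _ => - w)%C); [exact Hl|apply cder_const].
  - intros th Hth; rewrite Cmod_inv by apply Hne, Hcirc.
    apply Rinv_le_contravar; [lra|].
    specialize (Hmin th Hth); cbv beta in Hmin.
    assert (T := Cmod_minus_chain (f (p (circ (1 / 2) th))) w (f a)); lra. }
rewrite Cmod_minus_sym in Hw; assert (Hm2 : 0 < m / 2) by lra; assert (Hp1 := proj1 (Cmod_gt_0 _) Hw0).
assert (K := Rinv_lt_contravar (Cmod (f a - w)) (m / 2)
  (Rmult_lt_0_compat _ _ Hp1 Hm2) Hw); lra.
Qed.

(** If points [z n] tending to the circle had images in a smaller disc, these images
    would accumulate at some [f a]; by openness they would be attained near [a], and by
    injectivity nowhere else. *)
Lemma automorphism_proper (f : C -> C) : holo f -> holo_injective f ->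
  (forall w, unit_disc w -> exists z, unit_disc z /\ f z = w) ->
  forall rho, rho < 1 -> exists R, R < 1 /\
    forall z, unit_disc z -> R < Cmod z -> rho < Cmod (f z).
Proof.
intros Hf Hi Hs rho Hrho; apply NNPP; intros HN.
assert (Hex : forall n : nat, exists z, unit_disc z /\ 1 - / (INR n + 1) < Cmod z /\
  Cmod (f z) <= rho).
{ intros n; apply NNPP; intros HN2; apply HN; exists (1 - / (INR n + 1)); split.
  - assert (0 < / (INR n + 1)) by (apply Rinv_0_lt_compat; assert (H := pos_INR n); lra); lra.
  - intros z Hz Hz2; apply Rnot_le_lt; intros Hle; apply HN2; exists z; auto. }
destruct (choice _ Hex) as [z Hz].
destruct (bounded_ultralimit (fun n => f (z n)) rho) as [w Hw]; [intros n; apply Hz|].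
assert (Hwr : Cmod w <= rho).
{ apply (ultralimit_bound (fun n => f (z n))); [|exact Hw].
  apply mostly_all; intros n; apply Hz. }
destruct (Hs w) as [a [Ha Ea]]; [unfold unit_disc; lra|].
unfold unit_disc in Ha.
destruct (injective_open f a ((1 - Cmod a) / 2) Hf Hi) as [m [Hm Hopen]]; [lra|lra|].
rewrite Ea in Hopen.
destruct (mostly_ex _ (mostly_and _ _ (Hw m Hm)
  (mostly_inv_lt ((1 - Cmod a) / 2) ltac:(lra)))) as [n [H1 H2]].
destruct (Hopen _ H1) as [y [Hy Ey]].
assert (H3 := Cmod_minus_ge y a).
destruct (Hz n) as [K1 [K2 _]].
assert (E : y = z n) by (apply Hi; [unfold unit_disc; lra|exact K1|exact Ey]).
subst y; lra.
Qed.

Lemma pow_root_of_unity (k : nat) : (2 <= k)%nat ->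
  exists u : C, Cmod u = 1 /\ u <> 1%C /\ (u ^ k = 1)%C.
Proof.
intros Hk; set (t := 2 * PI / INR k); assert (HPI := PI_RGT_0).
assert (HkR : 2 <= INR k) by (apply (le_INR 2 k) in Hk; simpl in Hk; lra).
assert (Hp : forall n, (circ 1 t ^ n)%C = circ 1 (INR n * t)).
{ induction n.
  - simpl; unfold circ; rewrite Rmult_0_l, cos_0, sin_0; unfold RtoC; f_equal; ring.
  - rewrite S_INR; simpl; rewrite IHn.
    replace ((INR n + 1) * t) with (t + INR n * t) by ring.
    unfold circ, Cmult; simpl; rewrite cos_plus, sin_plus; f_equal; ring. }
exists (circ 1 t); repeat split.
- apply Cmod_circ; lra.
- intros E; apply (f_equal fst) in E; simpl in E.
  assert (Ht : 0 < t <= PI).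
  { unfold t; split; [apply Rdiv_lt_0_compat; lra|].
    apply Rmult_le_reg_r with (INR k); [lra|].
    replace (2 * PI / INR k * INR k) with (2 * PI) by (field; lra); nra. }
  assert (H := cos_decreasing_1 0 t); rewrite cos_0 in H; lra.
- rewrite Hp; unfold t; replace (INR k * (2 * PI / INR k)) with (2 * PI) by (field; lra).
  rewrite circ_period; unfold circ; rewrite cos_0, sin_0; unfold RtoC; f_equal; ring.
Qed.

(** Schwarz's lemma: the quotient at [z] is bounded by [1 / |z|], hence by [1] in the
    limit at the circle. *)
Lemma schwarz_divide (f : C -> C) : holo f -> (forall z, unit_disc z -> Cmod (f z) <= 1) ->
  f 0%C = 0%C ->
  exists s, holo s /\ (forall z, unit_disc z -> Cmod (s z) <= 1) /\
    forall z, unit_disc z -> (f z = z * s z)%C.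
Proof.
intros Hf Hb H0; destruct (holo_divide f Hf H0) as [s [Hs E]].
exists s; split; [exact Hs|split; [|exact E]].
apply max_modulus_limsup; [exact Hs|]; intros eps He.
exists (/ (1 + eps)); split.
{ rewrite <- Rinv_1 at 2; apply Rinv_lt_contravar; lra. }
intros z Hz Hlt; specialize (Hb z Hz); rewrite (E z Hz), Cmod_mult in Hb.
assert (Hi : 0 < / (1 + eps)) by (apply Rinv_0_lt_compat; lra).
assert (Hs0 := Cmod_ge_0 (s z)).
apply Rmult_le_reg_l with (/ (1 + eps)); [exact Hi|]; rewrite Rinv_l by lra; nra.
Qed.

(** Write [f z = z ^ k * s z] with [s 0 <> 0]. Both [s] and [1 / s] are bounded by [1],
    the latter because [f] is proper, so [s] is a unimodular constant, and
    injectivity forces [k = 1]. *)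
Lemma automorphism_fixing_0 (f : C -> C) : holo f ->
  (forall z, unit_disc z -> unit_disc (f z)) -> holo_injective f ->
  (forall w, unit_disc w -> exists z, unit_disc z /\ f z = w) -> f 0%C = 0%C ->
  exists c, Cmod c = 1 /\ forall z, unit_disc z -> f z = (c * z)%C.
Proof.
intros Hf Hd Hi Hs H0.
set (P := fun k s => holo s /\ (forall z, unit_disc z -> Cmod (s z) <= 1) /\
  forall z, unit_disc z -> (f z = z ^ k * s z)%C).
assert (Hk : exists k s, P k s /\ s 0%C <> 0%C).
{ apply NNPP; intros HN.
  assert (HP : forall k, exists s, P k s).
  { induction k as [|k [s HPs]].
    - exists f; split; [exact Hf|split].
      + intros z Hz; apply Rlt_le, Hd, Hz.
      + intros z _; simpl; ring.
    - assert (Hs0 : s 0%C = 0%C) by (apply NNPP; intros K; apply HN; exists k, s; auto).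
      destruct HPs as [A1 [A2 A3]].
      destruct (schwarz_divide s A1 A2 Hs0) as [s' [B1 [B2 B3]]].
      exists s'; split; [exact B1|split; [exact B2|]].
      intros z Hz; rewrite (A3 z Hz), (B3 z Hz); simpl; ring. }
  assert (Hh : unit_disc (RtoC (1 / 2))).
  { unfold unit_disc; rewrite Cmod_R, Rabs_pos_eq; lra. }
  assert (E : f (RtoC (1 / 2)) = 0%C).
  { apply Cmod_small_0; intros eps He.
    destruct (pow_lt_1_zero (1 / 2)) with (y := eps) as [N HN2];
      [rewrite Rabs_pos_eq; lra|exact He|].
    specialize (HN2 N (le_n N)); destruct (HP N) as [s [_ [A2 A3]]].
    rewrite (A3 _ Hh), Cmod_mult, Cmod_pow, Cmod_R, (Rabs_pos_eq (1 / 2)) by lra.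
    assert (HpN : 0 <= (1 / 2) ^ N) by (apply pow_le; lra).
    rewrite Rabs_pos_eq in HN2 by exact HpN.
    specialize (A2 _ Hh); assert (K := Cmod_ge_0 (s (RtoC (1 / 2)))); nra. }
  rewrite <- H0 in E; apply Hi in E; [|exact Hh|exact unit_disc_0].
  apply (f_equal fst) in E; simpl in E; lra. }
destruct Hk as [k [s [[A1 [A2 A3]] As0]]].
assert (Hsne : forall z, unit_disc z -> s z <> 0%C).
{ intros z Hz E; apply As0.
  assert (E2 : f z = f 0%C) by (rewrite (A3 z Hz), E, H0; ring).
  apply Hi in E2; [|exact Hz|exact unit_disc_0]; rewrite <- E2 at 1; exact E. }
assert (Hinv : forall z, unit_disc z -> Cmod (/ s z) <= 1).
{ apply max_modulus_limsup; [apply holo_inv; assumption|]; intros eps He.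
  destruct (automorphism_proper f Hf Hi Hs (/ (1 + eps))) as [R [HR HRz]].
  { rewrite <- Rinv_1; apply Rinv_lt_contravar; lra. }
  exists R; split; [exact HR|]; intros z Hz Hz2; specialize (HRz z Hz Hz2).
  rewrite (A3 z Hz), Cmod_mult, Cmod_pow in HRz.
  rewrite Cmod_inv by (apply Hsne, Hz).
  assert (Hsp := proj1 (Cmod_gt_0 _) (Hsne z Hz)).
  rewrite <- (Rinv_inv (1 + eps)); apply Rinv_le_contravar.
  - apply Rinv_0_lt_compat; lra.
  - assert (Hzk : Cmod z ^ k <= 1).
    { unfold unit_disc in Hz; rewrite <- (pow1 k); apply pow_incr; split; [apply Cmod_ge_0|lra]. }
    nra. }
assert (Hs1 : forall z, unit_disc z -> Cmod (s z) = 1).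
{ intros z Hz; apply Rle_antisym; [apply A2, Hz|].
  specialize (Hinv z Hz); rewrite Cmod_inv in Hinv by (apply Hsne, Hz).
  assert (Hsp := proj1 (Cmod_gt_0 _) (Hsne z Hz)).
  apply (Rmult_le_compat_l (Cmod (s z))) in Hinv; [|lra]; rewrite Rinv_r in Hinv; lra. }
assert (Hsc : forall z, unit_disc z -> s z = s 0%C).
{ apply strong_max_modulus_0; [exact A1|].
  intros z Hz; rewrite (Hs1 z Hz), (Hs1 0%C unit_disc_0); lra. }
exists (s 0%C); split; [apply Hs1, unit_disc_0|].
intros z Hz; rewrite (A3 z Hz), (Hsc z Hz).
destruct k as [|[|k]].
- assert (E := A3 0%C unit_disc_0); rewrite H0 in E; simpl in E.
  elim As0; rewrite Cmult_1_l in E; symmetry; exact E.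
- simpl; ring.
- destruct (pow_root_of_unity (S (S k)) ltac:(lia)) as [u [Hu [Hu1 Huk]]].
  elim Hu1.
  assert (Hh : unit_disc (RtoC (1 / 2))).
  { unfold unit_disc; rewrite Cmod_R, Rabs_pos_eq; lra. }
  assert (Hh2 : unit_disc (u * RtoC (1 / 2))%C).
  { unfold unit_disc; rewrite Cmod_mult, Hu, Cmod_R, Rabs_pos_eq; lra. }
  assert (E : f (u * RtoC (1 / 2))%C = f (RtoC (1 / 2))).
  { rewrite (A3 _ Hh), (A3 _ Hh2), (Hsc _ Hh), (Hsc _ Hh2), Cpow_mult_l, Huk; ring. }
  apply Hi in E; [|exact Hh2|exact Hh].
  assert (H2 : RtoC (1 / 2) <> 0%C) by (intros K; apply (f_equal fst) in K; simpl in K; lra).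
  replace u with (u * RtoC (1 / 2) * / RtoC (1 / 2))%C by (field; exact H2).
  rewrite E; field; exact H2.
Qed.

(** A Moebius map moving [f 0] to [0] reduces to the automorphisms fixing [0]. *)
Lemma automorphism_form (f : C -> C) : disc_automorphism f ->
  exists a c, unit_disc a /\ Cmod c = 1 /\
    forall z, unit_disc z -> f z = mob a (c * z)%C.
Proof.
intros [Ha [Hd [Hi Hs]]]; apply holo_analytic in Ha.
set (b := f 0%C); assert (Hb : unit_disc b) by (apply Hd, unit_disc_0).
assert (Hb' := unit_disc_opp b Hb).
destruct (automorphism_fixing_0 (fun z => mob b (f z))) as [c [Hc E]].
- apply (holo_comp f (mob b)); auto using holo_mob.
- intros z Hz; apply mob_disc; auto.
- intros z w Hz Hw E; apply Hi; [exact Hz|exact Hw|].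
  rewrite <- (mob_opp_mob b (f z)), <- (mob_opp_mob b (f w)), E; auto.
- intros w Hw; destruct (Hs (mob (- b) w)) as [z [Hz Ez]]; [apply mob_disc; assumption|].
  exists z; split; [exact Hz|]; rewrite Ez; apply mob_mob_opp; assumption.
- apply mob_self.
- exists (- b)%C, c; split; [exact Hb'|split; [exact Hc|]].
  intros z Hz; rewrite <- (E z Hz), mob_opp_mob; auto.
Qed.

Lemma schwarz_pick_equality (f : C -> C) (z l : C) : disc_automorphism f -> unit_disc z ->
  cder f z l -> (1 - Cmod z ^ 2) * Cmod l = 1 - Cmod (f z) ^ 2.
Proof.
intros Hf Hz Hl; destruct (automorphism_form f Hf) as [a [c [Ha [Hc E]]]].
assert (Hcz : forall w, unit_disc w -> unit_disc (c * w)%C).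
{ unfold unit_disc; intros w Hw; rewrite Cmod_mult, Hc; lra. }
assert (Hl2 : cder f z ((1 - Cconj a * a) /
  ((1 - Cconj a * (c * z)) * (1 - Cconj a * (c * z))) * (c * 1))%C).
{ destruct (unit_disc_nbhd z Hz) as [d [Hd Hdz]].
  apply (cder_ext_loc (fun w => mob a (c * w)%C)).
  - exists d; split; [exact Hd|]; intros w Hw; symmetry; apply E, Hdz, Hw.
  - apply (cder_comp (fun w => c * w)%C (mob a)); [apply cder_scal, cder_id|].
    apply cder_mob; auto. }
rewrite (cder_unique _ _ _ _ Hl Hl2), (E z Hz), mob_weight by auto.
assert (Hn := mob_den_neq a (c * z)%C Ha (Hcz z Hz)).
rewrite Cmod_mult, Cmod_div, !Cmod_mult, Cmod_1, Hc by (apply Cmult_neq_0; exact Hn).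
assert (En : Cmod (1 - Cconj a * a) = 1 - Cmod a ^ 2).
{ replace (1 - Cconj a * a)%C with (RtoC (1 - Cmod a ^ 2))
    by (rewrite RtoC_minus, Cmod2_conj; ring).
  rewrite Cmod_R; apply Rabs_pos_eq, Rlt_le, unit_disc_sqr, Ha. }
rewrite En; field; apply Rgt_not_eq, Cmod_gt_0, Hn.
Qed.

(** * Norming functionals *)

Lemma Cmod_minus_1 : Cmod (RtoC (-1)) = 1.
Proof. rewrite Cmod_R, Rabs_left; lra. Qed.

Lemma RtoC_minus_1 : RtoC (-1) = (- RtoC 1)%C.
Proof. rewrite <- RtoC_opp; f_equal; ring. Qed.

Lemma plus_minus_cancel {G : AbelianGroup} (x y : G) : minus (plus x y) y = x.
Proof.
unfold minus; rewrite <- plus_assoc; transitivity (plus x zero).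
- f_equal; apply plus_opp_r.
- apply plus_zero_r.
Qed.

Lemma minus_plus_plus {G : AbelianGroup} (a b c d : G) :
  minus (plus a b) (plus c d) = plus (minus a c) (minus b d).
Proof.
unfold minus; transitivity (plus (plus a b) (plus (opp c) (opp d))).
- f_equal; apply opp_plus.
- rewrite <- !plus_assoc; f_equal; rewrite !plus_assoc; f_equal; apply plus_comm.
Qed.

Section Normed.

Context {V : NormedModule C_AbsRing}.

Local Notation "c *: x" := (scal (K := C_AbsRing) (V := V) (c : C) x) (at level 40).

Lemma scalC_1 (x : V) : RtoC 1 *: x = x.
Proof. exact (scal_one (K := C_AbsRing) (V := V) x). Qed.

Lemma scalC_assoc (a b : C) (x : V) : a *: (b *: x) = (a * b)%C *: x.
Proof. exact (scal_assoc (K := C_AbsRing) (V := V) a b x). Qed.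

Lemma scalC_0 (x : V) : RtoC 0 *: x = zero.
Proof. exact (scal_zero_l (K := C_AbsRing) (V := V) x). Qed.

Lemma scalC_plus_l (a b : C) (x : V) : (a + b)%C *: x = plus (a *: x) (b *: x).
Proof. exact (scal_distr_r (K := C_AbsRing) (V := V) a b x). Qed.

Lemma scalC_plus_r (a : C) (x y : V) : a *: plus x y = plus (a *: x) (a *: y).
Proof. exact (scal_distr_l (K := C_AbsRing) (V := V) a x y). Qed.

Lemma oppC (x : V) : opp x = RtoC (-1) *: x.
Proof.
etransitivity; [symmetry; exact (scal_opp_one (K := C_AbsRing) (V := V) x)|].
change (Copp (RtoC 1) *: x = RtoC (-1) *: x).
rewrite RtoC_minus_1; reflexivity.
Qed.

Lemma minusC (x y : V) : minus x y = plus x (RtoC (-1) *: y).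
Proof. unfold minus; rewrite oppC; reflexivity. Qed.

Lemma minus_plus_cancel (x y : V) : plus (minus x y) y = x.
Proof.
unfold minus; rewrite <- plus_assoc, plus_opp_l; apply plus_zero_r.
Qed.

Lemma norm_scalC (c : C) (x : V) : norm (c *: x) = Cmod c * norm x.
Proof.
apply Rle_antisym; [exact (norm_scal (K := C_AbsRing) (V := V) c x)|].
destruct (classic (c = 0%C)) as [->|Hc].
{ rewrite Cmod_0, Rmult_0_l; apply norm_ge_0. }
assert (Hp := proj1 (Cmod_gt_0 _) Hc).
assert (E : x = (/ c)%C *: (c *: x)).
{ rewrite scalC_assoc, Cinv_l by exact Hc; symmetry; apply scalC_1. }
assert (H : norm x <= / Cmod c * norm (c *: x)).
{ rewrite E at 1; rewrite <- Cmod_inv by exact Hc.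
  exact (norm_scal (K := C_AbsRing) (V := V) (/ c)%C (c *: x)). }
apply (Rmult_le_compat_l (Cmod c)) in H; [|lra].
rewrite <- Rmult_assoc, Rinv_r, Rmult_1_l in H by lra; exact H.
Qed.

Lemma norm_minus_sym (x y : V) : norm (minus x y) = norm (minus y x).
Proof.
rewrite <- (opp_minus y x), oppC, norm_scalC, Cmod_minus_1; ring.
Qed.

Lemma norm_minus_ge (x y : V) : norm x - norm y <= norm (minus x y).
Proof.
assert (H := norm_triangle (minus x y) y); rewrite minus_plus_cancel in H; lra.
Qed.

Lemma norm_lipschitz (x y : V) : Rabs (norm x - norm y) <= norm (minus x y).
Proof.
assert (K := norm_minus_ge y x); rewrite norm_minus_sym in K.
apply Rabs_le; split; [lra|apply norm_minus_ge].
Qed.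

Lemma norm_minus_le (x y : V) : norm (minus x y) <= norm x + norm y.
Proof.
eapply Rle_trans; [apply norm_triangle|].
rewrite (norm_opp (K := C_AbsRing) (V := V)); lra.
Qed.

Lemma norm_minus_chain (a b c : V) :
  norm (minus a c) <= norm (minus a b) + norm (minus b c).
Proof.
assert (E : minus a c = plus (minus a b) (minus b c)) by exact (minus_trans b a c).
rewrite E; apply norm_triangle.
Qed.

Lemma norm_pos (x : V) : x <> zero -> 0 < norm x.
Proof.
intros Hx; destruct (norm_ge_0 x) as [H|H]; [exact H|].
elim Hx; apply norm_eq_zero; symmetry; exact H.
Qed.

Lemma norm_normalize (x : V) : x <> zero -> norm (RtoC (/ norm x) *: x) = 1.
Proof.
intros Hx; assert (H := norm_pos x Hx).
rewrite norm_scalC, Cmod_R, Rabs_pos_eq by (apply Rlt_le, Rinv_0_lt_compat, H).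
field; lra.
Qed.

Definition functional (phi : V -> C) : Prop :=
  (forall x y, phi (plus x y) = (phi x + phi y)%C) /\
  (forall c x, phi (c *: x) = (c * phi x)%C) /\
  (exists M, 0 <= M /\ forall x, Cmod (phi x) <= M * norm x).

(** For a unit vector these are the support functionals. All vectors are allowed here
    in order to compute the norm of a vector of unknown length; the zero functional
    is norming for [0]. *)
Definition norming (x : V) (phi : V -> C) : Prop :=
  (forall y z, phi (plus y z) = (phi y + phi z)%C) /\
  (forall c y, phi (c *: y) = (c * phi y)%C) /\
  (forall y, Cmod (phi y) <= norm y) /\
  phi x = RtoC (norm x).

Lemma norming_functional (x : V) (phi : V -> C) : norming x phi -> functional phi.
Proof.
intros [H1 [H2 [H3 _]]]; split; [exact H1|split; [exact H2|]].
exists 1; split; [lra|]; intros y; rewrite Rmult_1_l; apply H3.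
Qed.

Lemma functional_opp (phi : V -> C) (x : V) : functional phi -> phi (opp x) = (- phi x)%C.
Proof.
intros [_ [H _]]; rewrite oppC, H, RtoC_minus_1; ring.
Qed.

Lemma functional_minus (phi : V -> C) (x y : V) : functional phi ->
  phi (minus x y) = (phi x - phi y)%C.
Proof.
intros H; unfold minus; rewrite (proj1 H), functional_opp by exact H; reflexivity.
Qed.

Lemma functional_zero (phi : V -> C) : functional phi -> phi zero = 0%C.
Proof.
intros [_ [H _]]; transitivity (phi (RtoC 0 *: zero)).
- f_equal; symmetry; apply scalC_0.
- rewrite H; ring.
Qed.

Lemma support_functional_norming (u : V) (phi : V -> C) : norm u = 1 ->
  (support_functional u phi <-> norming u phi).
Proof.
intros Hu; split.
- intros [[L1 L2 L3] [Hd Hphi]].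
  assert (Hlub : is_lub_Rbar (fun r => exists x : V, norm x <= 1 /\ r = Cmod (phi x)) (Finite 1)).
  { rewrite <- Hd; apply Lub_Rbar_correct. }
  assert (H1 : forall x, norm x <= 1 -> Cmod (phi x) <= 1).
  { intros x Hx; apply (proj1 Hlub (Cmod (phi x))); exists x; auto. }
  assert (Hs : forall c y, phi (c *: y) = (c * phi y)%C) by (intros c y; exact (L2 c y)).
  split; [exact L1|split; [exact Hs|split; [|exact Hphi]]].
  intros y; destruct (classic (y = zero)) as [->|Hy].
  + assert (E : phi zero = 0%C).
    { transitivity (phi (RtoC 0 *: zero)); [f_equal; symmetry; apply scalC_0|].
      rewrite Hs; ring. }
    rewrite E, Cmod_0; apply norm_ge_0.
  + assert (Hp := norm_pos y Hy).
    assert (H := H1 (RtoC (/ norm y) *: y)).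
    rewrite norm_normalize in H by exact Hy; specialize (H (Rle_refl 1)).
    rewrite Hs, Cmod_mult, Cmod_R, Rabs_pos_eq in H
      by (apply Rlt_le, Rinv_0_lt_compat, Hp).
    apply (Rmult_le_compat_l (norm y)) in H; [|lra].
    rewrite <- Rmult_assoc, Rinv_r, Rmult_1_l in H by lra; lra.
- intros [H1 [H2 [H3 H4]]]; split; [|split; [|exact H4]].
  + split; [exact H1|intros c y; exact (H2 c y)|].
    exists 1; split; [lra|]; intros y; rewrite Rmult_1_l; exact (H3 y).
  + apply is_lub_Rbar_unique; split.
    * intros r [x [Hx ->]]; simpl; eapply Rle_trans; [apply H3|exact Hx].
    * intros b Hb; apply (Hb 1); exists u; rewrite H4, Hu, Cmod_R, Rabs_R1; split; lra.
Qed.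

Context (Vsmooth : smooth V).

(** Smoothness provides norming functionals, which elsewhere would come from the
    Hahn-Banach theorem. *)
Lemma norming_exists (x : V) : exists phi, norming x phi.
Proof.
destruct (classic (x = zero)) as [->|Hx].
- exists (fun _ => 0%C); repeat split; intros; try ring.
  + rewrite Cmod_0; apply norm_ge_0.
  + rewrite (norm_zero (K := C_AbsRing) (V := V)); reflexivity.
- assert (Hp := norm_pos x Hx); assert (Hu := norm_normalize x Hx).
  destruct (Vsmooth _ Hu) as [phi [Hphi _]].
  apply support_functional_norming in Hphi; [|exact Hu].
  destruct Hphi as [H1 [H2 [H3 H4]]].
  exists phi; split; [exact H1|split; [exact H2|split; [exact H3|]]].
  rewrite H2, Hu in H4.
  assert (Hne : RtoC (norm x) <> 0%C) by (apply RtoC_neq_0; lra).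
  rewrite RtoC_inv in H4 by lra.
  replace (phi x) with (RtoC (norm x) * (/ RtoC (norm x) * phi x))%C by (field; exact Hne).
  rewrite H4; ring.
Qed.

Lemma norming_unique (u : V) (phi psi : V -> C) : norm u = 1 ->
  norming u phi -> norming u psi -> phi = psi.
Proof.
intros Hu H1 H2; destruct (Vsmooth u Hu) as [chi [_ Hc]].
rewrite <- (Hc phi), <- (Hc psi); auto; apply support_functional_norming; assumption.
Qed.

Lemma norm_le_norming (x : V) (M : R) :
  (forall phi, norming x phi -> Cmod (phi x) <= M) -> norm x <= M.
Proof.
intros H; destruct (norming_exists x) as [phi Hphi]; specialize (H phi Hphi).
rewrite (proj2 (proj2 (proj2 Hphi))), Cmod_R in H.
rewrite Rabs_pos_eq in H by apply norm_ge_0; exact H.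
Qed.

Lemma ultralimit_functional (phi : nat -> V -> C) :
  (forall n y z, phi n (plus y z) = (phi n y + phi n z)%C) ->
  (forall n c y, phi n (c *: y) = (c * phi n y)%C) ->
  (forall n y, Cmod (phi n y) <= norm y) ->
  exists psi : V -> C,
    (forall y z, psi (plus y z) = (psi y + psi z)%C) /\
    (forall c y, psi (c *: y) = (c * psi y)%C) /\
    (forall y, Cmod (psi y) <= norm y) /\
    forall y, ultralimit (fun n => phi n y) (psi y).
Proof.
intros H1 H2 H3.
destruct (choice (fun y l => ultralimit (fun n => phi n y) l)) as [psi Hpsi].
{ intros y; apply (bounded_ultralimit _ (norm y)); intros n; apply H3. }
exists psi; repeat split.
- intros y z; apply (ultralimit_unique (fun n => phi n (plus y z))); [apply Hpsi|].
  replace (fun n => phi n (plus y z)) with (fun n => phi n y + phi n z)%C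
    by (apply functional_extensionality; intros n; rewrite H1; reflexivity).
  apply ultralimit_plus; apply Hpsi.
- intros c y; apply (ultralimit_unique (fun n => phi n (c *: y))); [apply Hpsi|].
  replace (fun n => phi n (c *: y)) with (fun n => c * phi n y)%C
    by (apply functional_extensionality; intros n; rewrite H2; reflexivity).
  apply ultralimit_scal, Hpsi.
- intros y; apply (ultralimit_bound (fun n => phi n y)); [|apply Hpsi].
  apply mostly_all; intros n; apply H3.
- exact Hpsi.
Qed.

(** One-sided Gateaux differentiability: norming functionals of [u + t v] with
    [t -> 0] accumulate at a norming functional of [u], and there is only one. *)
Lemma smooth_gateaux (u v : V) (phi : V -> C) (eps : R) :
  norm u = 1 -> norming u phi -> 0 < eps ->
  exists delta, 0 < delta /\ forall t, 0 < t < delta ->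
    norm (plus u (RtoC t *: v)) <= 1 + t * (fst (phi v) + eps).
Proof.
intros Hu Hphi He; apply NNPP; intros HN.
assert (Hex : forall n : nat, exists t, 0 < t < / (INR n + 1) /\
  1 + t * (fst (phi v) + eps) < norm (plus u (RtoC t *: v))).
{ intros n; apply NNPP; intros HN2; apply HN; exists (/ (INR n + 1)); split.
  - apply Rinv_0_lt_compat; assert (H := pos_INR n); lra.
  - intros t Ht; apply Rnot_lt_le; intros Hlt; apply HN2; exists t; auto. }
destruct (choice _ Hex) as [t Ht].
destruct (choice (fun n psi => norming (plus u (RtoC (t n) *: v)) psi)) as [f Hf].
{ intros n; apply norming_exists. }
destruct (ultralimit_functional f) as [psi [P1 [P2 [P3 P4]]]]; try (intros n; apply Hf).
assert (Hval : forall n, (f n u + RtoC (t n) * f n v)%C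
  = RtoC (norm (plus u (RtoC (t n) *: v)))).
{ intros n; rewrite <- (proj2 (proj2 (proj2 (Hf n)))).
  rewrite (proj1 (Hf n)), (proj1 (proj2 (Hf n))); reflexivity. }
assert (Hpsi : norming u psi).
{ split; [exact P1|split; [exact P2|split; [exact P3|]]].
  rewrite Hu; apply (ultralimit_unique (fun n => f n u)); [apply P4|].
  intros e Hee; assert (Hv := norm_ge_0 v).
  assert (Hq : 0 < e / (2 * norm v + 1)) by (apply Rdiv_lt_0_compat; lra).
  generalize (mostly_inv_lt _ Hq); apply mostly_imp; intros n Hn.
  destruct (Ht n) as [Htn _].
  set (s := t n) in *.
  assert (B1 : Cmod (f n v) <= norm v) by apply Hf.
  assert (B2 : Rabs (norm (plus u (RtoC s *: v)) - 1) <= s * norm v).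
  { assert (T1 := norm_triangle u (RtoC s *: v)).
    assert (T2 := norm_minus_le (plus u (RtoC s *: v)) (RtoC s *: v)).
    assert (E : minus (plus u (RtoC s *: v)) (RtoC s *: v) = u).
    { exact (plus_minus_cancel (G := V) u (RtoC s *: v)). }
    rewrite E, norm_scalC, Cmod_R in T2.
    rewrite norm_scalC, Cmod_R in T1.
    rewrite (Rabs_pos_eq s) in T1, T2 by lra.
    apply Rabs_le; lra. }
  replace (f n u - 1)%C with (RtoC (norm (plus u (RtoC s *: v)) - 1) - RtoC s * f n v)%C
    by (rewrite RtoC_minus; unfold s; rewrite <- (Hval n); ring).
  eapply Rle_lt_trans; [apply Cmod_triangle_minus|].
  rewrite Cmod_mult, !Cmod_R, (Rabs_pos_eq s) by lra.
  assert (B3 : s * Cmod (f n v) <= s * norm v) by (apply Rmult_le_compat_l; lra).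
  assert (B4 : s < e / (2 * norm v + 1)) by lra.
  apply (Rmult_lt_compat_r (2 * norm v + 1)) in B4; [|lra].
  replace (e / (2 * norm v + 1) * (2 * norm v + 1)) with e in B4 by (field; lra); nra. }
assert (E := norming_unique u phi psi Hu Hphi Hpsi); subst psi.
destruct (mostly_ex _ (P4 v eps He)) as [n Hn].
destruct (Ht n) as [Htn Hlt].
assert (E1 := Hval n); apply (f_equal fst) in E1.
assert (Hfu : Cmod (f n u) <= 1) by (rewrite <- Hu; apply Hf).
assert (B1 := re_le_Cmod (f n u)); apply Rabs_le_between in B1; unfold Re in B1.
assert (B2 := re_le_Cmod (f n v - phi v)); apply Rabs_le_between in B2.
unfold Re in B2; simpl in B2, E1.
assert (B3 : fst (f n v) < fst (phi v) + eps) by lra.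
assert (B4 : t n * fst (f n v) < t n * (fst (phi v) + eps))
  by (apply Rmult_lt_compat_l; lra).
lra.
Qed.

(** * Functionals on finite-dimensional subspaces *)

Fixpoint span (l : list V) (x : V) : Prop :=
  match l with
  | nil => x = zero
  | cons v l' => exists a y, span l' y /\ x = plus (a *: v) y
  end.

Lemma span_scal (l : list V) (c : C) (x : V) : span l x -> span l (c *: x).
Proof.
revert x; induction l as [|v l IH]; simpl; intros x.
- intros ->; apply (scal_zero_r (K := C_AbsRing) (V := V)).
- intros [a [y [Hy ->]]]; exists (c * a)%C, (c *: y); split; [apply IH, Hy|].
  rewrite scalC_plus_r, scalC_assoc; reflexivity.
Qed.

Lemma span_plus (l : list V) (x y : V) : span l x -> span l y -> span l (plus x y).
Proof.
revert x y; induction l as [|v l IH]; simpl; intros x y.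
- intros -> ->; apply plus_zero_l.
- intros [a [x' [Hx ->]]] [b [y' [Hy ->]]]; exists (a + b)%C, (plus x' y').
  split; [apply IH; assumption|].
  rewrite scalC_plus_l, <- !plus_assoc; f_equal.
  rewrite !plus_assoc; f_equal; apply plus_comm.
Qed.

Lemma span_zero (l : list V) : span l zero.
Proof.
induction l as [|v l IH]; simpl; [reflexivity|].
exists (RtoC 0), zero; split; [exact IH|]; rewrite scalC_0, plus_zero_l; reflexivity.
Qed.

Lemma span_in (l : list V) (v : V) : In v l -> span l v.
Proof.
induction l as [|w l IH]; simpl; [contradiction|].
intros [->|H].
- exists (RtoC 1), zero; split; [apply span_zero|].
  rewrite scalC_1, plus_zero_r; reflexivity.
- exists (RtoC 0), v; split; [apply IH, H|].
  rewrite scalC_0, plus_zero_l; reflexivity.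
Qed.

Definition norm_ultralimit (x : nat -> V) (y : V) : Prop :=
  forall eps, 0 < eps -> mostly (fun n => norm (minus (x n) y) < eps).

(** Compactness makes the subspace closed, so that it stays away from [v]. *)
Lemma span_distance (l : list V) (v : V) :
  (forall (x : nat -> V) M, (forall n, span l (x n)) -> (forall n, norm (x n) <= M) ->
    exists y, span l y /\ norm_ultralimit x y) ->
  ~ span l v -> exists d, 0 < d /\ forall y, span l y -> d <= norm (minus v y).
Proof.
intros HC Hv; apply NNPP; intros HN.
assert (Hex : forall n : nat, exists y, span l y /\ norm (minus v y) < / (INR n + 1)).
{ intros n; apply NNPP; intros HN2; apply HN; exists (/ (INR n + 1)); split.
  - apply Rinv_0_lt_compat; assert (H := pos_INR n); lra.
  - intros y Hy; apply Rnot_lt_le; intros Hlt; apply HN2; exists y; auto. }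
destruct (choice _ Hex) as [x Hx].
destruct (HC x (norm v + 1)) as [y [Hy Hlim]].
{ intros n; apply Hx. }
{ intros n; destruct (Hx n) as [_ H]; assert (H1 := norm_minus_ge (x n) v).
  rewrite norm_minus_sym in H1.
  assert (H2 : / (INR n + 1) <= 1).
  { rewrite <- Rinv_1; apply Rinv_le_contravar; assert (K := pos_INR n); lra. }
  lra. }
apply Hv; replace v with y; [exact Hy|]; symmetry.
assert (E : minus v y = zero).
{ apply norm_eq_zero; apply Rle_antisym; [|apply norm_ge_0].
  apply le_epsilon; intros eps He.
  destruct (mostly_ex _ (mostly_and _ _ (Hlim (eps / 2) ltac:(lra))
    (mostly_inv_lt (eps / 2) ltac:(lra)))) as [n [H1 H2]].
  assert (H3 := norm_minus_chain v (x n) y).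
  destruct (Hx n) as [_ H4]; lra. }
rewrite <- (minus_plus_cancel v y), E; apply plus_zero_l.
Qed.

(** Adding a vector [v] outside of the closed subspace [span l] bounds its
    coefficient by the distance from [v] to [span l]. *)
Lemma span_compact (l : list V) (x : nat -> V) (M : R) :
  (forall n, span l (x n)) -> (forall n, norm (x n) <= M) ->
  exists y, span l y /\ norm_ultralimit x y.
Proof.
revert x M; induction l as [|v l IH]; intros x M Hx HM.
- exists zero; split; [reflexivity|]; intros eps He; apply mostly_all; intros n.
  assert (E : minus (x n) zero = (zero : V)) by (rewrite (Hx n); exact (minus_eq_zero (G := V) zero)).
  assert (E2 : norm (minus (x n) (zero : V)) = 0).
  { transitivity (norm (zero : V)); [f_equal; exact E|].
    exact (norm_zero (K := C_AbsRing) (V := V)). }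
  eapply Rle_lt_trans; [right; exact E2|exact He].
- destruct (classic (span l v)) as [Hv|Hv].
  { destruct (IH x M) as [y [Hy Hlim]]; [|exact HM|].
    - intros n; destruct (Hx n) as [a [z [Hz ->]]]; apply span_plus; [|exact Hz].
      apply span_scal, Hv.
    - exists y; split; [|exact Hlim].
      exists (RtoC 0), y; split; [exact Hy|]; rewrite scalC_0, plus_zero_l; reflexivity. }
  destruct (span_distance l v IH Hv) as [d [Hd Hdist]].
  assert (Hex : forall n, exists az : C * V, span l (snd az) /\
    x n = plus (fst az *: v) (snd az)).
  { intros n; destruct (Hx n) as [a [z [Hz E]]]; exists (a, z); auto. }
  destruct (choice _ Hex) as [az Haz].
  assert (Ha : forall n, Cmod (fst (az n)) <= M / d).
  { intros n; destruct (Haz n) as [H1 H2]; set (a := fst (az n)) in *.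
    destruct (classic (a = 0%C)) as [->|Ha].
    - rewrite Cmod_0; apply Rmult_le_pos; [|apply Rlt_le, Rinv_0_lt_compat, Hd].
      eapply Rle_trans; [apply (norm_ge_0 (x n))|apply (HM n)].
    - assert (Hp := proj1 (Cmod_gt_0 _) Ha).
      assert (H3 := Hdist _ (span_scal l (- / a)%C _ H1)).
      rewrite minusC, scalC_assoc in H3.
      replace (RtoC (-1) * - / a)%C with (/ a)%C in H3
        by (rewrite RtoC_minus_1; ring).
      assert (E : x n = a *: plus v ((/ a)%C *: snd (az n))).
      { rewrite H2, scalC_plus_r, scalC_assoc, Cinv_r, scalC_1 by exact Ha; reflexivity. }
      assert (H4 := HM n); rewrite E, norm_scalC in H4.
      apply Rmult_le_reg_r with d; [exact Hd|].
      replace (M / d * d) with M by (field; lra); nra. }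
  destruct (bounded_ultralimit (fun n => fst (az n)) (M / d) Ha) as [a Hlima].
  destruct (IH (fun n => snd (az n)) (M + M / d * norm v)) as [y [Hy Hlimy]].
  { intros n; apply Haz. }
  { intros n.
    assert (E : snd (az n) = minus (x n) (fst (az n) *: v)).
    { rewrite (proj2 (Haz n)), (plus_comm _ (snd (az n))); symmetry.
      exact (plus_minus_cancel (G := V) _ _). }
    rewrite E; eapply Rle_trans; [apply norm_minus_le|]; rewrite norm_scalC.
    apply Rplus_le_compat; [apply HM|].
    apply Rmult_le_compat_r; [apply norm_ge_0|apply Ha]. }
  exists (plus (a *: v) y); split; [exists a, y; auto|].
  intros eps He; assert (Hv0 := norm_ge_0 v).
  assert (Hq : 0 < eps / (2 * (norm v + 1))) by (apply Rdiv_lt_0_compat; lra).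
  generalize (mostly_and _ _ (Hlima _ Hq) (Hlimy (eps / 2) ltac:(lra))).
  apply mostly_imp; intros n [H1 H2].
  rewrite (proj2 (Haz n)); set (b := fst (az n)) in *; set (z := snd (az n)) in *.
  assert (E : minus (plus (b *: v) z) (plus (a *: v) y)
    = plus ((b - a)%C *: v) (minus z y)).
  { unfold Cminus; rewrite scalC_plus_l.
    replace ((- a)%C *: v) with (opp (a *: v)).
    - exact (minus_plus_plus (G := V) _ _ _ _).
    - rewrite oppC, scalC_assoc; f_equal; rewrite RtoC_minus_1; ring. }
  eapply Rle_lt_trans; [right; apply (f_equal norm E)|].
  eapply Rle_lt_trans; [apply norm_triangle|]; rewrite norm_scalC.
  assert (B : Cmod (b - a) * norm v <= Cmod (b - a) * (norm v + 1)).
  { apply Rmult_le_compat_l; [apply Cmod_ge_0|lra]. }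
  apply (Rmult_lt_compat_r (norm v + 1)) in H1; [|lra].
  replace (eps / (2 * (norm v + 1)) * (norm v + 1)) with (eps / 2) in H1 by (field; lra).
  lra.
Qed.

Lemma eq_of_fst_le (a b : C) : fst a <= fst b -> fst (- a)%C <= fst (- b)%C ->
  fst (Ci * a)%C <= fst (Ci * b)%C -> fst (- (Ci * a))%C <= fst (- (Ci * b))%C -> a = b.
Proof. destruct a, b; simpl; intros; f_equal; lra. Qed.

(** On a finite-dimensional subspace every functional is a multiple of a norming
    functional of the whole space: its norm there is attained, and Gateaux
    differentiability at the maximum identifies the functional. *)
Lemma functional_on_span (l : list V) (lam : V -> C) : functional lam ->
  (forall y, span l y -> lam y = 0%C) \/
  exists x phi c, norm x = 1 /\ norming x phi /\ forall y, span l y -> lam y = (c * phi y)%C.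
Proof.
intros Hlam; assert (Hlam' := Hlam); destruct Hlam' as [L1 [L2 [M [HM0 HM]]]].
destruct (classic (forall y, span l y -> lam y = 0%C)) as [H|H]; [left; exact H|right].
assert (H0 : exists y0, span l y0 /\ lam y0 <> 0%C).
{ apply NNPP; intros K; apply H; intros y Hy; apply NNPP; intros K2; apply K; exists y; auto. }
destruct H0 as [y0 [Hy0 Hl0]].
set (A := fun r => exists y, span l y /\ norm y <= 1 /\ r = fst (lam y)).
assert (HA1 : bound A).
{ exists M; intros r [y [_ [Hy ->]]].
  eapply Rle_trans; [apply Rle_abs|]; eapply Rle_trans; [apply (re_le_Cmod (lam y))|].
  eapply Rle_trans; [apply HM|]; nra. }
assert (HA2 : exists r, A r).
{ exists (fst (lam zero)), zero; split; [apply span_zero|].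
  rewrite (norm_zero (K := C_AbsRing) (V := V)); split; [lra|reflexivity]. }
destruct (completeness A HA1 HA2) as [c [Hc1 Hc2]].
assert (Hpos : 0 < c).
{ assert (Hy0z : y0 <> zero).
  { intros E; apply Hl0; rewrite E; apply functional_zero, Hlam. }
  assert (Hp := norm_pos y0 Hy0z); assert (Hp2 := proj1 (Cmod_gt_0 _) Hl0).
  set (k := (Cconj (lam y0) / (RtoC (Cmod (lam y0)) * RtoC (norm y0)))%C).
  assert (E : lam (k *: y0) = RtoC (Cmod (lam y0) / norm y0)).
  { rewrite L2; unfold k.
    replace (Cconj (lam y0) / (RtoC (Cmod (lam y0)) * RtoC (norm y0)) * lam y0)%C
      with ((lam y0 * Cconj (lam y0)) / (RtoC (Cmod (lam y0)) * RtoC (norm y0)))%C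
      by (field; split; apply RtoC_neq_0; lra).
    rewrite <- Cmod2_conj.
    replace (RtoC (Cmod (lam y0) ^ 2)) with (RtoC (Cmod (lam y0)) * RtoC (Cmod (lam y0)))%C
      by (rewrite <- RtoC_mult; f_equal; ring).
    rewrite RtoC_div by lra; field; split; apply RtoC_neq_0; lra. }
  apply Rlt_le_trans with (Cmod (lam y0) / norm y0); [apply Rdiv_lt_0_compat; assumption|].
  apply Hc1; exists (k *: y0); split; [apply span_scal, Hy0|split].
  - rewrite norm_scalC; unfold k.
    rewrite Cmod_div by (apply Cmult_neq_0; apply RtoC_neq_0; lra).
    rewrite Cmod_mult, Cmod_conj, !Cmod_R, !Rabs_pos_eq by lra.
    right; field; split; lra.
  - rewrite E; reflexivity. }
assert (Hhom : forall y, span l y -> fst (lam y) <= c * norm y).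
{ intros y Hy; destruct (classic (y = zero)) as [->|Hyz].
  - rewrite functional_zero by exact Hlam; simpl.
    rewrite (norm_zero (K := C_AbsRing) (V := V)); lra.
  - assert (Hp := norm_pos y Hyz).
    assert (K : fst (lam (RtoC (/ norm y) *: y)) <= c).
    { apply Hc1; exists (RtoC (/ norm y) *: y); split; [apply span_scal, Hy|].
      rewrite norm_normalize by exact Hyz; split; [lra|reflexivity]. }
    rewrite L2 in K; simpl in K; rewrite Rmult_0_l, Rminus_0_r in K.
    apply (Rmult_le_compat_l (norm y)) in K; [|lra].
    rewrite <- Rmult_assoc, Rinv_r, Rmult_1_l in K by lra; lra. }
assert (Hex : forall n : nat, exists y, span l y /\ norm y <= 1 /\
  c - / (INR n + 1) < fst (lam y)).
{ intros n; apply NNPP; intros K.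
  assert (Hub : is_upper_bound A (c - / (INR n + 1))).
  { intros r [y [Hy [Hy1 ->]]]; apply Rnot_lt_le; intros Hlt; apply K; exists y; auto. }
  specialize (Hc2 _ Hub).
  assert (0 < / (INR n + 1)) by (apply Rinv_0_lt_compat; assert (Q := pos_INR n); lra).
  lra. }
destruct (choice _ Hex) as [z Hz].
destruct (span_compact l z 1) as [x [Hx Hlim]]; try (intros n; apply Hz).
assert (Hx1 : norm x <= 1).
{ apply le_epsilon; intros eps He; destruct (mostly_ex _ (Hlim eps He)) as [n Hn].
  rewrite norm_minus_sym in Hn; assert (K := norm_minus_ge x (z n)).
  destruct (Hz n) as [_ [K2 _]]; lra. }
assert (Hxc : c <= fst (lam x)).
{ apply le_epsilon; intros eps He.
  assert (Hq : 0 < eps / (2 * (M + 1))) by (apply Rdiv_lt_0_compat; lra).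
  destruct (mostly_ex _ (mostly_and _ _ (Hlim _ Hq) (mostly_inv_lt (eps / 2) ltac:(lra))))
    as [n [H1 H2]].
  destruct (Hz n) as [_ [_ K]].
  assert (B := re_le_Cmod (lam (minus (z n) x))); rewrite functional_minus in B by exact Hlam.
  apply Rabs_le_between in B; unfold Re in B; simpl in B.
  assert (B2 := HM (minus (z n) x)); rewrite functional_minus in B2 by exact Hlam.
  assert (B3 := norm_ge_0 (minus (z n) x)).
  apply (Rmult_lt_compat_r (M + 1)) in H1; [|lra].
  replace (eps / (2 * (M + 1)) * (M + 1)) with (eps / 2) in H1 by (field; lra).
  assert (B4 : Cmod (lam (z n) - lam x) < eps / 2).
  { eapply Rle_lt_trans; [exact B2|]; eapply Rle_lt_trans; [|exact H1].
    rewrite Rmult_comm; apply Rmult_le_compat_l; [exact B3|lra]. }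
  lra. }
assert (Hxn : norm x = 1).
{ apply Rle_antisym; [exact Hx1|]; specialize (Hhom x Hx); nra. }
assert (Hxl : fst (lam x) = c) by (specialize (Hhom x Hx); rewrite Hxn in Hhom; lra).
destruct (norming_exists x) as [phi Hphi].
exists x, phi, (RtoC c); split; [exact Hxn|split; [exact Hphi|]].
assert (Hle : forall y, span l y -> fst (lam y) <= c * fst (phi y)).
{ intros y Hy; apply le_epsilon; intros eps He.
  assert (Hq : 0 < eps / c) by (apply Rdiv_lt_0_compat; assumption).
  destruct (smooth_gateaux x y phi _ Hxn Hphi Hq) as [d [Hd Hg]].
  specialize (Hg (d / 2) ltac:(lra)).
  assert (K := Hhom (plus x (RtoC (d / 2) *: y)) (span_plus l _ _ Hx (span_scal l _ _ Hy))).
  rewrite L1, L2 in K; simpl in K; rewrite Hxl in K.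
  assert (K2 : c * norm (plus x (RtoC (d / 2) *: y))
    <= c * (1 + d / 2 * (fst (phi y) + eps / c))) by (apply Rmult_le_compat_l; lra).
  replace (c * (1 + d / 2 * (fst (phi y) + eps / c)))
    with (c + d / 2 * (c * fst (phi y) + eps)) in K2 by (field; lra).
  apply Rmult_le_reg_l with (d / 2); [lra|]; lra. }
intros y Hy; assert (Hp2 := proj1 (proj2 Hphi)).
assert (Hfst : forall w, fst (RtoC c * w)%C = c * fst w) by (intros w; simpl; ring).
assert (Em : forall w : C, (RtoC (-1) * w)%C = (- w)%C) by (intros w; rewrite RtoC_minus_1; ring).
apply eq_of_fst_le.
- rewrite Hfst; apply Hle, Hy.
- assert (K := Hle _ (span_scal l (RtoC (-1)) y Hy)); rewrite L2, Hp2, !Em in K.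
  replace (- (RtoC c * phi y))%C with (RtoC c * - phi y)%C by ring; rewrite Hfst; exact K.
- assert (K := Hle _ (span_scal l Ci y Hy)); rewrite L2, Hp2 in K.
  replace (Ci * (RtoC c * phi y))%C with (RtoC c * (Ci * phi y))%C by ring.
  rewrite Hfst; exact K.
- assert (K := Hle _ (span_scal l (RtoC (-1)) _ (span_scal l Ci y Hy))).
  rewrite !L2, !Hp2, !Em in K.
  replace (- (Ci * (RtoC c * phi y)))%C with (RtoC c * - (Ci * phi y))%C by ring.
  rewrite Hfst; exact K.
Qed.

End Normed.

(** * Vector-valued analytic functions *)

Section Analytic.

Context {E : CompleteNormedModule C_AbsRing}.

Local Notation EN := (CompleteNormedModule.NormedModule C_AbsRing E).
Local Notation vadd := (@plus (NormedModule.AbelianMonoid C_AbsRing EN)).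
Local Notation vsub := (@minus (NormedModule.AbelianGroup C_AbsRing EN)).
Local Notation vzero := (@zero (NormedModule.AbelianMonoid C_AbsRing EN)).
Local Notation "c *: x" := (@scal _ (NormedModule.ModuleSpace C_AbsRing EN) (c : C) x)
  (at level 40).


Lemma is_derive_C_ext_loc (f g : C -> E) (z : C) (l : E) :
  (exists delta, 0 < delta /\ forall w, Cmod (w - z) < delta -> f w = g w) ->
  is_derive (K := C_AbsRing) f z l -> is_derive (K := C_AbsRing) g z l.
Proof.
intros [d [Hd H]] Hf; apply is_derive_C_iff; intros eps He.
destruct (proj1 (is_derive_C_iff _ _ _) Hf eps He) as [d2 [Hd2 H2]].
exists (Rmin d d2); split; [apply Rmin_pos; assumption|]; intros w Hw.
rewrite <- (H w), <- (H z).
- apply H2; eapply Rlt_le_trans; [exact Hw|apply Rmin_r].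
- rewrite Cmod_minus_self; exact Hd.
- eapply Rlt_le_trans; [exact Hw|apply Rmin_l].
Qed.

Lemma cder_functional (phi : E -> C) (f : C -> E) (z : C) (l : E) : functional phi ->
  is_derive (K := C_AbsRing) f z l -> cder (fun w => phi (f w)) z (phi l).
Proof.
intros Hphi Hf eps He; assert (Hphi' := Hphi); destruct Hphi' as [_ [H2 [M [HM0 HM]]]].
assert (He' : 0 < eps / (M + 1)) by (apply Rdiv_lt_0_compat; lra).
destruct (proj1 (is_derive_C_iff _ _ _) Hf _ He') as [d [Hd H]].
exists d; split; [exact Hd|]; intros w Hw; specialize (H w Hw).
replace (phi (f w) - phi (f z) - phi l * (w - z))%C
  with (phi (vsub (vsub (f w) (f z)) ((w - z)%C *: l)))
  by (rewrite !(functional_minus phi), H2 by exact Hphi; ring).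
eapply Rle_trans; [apply HM|].
assert (Hn := Cmod_ge_0 (w - z)).
apply Rle_trans with (M * (eps / (M + 1) * Cmod (w - z))).
- apply Rmult_le_compat_l; [exact HM0|exact H].
- replace (eps * Cmod (w - z)) with ((M + 1) * (eps / (M + 1) * Cmod (w - z)))
    by (field; lra).
  apply Rmult_le_compat_r; [apply Rmult_le_pos; lra|lra].
Qed.

Lemma holo_functional (phi : E -> C) (f : C -> E) : functional phi ->
  analytic_on_disc f -> holo (fun w => phi (f w)).
Proof.
intros Hphi Hf z Hz; destruct (Hf z Hz) as [l Hl]; exists (phi l).
apply cder_functional; assumption.
Qed.

Lemma deriv_functional (phi : E -> C) (f : C -> E) (z : C) : functional phi ->
  analytic_on_disc f -> unit_disc z -> deriv (fun w => phi (f w)) z = phi (vderive f z).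
Proof.
intros Hphi Hf Hz; apply deriv_unique, cder_functional; [exact Hphi|].
apply vderive_correct, Hf, Hz.
Qed.

Lemma analytic_continuous (f : C -> E) (z : C) (l : E) :
  is_derive (K := C_AbsRing) f z l -> forall eps, 0 < eps -> exists delta, 0 < delta /\
    forall w, Cmod (w - z) < delta -> norm (vsub (f w) (f z)) < eps.
Proof.
intros Hf eps He.
destruct (proj1 (is_derive_C_iff _ _ _) Hf 1 Rlt_0_1) as [d [Hd H]].
assert (Hl := norm_ge_0 l).
assert (Hq : 0 < eps / (norm l + 1)) by (apply Rdiv_lt_0_compat; lra).
exists (Rmin d (eps / (norm l + 1))); split; [apply Rmin_pos; assumption|]; intros w Hw.
specialize (H w (Rlt_le_trans _ _ _ Hw (Rmin_l _ _))).
assert (Hw2 := Rlt_le_trans _ _ _ Hw (Rmin_r _ _)).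
assert (H2 := norm_minus_ge (vsub (f w) (f z)) ((w - z)%C *: l)).
rewrite (norm_scalC (V := E)) in H2.
apply (Rmult_lt_compat_r (norm l + 1)) in Hw2; [|lra].
replace (eps / (norm l + 1) * (norm l + 1)) with eps in Hw2 by (field; lra).
lra.
Qed.

Context (Esmooth : smooth E).

(** Vector identities become scalar ones, which are solved by [ring]. *)
Lemma eq_of_norming (x y : E) : (forall phi z, norming z phi -> phi x = phi y) -> x = y.
Proof.
intros H.
assert (E0 : vsub x y = vzero).
{ apply norm_eq_zero; apply Rle_antisym; [|apply norm_ge_0].
  apply (norm_le_norming Esmooth); intros phi Hphi.
  rewrite (functional_minus phi) by exact (norming_functional _ _ Hphi).
  rewrite (H phi _ Hphi); replace (phi y - phi y)%C with (RtoC 0) by ring.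
  rewrite Cmod_0; lra. }
rewrite <- ((minus_plus_cancel (V := E)) x y), E0; apply plus_zero_l.
Qed.

(** Cauchy's formula applies to the scalar functions [phi o f], uniformly in the
    functionals [phi] of norm one, and these compute the norm. *)
Lemma vderive_continuous (f : C -> E) (z : C) : analytic_on_disc f -> unit_disc z ->
  forall eps, 0 < eps -> exists delta, 0 < delta /\ forall w, Cmod (w - z) < delta ->
    unit_disc w /\ norm (vsub (vderive f w) (vderive f z)) < eps.
Proof.
intros Hf Hz eps He; assert (HPI := PI_RGT_0); unfold unit_disc in Hz.
assert (Hz0 := Cmod_ge_0 z).
set (rho := (2 * Cmod z + 1) / 3); set (r := (Cmod z + 2) / 3).
assert (Hcirc : forall th, unit_disc (circ r th))
  by (intros th; unfold unit_disc; rewrite Cmod_circ; unfold r; lra).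
destruct (continuous_bounded (fun th => norm (f (circ r th))) 0 (2 * PI)) as [M HM]; [lra| |].
{ intros th Hth; apply filterlim_locally; intros e.
  destruct (Hf _ (Hcirc th)) as [l Hl].
  destruct (analytic_continuous f _ l Hl e (cond_pos e)) as [d [Hd H]].
  destruct (proj1 (rcont_iff _ _) (rcont_circ r th) d Hd) as [d2 [Hd2 H2]].
  exists (mkposreal d2 Hd2); intros s Hs; specialize (H _ (H2 s Hs)).
  eapply Rle_lt_trans; [apply norm_lipschitz|exact H]. }
set (B := M * 4 / (r - rho) ^ 4).
assert (HB := Rabs_pos B).
assert (Hq : 0 < eps / (Rabs B + 1)) by (apply Rdiv_lt_0_compat; lra).
exists (Rmin (rho - Cmod z) (eps / (Rabs B + 1))); split.
{ apply Rmin_pos; [unfold rho; lra|exact Hq]. }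
intros w Hw.
assert (Hw1 := Rlt_le_trans _ _ _ Hw (Rmin_l _ _)).
assert (Hw2 := Rlt_le_trans _ _ _ Hw (Rmin_r _ _)).
assert (Hwr : Cmod w <= rho) by (assert (K := Cmod_minus_ge w z); lra).
assert (Hwd : unit_disc w) by (unfold unit_disc, rho in *; lra).
split; [exact Hwd|].
apply Rle_lt_trans with (B * Cmod (w - z)).
- apply (norm_le_norming Esmooth); intros phi Hphi.
  assert (HF := norming_functional _ _ Hphi).
  rewrite (functional_minus phi) by exact HF.
  rewrite <- !(deriv_functional phi f) by assumption.
  apply (deriv_lipschitz (fun w => phi (f w)) r rho M); try (unfold r, rho in *; lra).
  + apply holo_functional; assumption.
  + intros th Hth; eapply Rle_trans; [apply Hphi|exact (HM th Hth)].
- apply (Rmult_lt_compat_r (Rabs B + 1)) in Hw2; [|lra].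
  replace (eps / (Rabs B + 1) * (Rabs B + 1)) with eps in Hw2 by (field; lra).
  assert (K := Rle_abs B); assert (K2 := Cmod_ge_0 (w - z)); nra.
Qed.

(** * The little Bloch space *)

(** The embedding of the Bloch space into the functions vanishing at the circle. *)
Definition wderive (f : C -> E) (z : C) : E := RtoC (1 - Cmod z ^ 2) *: vderive f z.

Lemma norm_wderive (f : C -> E) (z : C) : unit_disc z ->
  norm (wderive f z) = weighted_derive f z.
Proof.
intros Hz; unfold wderive, weighted_derive; rewrite (norm_scalC (V := E)), Cmod_R, Rabs_pos_eq;
  [reflexivity|apply Rlt_le, weight_pos, Hz].
Qed.

Lemma vderive_plus (f g : B0 E) (z : C) : unit_disc z ->
  vderive (B0_plus f g) z = vadd (vderive f z) (vderive g z).
Proof.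
intros Hz; apply vderive_unique.
apply (is_vderive_plus f g); apply vderive_correct; apply B0_analytic, Hz.
Qed.

Lemma vderive_scal (c : C) (f : B0 E) (z : C) : unit_disc z ->
  vderive (B0_scal c f) z = c *: vderive f z.
Proof.
intros Hz; apply vderive_unique.
apply (is_vderive_scal c f); apply vderive_correct; apply B0_analytic, Hz.
Qed.

Lemma wderive_plus (f g : B0 E) (z : C) : unit_disc z ->
  wderive (B0_plus f g) z = vadd (wderive f z) (wderive g z).
Proof.
intros Hz; unfold wderive; rewrite vderive_plus by exact Hz; apply (scalC_plus_r (V := E)).
Qed.

Lemma wderive_scal (c : C) (f : B0 E) (z : C) : unit_disc z ->
  wderive (B0_scal c f) z = c *: wderive f z.
Proof.
intros Hz; unfold wderive; rewrite vderive_scal by exact Hz.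
rewrite !(scalC_assoc (V := E)); f_equal; ring.
Qed.

Lemma ccont_weight (z : C) : ccont (fun w => RtoC (1 - Cmod w ^ 2)) z.
Proof.
apply (ccont_ext_loc (fun w => 1 + RtoC (-1) * (w * Cconj w))%C).
- exists 1; split; [lra|]; intros w _; rewrite RtoC_minus, Cmod2_conj, RtoC_minus_1; ring.
- apply ccont_plus; [apply ccont_const|]; apply ccont_mult; [apply ccont_const|].
  apply ccont_mult; [apply ccont_id|].
  intros eps He; exists eps; split; [exact He|]; intros w Hw.
  rewrite <- Cminus_conj, Cmod_conj; exact Hw.
Qed.

Lemma weight_le_1 (z : C) : unit_disc z -> Cmod (RtoC (1 - Cmod z ^ 2)) <= 1.
Proof.
intros Hz; assert (H := weight_pos z Hz); rewrite Cmod_R, Rabs_pos_eq by lra.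
assert (H0 := Cmod_ge_0 z); nra.
Qed.

Lemma wderive_continuous (f : C -> E) (z : C) : analytic_on_disc f -> unit_disc z ->
  forall eps, 0 < eps -> exists delta, 0 < delta /\ forall w, Cmod (w - z) < delta ->
    unit_disc w /\ norm (vsub (wderive f w) (wderive f z)) < eps.
Proof.
intros Hf Hz eps He.
set (y := vderive f z).
assert (Hy := norm_ge_0 y).
assert (Hq : 0 < eps / (2 * (norm y + 1))) by (apply Rdiv_lt_0_compat; lra).
destruct (ccont_weight z _ Hq) as [d1 [Hd1 H1]].
destruct (vderive_continuous f z Hf Hz (eps / 2) ltac:(lra)) as [d2 [Hd2 H2]].
exists (Rmin d1 d2); split; [apply Rmin_pos; assumption|]; intros w Hw.
specialize (H1 w (Rlt_le_trans _ _ _ Hw (Rmin_l _ _))).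
destruct (H2 w (Rlt_le_trans _ _ _ Hw (Rmin_r _ _))) as [Hwd H3]; fold y in H3.
split; [exact Hwd|].
set (x := vderive f w) in *.
apply Rle_lt_trans with (Cmod (RtoC (1 - Cmod w ^ 2) - RtoC (1 - Cmod z ^ 2)) * norm y
  + norm (vsub x y)).
- apply (norm_le_norming Esmooth); intros chi Hchi.
  assert (HF := norming_functional _ _ Hchi).
  unfold wderive; fold x; fold y.
  rewrite (functional_minus chi), !(proj1 (proj2 HF)) by exact HF.
  replace (RtoC (1 - Cmod w ^ 2) * chi x - RtoC (1 - Cmod z ^ 2) * chi y)%C
    with ((RtoC (1 - Cmod w ^ 2) - RtoC (1 - Cmod z ^ 2)) * chi y
      + RtoC (1 - Cmod w ^ 2) * (chi x - chi y))%C by ring.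
  rewrite <- (functional_minus chi) by exact HF.
  eapply Rle_trans; [apply Cmod_triangle|]; rewrite !Cmod_mult.
  assert (C1 : Cmod (chi y) <= norm y) by apply Hchi.
  assert (C2 : Cmod (chi (vsub x y)) <= norm (vsub x y)) by apply Hchi.
  apply Rplus_le_compat; [apply Rmult_le_compat_l; [apply Cmod_ge_0|exact C1]|].
  rewrite <- (Rmult_1_l (norm (vsub x y))).
  apply Rmult_le_compat; [apply Cmod_ge_0|apply Cmod_ge_0|apply weight_le_1, Hwd|exact C2].
- set (c := Cmod (RtoC (1 - Cmod w ^ 2) - RtoC (1 - Cmod z ^ 2))) in *.
  assert (Hc : 0 <= c) by apply Cmod_ge_0.
  apply (Rmult_lt_compat_r (norm y + 1)) in H1; [|lra].
  replace (eps / (2 * (norm y + 1)) * (norm y + 1)) with (eps / 2) in H1 by (field; lra).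
  lra.
Qed.

(** The decay at the circle confines the supremum to a compact disc. *)
Lemma B0_attained (f : B0 E) : exists z, unit_disc z /\
  forall w, unit_disc w -> weighted_derive f w <= weighted_derive f z.
Proof.
destruct (classic (exists z, unit_disc z /\ 0 < weighted_derive f z)) as [[z1 [Hz1 Hm]]|HN].
- destruct (B0_little _ f (mkposreal _ Hm)) as [d Hd]; simpl in Hd.
  assert (Hd0 := cond_pos d).
  set (r := Rmax (Cmod z1) (1 - d)).
  assert (Hr1 : r < 1) by (apply Rmax_lub_lt; [exact Hz1|lra]).
  assert (Hr0 : Cmod z1 <= r) by apply Rmax_l.
  assert (Hz0 := Cmod_ge_0 z1).
  destruct (max_on_disc (weighted_derive f) r) as [z [Hz Hmax]]; [lra| |].
  { intros z Hz eps He; assert (Hzd : unit_disc z) by (unfold unit_disc; lra).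
    destruct (wderive_continuous f z (B0_analytic _ f) Hzd eps He) as [d2 [Hd2 H2]].
    exists d2; split; [exact Hd2|]; intros w Hw Hwz; destruct (H2 w Hwz) as [Hwd H3].
    rewrite <- !norm_wderive by assumption.
    eapply Rle_lt_trans; [apply (norm_lipschitz (V := E))|exact H3]. }
  exists z; split; [unfold unit_disc; lra|]; intros w Hw.
  destruct (Rle_lt_dec (Cmod w) r) as [Hwr|Hwr]; [apply Hmax, Hwr|].
  specialize (Hd w Hw); assert (K := Rmax_r (Cmod z1) (1 - d)); fold r in K.
  specialize (Hd ltac:(lra)); specialize (Hmax z1 Hr0).
  apply Rabs_def2 in Hd; lra.
- exists 0%C; split; [apply unit_disc_0|]; intros w Hw.
  apply Rle_trans with 0; [|apply weighted_derive_pos, unit_disc_0].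
  apply Rnot_lt_le; intros Hlt; apply HN; exists w; auto.
Qed.

Lemma B0_norm_eq (f : B0 E) (z : C) : unit_disc z ->
  (forall w, unit_disc w -> weighted_derive f w <= weighted_derive f z) ->
  B0_norm f = Finite (weighted_derive f z).
Proof.
intros Hz H; apply is_lub_Rbar_unique; split.
- intros r [w [Hw ->]]; apply H, Hw.
- intros b Hb; apply Hb; exists z; auto.
Qed.

Lemma B0_norm_le (f : B0 E) (M : R) :
  Rbar_le (B0_norm f) (Finite M) <-> forall z, unit_disc z -> weighted_derive f z <= M.
Proof.
destruct (Lub_Rbar_correct (fun r => exists z, unit_disc z /\ r = weighted_derive f z))
  as [H1 H2]; fold (B0_norm f) in H1, H2.
split.
- intros H z Hz.
  assert (K : Rbar_le (weighted_derive f z) (Finite M)); [|exact K].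
  eapply Rbar_le_trans; [apply H1; exists z; auto|exact H].
- intros H; apply H2; intros r [z [Hz ->]]; exact (H z Hz).
Qed.

(** Elements of the space vanish off the disc, where formulas usually do not. *)
Lemma B0_cutoff (f : C -> E) :
  analytic_on_disc f -> f 0%C = vzero -> vanishes_at_circle (weighted_derive f) ->
  exists g : B0 E, forall z, unit_disc z -> g z = f z /\ vderive g z = vderive f z.
Proof.
intros Ha H0 Hv.
set (G := fun z => if Rlt_dec (Cmod z) 1 then f z else vzero).
assert (HG : forall z, unit_disc z -> G z = f z).
{ intros z Hz; unfold G; destruct (Rlt_dec (Cmod z) 1) as [|n]; [reflexivity|].
  elim n; exact Hz. }
assert (HD : forall z, unit_disc z -> is_derive (K := C_AbsRing) G z (vderive f z)).
{ intros z Hz; apply (is_derive_C_ext_loc f).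
  - destruct (unit_disc_nbhd z Hz) as [d [Hd H]]; exists d; split; [exact Hd|].
    intros w Hw; symmetry; apply HG, H, Hw.
  - apply vderive_correct, Ha, Hz. }
assert (HV : forall z, unit_disc z -> vderive G z = vderive f z).
{ intros z Hz; apply vderive_unique, HD, Hz. }
assert (P1 : forall z, ~ unit_disc z -> G z = vzero).
{ intros z Hz; unfold G; destruct (Rlt_dec (Cmod z) 1) as [n|]; [|reflexivity].
  elim Hz; exact n. }
assert (P2 : analytic_on_disc G) by (intros z Hz; eexists; apply HD, Hz).
assert (P3 : G 0%C = vzero) by (rewrite HG by apply unit_disc_0; exact H0).
assert (P4 : vanishes_at_circle (weighted_derive G)).
{ intros eps; destruct (Hv eps) as [d Hd]; exists d; intros z Hz Hz2.
  unfold weighted_derive; rewrite (HV z Hz); exact (Hd z Hz Hz2). }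
exists (mkB0 G P1 P2 P3 P4); intros z Hz; split; [exact (HG z Hz)|exact (HV z Hz)].
Qed.

(** The source of all test functions: against a bounded derivative the weight
    vanishes at the circle. *)
Lemma B0_of_scalar (h h' : C -> C) (M : R) (e : E) :
  (forall z, unit_disc z -> cder h z (h' z)) ->
  (forall z, unit_disc z -> Cmod (h' z) <= M) ->
  exists g : B0 E, forall z, unit_disc z -> vderive g z = h' z *: e.
Proof.
intros Hh HM; assert (He0 : 0 <= norm e) by apply norm_ge_0.
set (G := fun z => (h z - h 0)%C *: e).
assert (HG : forall z, unit_disc z -> is_derive (K := C_AbsRing) G z (h' z *: e)).
{ intros z Hz; apply is_derive_C_iff; intros eps He.
  assert (Hq : 0 < eps / (norm e + 1)) by (apply Rdiv_lt_0_compat; lra).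
  destruct (Hh z Hz _ Hq) as [d [Hd H]]; exists d; split; [exact Hd|].
  intros w Hw; specialize (H w Hw).
  assert (Hn := Cmod_ge_0 (w - z)).
  apply Rle_trans with (Cmod (h w - h z - h' z * (w - z)) * norm e).
  - apply (norm_le_norming Esmooth); intros chi Hchi.
    assert (HF := norming_functional _ _ Hchi).
    unfold G; rewrite !(functional_minus chi), !(proj1 (proj2 HF)) by exact HF.
    replace ((h w - h 0) * chi e - (h z - h 0) * chi e - (w - z) * (h' z * chi e))%C
      with ((h w - h z - h' z * (w - z)) * chi e)%C by ring.
    rewrite Cmod_mult; apply Rmult_le_compat_l; [apply Cmod_ge_0|apply Hchi].
  - apply Rle_trans with (eps / (norm e + 1) * Cmod (w - z) * norm e).
    + apply Rmult_le_compat_r; assumption.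
    + replace (eps * Cmod (w - z)) with (eps / (norm e + 1) * Cmod (w - z) * (norm e + 1))
        by (field; lra).
      apply Rmult_le_compat_l; [apply Rmult_le_pos|]; lra. }
destruct (B0_cutoff G) as [g Hg].
- intros z Hz; eexists; apply HG, Hz.
- unfold G; replace (h 0 - h 0)%C with (RtoC 0) by ring; apply (scalC_0 (V := E)).
- intros eps; assert (He := cond_pos eps).
  assert (HM0 : 0 <= M).
  { eapply Rle_trans; [apply Cmod_ge_0|apply (HM 0%C), unit_disc_0]. }
  assert (HMe : 0 <= M * norm e) by (apply Rmult_le_pos; assumption).
  assert (Hq : 0 < eps / (2 * (M * norm e + 1))) by (apply Rdiv_lt_0_compat; lra).
  exists (mkposreal _ Hq); simpl; intros z Hz Hz2.
  rewrite Rabs_pos_eq by (apply weighted_derive_pos, Hz).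
  unfold weighted_derive; rewrite (vderive_unique _ _ _ (HG z Hz)), (norm_scalC (V := E)).
  assert (B1 : Cmod (h' z) * norm e <= M * norm e)
    by (apply Rmult_le_compat_r; [exact He0|apply HM, Hz]).
  assert (B2 : 1 - Cmod z ^ 2 <= 2 * (1 - Cmod z)).
  { unfold unit_disc in Hz; assert (K := Cmod_ge_0 z); nra. }
  assert (B3 := weight_pos z Hz).
  assert (B5 : 1 - Cmod z < eps / (2 * (M * norm e + 1))) by lra.
  apply (Rmult_lt_compat_r (2 * (M * norm e + 1))) in B5; [|lra].
  replace (eps / (2 * (M * norm e + 1)) * (2 * (M * norm e + 1))) with (pos eps) in B5
    by (field; lra).
  apply Rle_lt_trans with (2 * (1 - Cmod z) * (M * norm e + 1)); [|lra].
  apply Rmult_le_compat; [lra|apply Rmult_le_pos; [apply Cmod_ge_0|exact He0]|exact B2|lra].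
- exists g; intros z Hz; rewrite (proj2 (Hg z Hz)); apply vderive_unique, HG, Hz.
Qed.

Lemma B0_monomials (e : E) : exists m0 m1 m2 : B0 E, forall z, unit_disc z ->
  vderive m0 z = e /\ vderive m1 z = z *: e /\ vderive m2 z = (z * z)%C *: e.
Proof.
assert (H2 : RtoC 2 <> 0%C) by (apply RtoC_neq_0; lra).
assert (H3 : RtoC 3 <> 0%C) by (apply RtoC_neq_0; lra).
assert (D1 := cder_id); assert (D2 : forall z, cder (fun w => w * w)%C z (1 * z + z * 1)%C).
{ intros z; apply cder_mult; apply cder_id. }
assert (D3 : forall z, cder (fun w => w * w * w)%C z ((1 * z + z * 1) * z + z * z * 1)%C).
{ intros z; apply (cder_mult (fun w => w * w)%C); [apply D2|apply cder_id]. }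
destruct (B0_of_scalar (fun w => w) (fun _ => RtoC 1) 1 e) as [m0 M0].
{ intros z _; apply cder_id. }
{ intros z _; rewrite Cmod_1; lra. }
destruct (B0_of_scalar (fun w => / RtoC 2 * (w * w))%C (fun w => w) 1 e) as [m1 M1].
{ intros z _; replace z with (/ RtoC 2 * (1 * z + z * 1))%C at 2 by (field; exact H2).
  apply cder_scal, D2. }
{ intros z Hz; apply Rlt_le, Hz. }
destruct (B0_of_scalar (fun w => / RtoC 3 * (w * w * w))%C (fun w => (w * w)%C) 1 e)
  as [m2 M2].
{ intros z _; replace (z * z)%C with (/ RtoC 3 * ((1 * z + z * 1) * z + z * z * 1))%C
    by (field; exact H3).
  apply cder_scal, D3. }
{ unfold unit_disc; intros z Hz; rewrite Cmod_mult; assert (K := Cmod_ge_0 z); nra. }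
exists m0, m1, m2; intros z Hz; split; [|split; auto].
rewrite (M0 z Hz); apply (scalC_1 (V := E)).
Qed.

Lemma linear_B0 (p : C) (e : E) : exists g : B0 E, forall z, unit_disc z ->
  vderive g z = (z - p)%C *: e.
Proof.
destruct (B0_monomials e) as [m0 [m1 [m2 H]]].
exists (B0_plus m1 (B0_scal (- p)%C m0)); intros z Hz; destruct (H z Hz) as [H0 [H1 _]].
rewrite vderive_plus, vderive_scal, H0, H1 by exact Hz.
symmetry; apply (scalC_plus_l (V := E)).
Qed.

End Analytic.

(** * Peaking functions and the action of an isometry on evaluations *)

Definition mob' (a z : C) : C :=
  ((1 - Cconj a * a) / ((1 - Cconj a * z) * (1 - Cconj a * z)))%C.

(** The weighted derivative of [mob a]. Its modulus [1 - |mob a z| ^ 2] has a strict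
    maximum at [a], with value [1]. *)
Definition peak (a z : C) : C := (RtoC (1 - Cmod z ^ 2) * mob' a z)%C.

Lemma Cmod_mob' (a z : C) : unit_disc a -> unit_disc z ->
  Cmod (mob' a z) = (1 - Cmod a ^ 2) / Cmod (1 - Cconj a * z) ^ 2.
Proof.
intros Ha Hz; assert (Hn := mob_den_neq a z Ha Hz).
unfold mob'; rewrite Cmod_div, Cmod_mult by (apply Cmult_neq_0; exact Hn).
replace (1 - Cconj a * a)%C with (RtoC (1 - Cmod a ^ 2))
  by (rewrite RtoC_minus, Cmod2_conj; ring).
rewrite Cmod_R, Rabs_pos_eq by (apply Rlt_le, weight_pos, Ha).
field; apply Rgt_not_eq, Cmod_gt_0, Hn.
Qed.

Lemma Cmod_peak (a z : C) : unit_disc a -> unit_disc z ->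
  Cmod (peak a z) = 1 - Cmod (mob a z) ^ 2.
Proof.
intros Ha Hz; unfold peak; rewrite Cmod_mult, Cmod_mob', mob_weight by assumption.
rewrite Cmod_R, Rabs_pos_eq by (apply Rlt_le, weight_pos, Hz).
field; apply Rgt_not_eq, Cmod_gt_0, mob_den_neq; assumption.
Qed.

Lemma peak_self (a : C) : unit_disc a -> peak a a = 1%C.
Proof.
intros Ha; assert (Hn := one_minus_norm_neq a Ha); unfold peak, mob'.
replace (RtoC (1 - Cmod a ^ 2)) with (1 - Cconj a * a)%C
  by (rewrite RtoC_minus, Cmod2_conj; ring).
field; exact Hn.
Qed.

Lemma peak_far (a z : C) : unit_disc a -> unit_disc z ->
  Cmod (peak a z) <= 1 - Cmod (z - a) ^ 2 / 4.
Proof.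
intros Ha Hz; rewrite Cmod_peak by assumption.
assert (Hn := mob_den_neq a z Ha Hz); assert (Hp := proj1 (Cmod_gt_0 _) Hn).
unfold mob; rewrite Cmod_div by exact Hn.
assert (H2 : Cmod (1 - Cconj a * z) <= 2).
{ eapply Rle_trans; [apply Cmod_triangle_minus|].
  rewrite Cmod_1, Cmod_mult, Cmod_conj; unfold unit_disc in *.
  assert (K1 := Cmod_ge_0 a); assert (K2 := Cmod_ge_0 z); nra. }
set (n := Cmod (z - a)) in *; set (m := Cmod (1 - Cconj a * z)) in *.
assert (Hn0 : 0 <= n) by apply Cmod_ge_0.
assert (K : n / 2 <= n / m).
{ apply Rmult_le_compat_l; [exact Hn0|]; apply Rinv_le_contravar; assumption. }
assert (K2 : (n / 2) ^ 2 <= (n / m) ^ 2) by (apply pow_incr; lra).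
replace ((n / 2) ^ 2) with (n ^ 2 / 4) in K2 by field; lra.
Qed.

Lemma peak_continuous (a : C) : unit_disc a -> ccont (peak a) a.
Proof.
intros Ha; unfold peak, mob'; apply ccont_mult; [apply ccont_weight|].
assert (Hn := one_minus_norm_neq a Ha).
assert (Hc : ccont (fun z => 1 - Cconj a * z)%C a).
{ apply (ccont_ext_loc (fun z => 1 + - Cconj a * z)%C).
  - exists 1; split; [lra|]; intros; ring.
  - apply ccont_plus; [apply ccont_const|].
    apply ccont_mult; [apply ccont_const|apply ccont_id]. }
unfold Cdiv; apply ccont_mult; [apply ccont_const|].
apply (ccont_comp (fun z => (1 - Cconj a * z) * (1 - Cconj a * z))%C Cinv).
- apply ccont_mult; exact Hc.
- apply ccont_inv, Cmult_neq_0; exact Hn.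
Qed.

Section Isometry.

Context {E : CompleteNormedModule C_AbsRing} (Esmooth : smooth E).

Local Notation EN := (CompleteNormedModule.NormedModule C_AbsRing E).
Local Notation vadd := (@plus (NormedModule.AbelianMonoid C_AbsRing EN)).
Local Notation vsub := (@minus (NormedModule.AbelianGroup C_AbsRing EN)).
Local Notation vzero := (@zero (NormedModule.AbelianMonoid C_AbsRing EN)).
Local Notation "c *: x" := (@scal _ (NormedModule.ModuleSpace C_AbsRing EN) (c : C) x)
  (at level 40).

Lemma B0_peak (a : C) (u : E) : unit_disc a ->
  exists f : B0 E, forall z, unit_disc z -> wderive f z = peak a z *: u.
Proof.
intros Ha.
destruct (B0_of_scalar Esmooth (mob a) (mob' a) ((1 - Cmod a ^ 2) / (1 - Cmod a) ^ 2) u)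
  as [f Hf].
- intros z Hz; apply cder_mob; assumption.
- intros z Hz; rewrite Cmod_mob' by assumption.
  assert (H := mob_den_pos a z Ha Hz); assert (Hw := weight_pos a Ha).
  apply Rmult_le_compat_l; [lra|]; unfold unit_disc in Ha.
  apply Rinv_le_contravar; [apply pow_lt; lra|apply pow_incr; lra].
- exists f; intros z Hz; unfold wderive, peak; rewrite (Hf z Hz).
  apply (scalC_assoc (V := E)).
Qed.

(** Gateaux differentiability of the norm of the Bloch space at a peaking function.
    Away from [a] the peak leaves room for [t * g]; near [a] write
    [peak * u + t w = peak * (u + t v) + t (1 - peak) v + t (w - v)], where
    [v] is the value at [a] of [wderive g] and [w] its value at a near point. *)
Lemma peak_gateaux (a : C) (u : E) (phi : E -> C) (f g : B0 E) (eps : R) :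
  unit_disc a -> norm u = 1 -> norming (V := E) u phi ->
  (forall z, unit_disc z -> wderive f z = peak a z *: u) -> 0 < eps ->
  exists t, 0 < t /\ forall z, unit_disc z ->
    norm (vadd (wderive f z) (RtoC t *: wderive g z))
      <= 1 + t * (fst (phi (wderive g a)) + eps).
Proof.
intros Ha Hu Hphi Hf He.
set (v := wderive g a); set (k := fst (phi v)).
destruct (B0_attained Esmooth g) as [zM [HzM HM]].
set (M := weighted_derive g zM) in *.
assert (HM0 : 0 <= M) by (apply weighted_derive_pos, HzM).
destruct (smooth_gateaux (V := E) Esmooth u v phi (eps / 4) Hu Hphi ltac:(lra))
  as [d1 [Hd1 H1]]; fold k in H1.
destruct (wderive_continuous Esmooth g a (B0_analytic _ g) Ha (eps / 4) ltac:(lra))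
  as [d2 [Hd2 H2]]; fold v in H2.
assert (Hv : 0 <= norm v) by apply norm_ge_0.
assert (Hq : 0 < eps / (4 * (norm v + 1))) by (apply Rdiv_lt_0_compat; lra).
destruct (peak_continuous a Ha _ Hq) as [d3 [Hd3 H3]].
rewrite (peak_self a Ha) in H3.
set (eta := Rmin d2 d3).
assert (Heta : 0 < eta) by (apply Rmin_pos; assumption).
assert (Hk := Rabs_pos k); assert (Hk1 := Rle_abs k).
assert (Hk2 : - Rabs k <= k) by (assert (K := Rle_abs (- k)); rewrite Rabs_Ropp in K; lra).
set (D := M + Rabs k + 1).
set (t := Rmin (d1 / 2) (Rmin 1 (eta ^ 2 / 4) / D)).
assert (HD : 0 < D) by (unfold D; lra).
assert (Hm1 : 0 < Rmin 1 (eta ^ 2 / 4)).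
{ apply Rmin_pos; [lra|]; apply Rdiv_lt_0_compat; [apply pow_lt, Heta|lra]. }
assert (Ht : 0 < t).
{ apply Rmin_pos; [lra|]; apply Rdiv_lt_0_compat; assumption. }
assert (Htd1 : t < d1) by (assert (K := Rmin_l (d1 / 2) (Rmin 1 (eta ^ 2 / 4) / D)); fold t in K; lra).
assert (HtD : t * D <= Rmin 1 (eta ^ 2 / 4)).
{ assert (K := Rmin_r (d1 / 2) (Rmin 1 (eta ^ 2 / 4) / D)); fold t in K.
  apply (Rmult_le_compat_r D) in K; [|lra].
  replace (Rmin 1 (eta ^ 2 / 4) / D * D) with (Rmin 1 (eta ^ 2 / 4)) in K by (field; lra).
  exact K. }
assert (HtD1 : t * D <= 1) by (eapply Rle_trans; [exact HtD|apply Rmin_l]).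
assert (HtD2 : t * D <= eta ^ 2 / 4) by (eapply Rle_trans; [exact HtD|apply Rmin_r]).
exists t; split; [exact Ht|]; intros z Hz; rewrite (Hf z Hz).
assert (Hp1 : Cmod (peak a z) <= 1).
{ assert (K := peak_far a z Ha Hz); assert (K2 := pow2_ge_0 (Cmod (z - a))); lra. }
set (al := peak a z) in *; set (w := wderive g z).
assert (HMw : norm w <= M).
{ unfold w; rewrite norm_wderive by exact Hz; apply HM, Hz. }
destruct (Rlt_le_dec (Cmod (z - a)) eta) as [Hnear|Hfar].
- destruct (H2 z (Rlt_le_trans _ _ _ Hnear (Rmin_l _ _))) as [_ Hwv]; fold w in Hwv.
  assert (Hal := H3 z (Rlt_le_trans _ _ _ Hnear (Rmin_r _ _))); fold al in Hal.
  specialize (H1 t (conj Ht Htd1)).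
  apply Rle_trans with (Cmod al * norm (vadd u (RtoC t *: v))
    + (t * (Cmod (al - 1) * norm v) + t * norm (vsub w v))).
  + apply (norm_le_norming (V := E) Esmooth); intros chi Hchi.
    assert (HF := norming_functional _ _ Hchi).
    destruct Hchi as [C1 [C2 [C3 _]]].
    rewrite C1, !C2.
    replace (al * chi u + RtoC t * chi w)%C
      with (al * (chi u + RtoC t * chi v) +
        (RtoC t * - ((al - 1) * chi v) + RtoC t * (chi w - chi v)))%C by ring.
    rewrite <- C2, <- C1, <- (functional_minus (V := E) chi w v HF).
    eapply Rle_trans; [apply Cmod_triangle|].
    apply Rplus_le_compat.
    * rewrite Cmod_mult; apply Rmult_le_compat_l; [apply Cmod_ge_0|apply C3].
    * eapply Rle_trans; [apply Cmod_triangle|].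
      rewrite !Cmod_mult, Cmod_opp, !Cmod_mult, Cmod_R, Rabs_pos_eq by lra.
      apply Rplus_le_compat; (apply Rmult_le_compat_l; [lra|]); [|apply C3].
      apply Rmult_le_compat_l; [apply Cmod_ge_0|apply C3].
  + assert (B0 : 0 <= 1 + t * (k + eps / 4)).
    { assert (K : - (t * D) <= t * k).
      { replace (- (t * D)) with (t * - D) by ring; apply Rmult_le_compat_l; [lra|].
        unfold D; lra. }
      assert (K2 : 0 <= t * (eps / 4)) by (apply Rmult_le_pos; lra); lra. }
    assert (B1 : Cmod al * norm (vadd u (RtoC t *: v)) <= 1 * (1 + t * (k + eps / 4))).
    { apply Rmult_le_compat; [apply Cmod_ge_0|apply norm_ge_0|exact Hp1|exact H1]. }
    assert (B2 : Cmod (al - 1) * norm v <= eps / 4).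
    { apply Rle_trans with (eps / (4 * (norm v + 1)) * (norm v + 1)).
      - apply Rmult_le_compat; [apply Cmod_ge_0|exact Hv|lra|lra].
      - right; field; lra. }
    assert (B3 : t * (Cmod (al - 1) * norm v) <= t * (eps / 4))
      by (apply Rmult_le_compat_l; lra).
    assert (B4 : t * norm (vsub w v) <= t * (eps / 4))
      by (apply Rmult_le_compat_l; lra).
    assert (B5 : 0 <= t * (eps / 4)) by (apply Rmult_le_pos; lra).
    lra.
- eapply Rle_trans; [apply (norm_triangle (V := E))|].
  rewrite !(norm_scalC (V := E)), Hu, Cmod_R, Rabs_pos_eq by lra.
  assert (K := peak_far a z Ha Hz); fold al in K.
  assert (K2 : eta ^ 2 <= Cmod (z - a) ^ 2) by (apply pow_incr; lra).
  assert (K3 : t * norm w <= t * M) by (apply Rmult_le_compat_l; lra).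
  assert (K4 : t * M <= t * D + t * k).
  { rewrite <- Rmult_plus_distr_l; apply Rmult_le_compat_l; [lra|]; unfold D; lra. }
  assert (K5 : 0 <= t * eps) by (apply Rmult_le_pos; lra).
  lra.
Qed.

Definition linear_isometry (T : B0 E -> B0 E) : Prop :=
  (forall f g, T (B0_plus f g) = B0_plus (T f) (T g)) /\
  (forall c f, T (B0_scal c f) = B0_scal c (T f)) /\
  (forall f, B0_norm (T f) = B0_norm f).

(** Let [f] peak at [a] in the direction [u], let [wderive (T f)] attain its norm at [y]
    and let [psi] norm its value there. For every [g], the real part of
    [psi (wderive (T g) y)] is at most the derivative of the norm of [T (f + t g)], which
    is that of [f + t g], at [t = 0]: by differentiability this bound is the real part of
    [phi (wderive g a)]. Linearity in [g] turns the inequality into an equality. *)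
Lemma transport (T : B0 E -> B0 E) (a : C) (u : E) (phi : E -> C) :
  linear_isometry T -> unit_disc a -> norm u = 1 -> norming (V := E) u phi ->
  exists y b psi, unit_disc y /\ norm b = 1 /\ norming (V := E) b psi /\
    forall g : B0 E, psi (wderive (T g) y) = phi (wderive g a).
Proof.
intros [T1 [T2 T3]] Ha Hu Hphi.
destruct (B0_peak a u Ha) as [f Hf].
assert (Hfz : forall z, unit_disc z -> weighted_derive f z = Cmod (peak a z)).
{ intros z Hz; rewrite <- norm_wderive, (Hf z Hz), (norm_scalC (V := E)), Hu by exact Hz; ring. }
assert (Hfa : weighted_derive f a = 1) by (rewrite Hfz, peak_self, Cmod_1 by exact Ha; reflexivity).
assert (Hf1 : B0_norm f = Finite 1).
{ rewrite (B0_norm_eq f a Ha), Hfa; [reflexivity|]; intros z Hz.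
  rewrite Hfa, (Hfz z Hz); assert (K := peak_far a z Ha Hz).
  assert (K2 := pow2_ge_0 (Cmod (z - a))); lra. }
destruct (B0_attained Esmooth (T f)) as [y [Hy Hmax]].
assert (HTf := B0_norm_eq (T f) y Hy Hmax); rewrite T3, Hf1 in HTf.
set (b := wderive (T f) y).
assert (Hb : norm b = 1).
{ unfold b; rewrite norm_wderive by exact Hy; injection HTf; auto. }
destruct (norming_exists (V := E) Esmooth b) as [psi Hpsi].
assert (HpsiF := norming_functional _ _ Hpsi).
exists y, b, psi; split; [exact Hy|split; [exact Hb|split; [exact Hpsi|]]].
assert (Hle : forall g : B0 E, fst (psi (wderive (T g) y)) <= fst (phi (wderive g a))).
{ intros g; apply le_epsilon; intros eps He.
  destruct (peak_gateaux a u phi f g eps Ha Hu Hphi Hf He) as [t [Ht Hg]].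
  set (k := fst (phi (wderive g a)) + eps) in *.
  assert (HN : Rbar_le (B0_norm (B0_plus f (B0_scal (RtoC t) g))) (Finite (1 + t * k))).
  { apply B0_norm_le; intros z Hz; rewrite <- norm_wderive by exact Hz.
    rewrite wderive_plus, wderive_scal by exact Hz; apply Hg, Hz. }
  rewrite <- T3, T1, T2 in HN.
  assert (HN2 := proj1 (B0_norm_le _ _) HN y Hy).
  rewrite <- norm_wderive, wderive_plus, wderive_scal in HN2 by exact Hy.
  assert (K := proj1 (proj2 (proj2 Hpsi)) (vadd b (RtoC t *: wderive (T g) y))).
  assert (K2 := re_le_Cmod (psi (vadd b (RtoC t *: wderive (T g) y)))).
  apply Rabs_le_between in K2; unfold Re in K2.
  assert (K3 : fst (psi (vadd b (RtoC t *: wderive (T g) y))) <= 1 + t * k).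
  { eapply Rle_trans; [apply K2|]; eapply Rle_trans; [exact K|exact HN2]. }
  rewrite (proj1 Hpsi), (proj1 (proj2 Hpsi)), (proj2 (proj2 (proj2 Hpsi))), Hb in K3.
  simpl in K3; apply Rmult_le_reg_l with t; [exact Ht|]; lra. }
intros g.
assert (Hs : forall c h, psi (wderive (T (B0_scal c h)) y) = (c * psi (wderive (T h) y))%C).
{ intros c h; rewrite T2, wderive_scal by exact Hy; apply Hpsi. }
assert (Hs' : forall c (h : B0 E), phi (wderive (B0_scal c h) a) = (c * phi (wderive h a))%C).
{ intros c h; rewrite wderive_scal by exact Ha; apply Hphi. }
assert (Em : forall w : C, (RtoC (-1) * w)%C = (- w)%C) by (intros w; rewrite RtoC_minus_1; ring).
apply eq_of_fst_le.
- apply Hle.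
- rewrite <- !Em, <- Hs, <- Hs'; apply Hle.
- rewrite <- Hs, <- Hs'; apply Hle.
- rewrite <- !Em, <- !Hs, <- !Hs'; apply Hle.
Qed.

Lemma B0_quadratic (p s : C) (m0 m1 m2 : B0 E) (e : E) :
  (forall z, unit_disc z ->
    vderive m0 z = e /\ vderive m1 z = z *: e /\ vderive m2 z = (z * z)%C *: e) ->
  forall z, unit_disc z ->
    vderive (B0_plus (B0_scal (p * s)%C m0) (B0_plus (B0_scal (- (p + s))%C m1) m2)) z
    = ((z - p) * (z - s))%C *: e.
Proof.
intros H z Hz; destruct (H z Hz) as [H0 [H1 H2]].
rewrite !vderive_plus, !vderive_scal, H0, H1, H2 by exact Hz.
apply (eq_of_norming Esmooth); intros chi x Hchi.
assert (C1 := proj1 Hchi); assert (C2 := proj1 (proj2 Hchi)).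
rewrite C2.
transitivity (p * s * chi e + (- (p + s) * (z * chi e) + z * z * chi e))%C; [|ring].
rewrite <- !C2, <- !C1; reflexivity.
Qed.

(** The image of the point [a] does not depend on the direction. On the
    finite-dimensional space of the values at [a] of the preimages of quadratic test
    functions, [phi1 + phi2] is a multiple of a norming functional, which is also
    transported to the evaluation at one point [y3]; but a combination of evaluations
    at two points is not an evaluation at one point. *)
Lemma transport_same_point (T Ti : B0 E -> B0 E) (a y1 y2 : C) (b1 b2 : E)
    (phi1 phi2 psi1 psi2 : E -> C) :
  linear_isometry T -> linear_isometry Ti -> (forall g, T (Ti g) = g) ->
  unit_disc a -> unit_disc y1 -> unit_disc y2 ->
  functional (V := E) phi1 -> functional (V := E) phi2 ->
  norm b1 = 1 -> norm b2 = 1 -> norming (V := E) b1 psi1 -> norming (V := E) b2 psi2 ->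
  (forall g : B0 E, psi1 (wderive (T g) y1) = phi1 (wderive g a)) ->
  (forall g : B0 E, psi2 (wderive (T g) y2) = phi2 (wderive g a)) ->
  y1 = y2.
Proof.
intros HT HTi HTTi Ha Hy1 Hy2 HF1 HF2 Hb1 Hb2 Hpsi1 Hpsi2 Hc1 Hc2.
apply NNPP; intros Hne.
destruct (B0_monomials Esmooth b1) as [m0 [m1 [m2 Hm]]].
destruct (B0_monomials Esmooth b2) as [n0 [n1 [n2 Hn]]].
set (val := fun m => wderive (Ti m) a).
set (l := val m0 :: val m1 :: val m2 :: val n0 :: val n1 :: val n2 :: nil).
destruct HTi as [Ti1 [Ti2 _]].
assert (Hvp : forall f g, val (B0_plus f g) = vadd (val f) (val g)).
{ intros f g; unfold val; rewrite Ti1; apply wderive_plus, Ha. }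
assert (Hvs : forall c f, val (B0_scal c f) = c *: val f).
{ intros c f; unfold val; rewrite Ti2; apply wderive_scal, Ha. }
set (lam := fun x => (phi1 x + phi2 x)%C).
assert (Hlam : functional (V := E) lam).
{ destruct HF1 as [A1 [A2 [M1 [A3 A4]]]], HF2 as [B1 [B2 [M2 [B3 B4]]]].
  split; [|split].
  - intros x y; unfold lam; rewrite A1, B1; ring.
  - intros c x; unfold lam; rewrite A2, B2; ring.
  - exists (M1 + M2); split; [lra|]; intros x; unfold lam.
    eapply Rle_trans; [apply Cmod_triangle|].
    specialize (A4 x); specialize (B4 x); lra. }
assert (Hval : forall g, lam (val g) = (psi1 (wderive g y1) + psi2 (wderive g y2))%C).
{ intros g; unfold lam, val; rewrite <- Hc1, <- Hc2, HTTi; reflexivity. }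
assert (Hpt : exists c y3 psi3, unit_disc y3 /\ functional (V := E) psi3 /\
  forall g, span (V := E) l (val g) ->
    (psi1 (wderive g y1) + psi2 (wderive g y2) = c * psi3 (wderive g y3))%C).
{ destruct (functional_on_span (V := E) Esmooth l lam Hlam) as [Hz|[x [phi [c [Hx [Hphi Hc]]]]]].
  - exists 0%C, y2, psi2; split; [exact Hy2|split; [exact (norming_functional _ _ Hpsi2)|]].
    intros g Hg; rewrite <- Hval, (Hz _ Hg); ring.
  - destruct (transport T a x phi HT Ha Hx Hphi) as [y3 [b3 [psi3 [Hy3 [_ [Hpsi3 Hc3]]]]]].
    exists c, y3, psi3; split; [exact Hy3|split; [exact (norming_functional _ _ Hpsi3)|]].
    intros g Hg; rewrite <- Hval, (Hc _ Hg); unfold val.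
    rewrite <- (Hc3 (Ti g)), HTTi; reflexivity. }
destruct Hpt as [c [y3 [psi3 [Hy3 [HF3 Hpt]]]]].
assert (Hspan : forall q0 q1 q2 p s, In (val q0) l -> In (val q1) l -> In (val q2) l ->
  span (V := E) l (val (B0_plus (B0_scal (p * s)%C q0) (B0_plus (B0_scal (- (p + s))%C q1) q2)))).
{ intros q0 q1 q2 p s I0 I1 I2; rewrite !Hvp, !Hvs.
  apply span_plus; [apply span_scal, span_in, I0|].
  apply span_plus; [apply span_scal, span_in, I1|apply span_in, I2]. }
assert (Hev : forall chi q0 q1 q2 e p s y, functional (V := E) chi -> unit_disc y ->
  (forall z, unit_disc z ->
    vderive (B0_fun _ q0) z = e /\ vderive (B0_fun _ q1) z = z *: e
    /\ vderive (B0_fun _ q2) z = (z * z)%C *: e) ->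
  chi (wderive (B0_plus (B0_scal (p * s)%C q0) (B0_plus (B0_scal (- (p + s))%C q1) q2)) y)
  = (RtoC (1 - Cmod y ^ 2) * ((y - p) * (y - s)) * chi e)%C).
{ intros chi q0 q1 q2 e p s y HF Hy Hq; unfold wderive.
  rewrite (B0_quadratic p s q0 q1 q2 e Hq y Hy), !(proj1 (proj2 HF)); ring. }
assert (Hwn : forall y, unit_disc y -> RtoC (1 - Cmod y ^ 2) <> 0%C).
{ intros y Hy; apply RtoC_neq_0; assert (W := weight_pos y Hy); lra. }
assert (Hsub : forall x y : C, x <> y -> (x - y)%C <> 0%C).
{ intros x y Hxy K; apply Hxy, Cminus_eq_0, K. }
assert (F1 := norming_functional _ _ Hpsi1); assert (F2 := norming_functional _ _ Hpsi2).
assert (P1 : psi1 b1 = 1%C) by (rewrite (proj2 (proj2 (proj2 Hpsi1))), Hb1; reflexivity).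
assert (P2 : psi2 b2 = 1%C) by (rewrite (proj2 (proj2 (proj2 Hpsi2))), Hb2; reflexivity).
destruct (classic (y3 = y1)) as [E31|H31].
- assert (K := Hpt _ (Hspan n0 n1 n2 y1 y1 ltac:(simpl; tauto) ltac:(simpl; tauto)
    ltac:(simpl; tauto))).
  rewrite (Hev psi1 _ _ _ b2), (Hev psi2 _ _ _ b2), (Hev psi3 _ _ _ b2) in K by assumption.
  rewrite E31, P2 in K.
  assert (K2 : (RtoC (1 - Cmod y2 ^ 2) * ((y2 - y1) * (y2 - y1)))%C = 0%C).
  { transitivity (RtoC (1 - Cmod y1 ^ 2) * ((y1 - y1) * (y1 - y1)) * psi1 b2 +
      RtoC (1 - Cmod y2 ^ 2) * ((y2 - y1) * (y2 - y1)) * 1)%C; [ring|rewrite K; ring]. }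
  revert K2; apply Cmult_neq_0; [apply Hwn, Hy2|].
  apply Cmult_neq_0; apply Hsub; auto.
- assert (K := Hpt _ (Hspan m0 m1 m2 y2 y3 ltac:(simpl; tauto) ltac:(simpl; tauto)
    ltac:(simpl; tauto))).
  rewrite (Hev psi1 _ _ _ b1), (Hev psi2 _ _ _ b1), (Hev psi3 _ _ _ b1) in K by assumption.
  rewrite P1 in K.
  assert (K2 : (RtoC (1 - Cmod y1 ^ 2) * ((y1 - y2) * (y1 - y3)))%C = 0%C).
  { transitivity (RtoC (1 - Cmod y1 ^ 2) * ((y1 - y2) * (y1 - y3)) * 1 +
      RtoC (1 - Cmod y2 ^ 2) * ((y2 - y2) * (y2 - y3)) * psi2 b1)%C; [ring|rewrite K; ring]. }
  revert K2; apply Cmult_neq_0; [apply Hwn, Hy1|].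
  apply Cmult_neq_0; apply Hsub; auto.
Qed.

(** All directions at [a] being transported to the same point [y], the norm of
    [wderive g a] can be computed by the functional transported from its own direction. *)
Lemma transport_norm_le (T Ti : B0 E -> B0 E) (a : C) (u : E) :
  linear_isometry T -> linear_isometry Ti -> (forall g, T (Ti g) = g) -> norm u = 1 ->
  unit_disc a ->
  exists y, unit_disc y /\
    forall g : B0 E, norm (wderive g a) <= norm (wderive (T g) y).
Proof.
intros HT HTi HTTi Hu Ha.
destruct (norming_exists (V := E) Esmooth u) as [phi Hphi].
destruct (transport T a u phi HT Ha Hu Hphi) as [y [b [psi [Hy [Hb [Hpsi Hc]]]]]].
exists y; split; [exact Hy|]; intros g.
destruct (classic (wderive g a = vzero)) as [Hz|Hz].
{ rewrite Hz, (norm_zero (V := E)); apply norm_ge_0. }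
set (w := wderive g a) in *.
destruct (norming_exists (V := E) Esmooth w) as [phi' Hphi'].
set (u' := RtoC (/ norm w) *: w).
assert (Hu' : norm u' = 1) by (apply (norm_normalize (V := E)), Hz).
assert (Hphi'' : norming (V := E) u' phi').
{ destruct Hphi' as [A1 [A2 [A3 A4]]].
  split; [exact A1|split; [exact A2|split; [exact A3|]]].
  assert (Hp := norm_pos (V := E) w Hz).
  unfold u'; rewrite A2, A4; fold u'; rewrite Hu', <- RtoC_mult; f_equal; field; lra. }
destruct (transport T a u' phi' HT Ha Hu' Hphi'') as [y' [b' [psi' [Hy' [Hb' [Hpsi' Hc']]]]]].
assert (Ey : y = y').
{ apply (transport_same_point T Ti a y y' b b' phi phi' psi psi'); auto;
    eapply norming_functional; eassumption. }
subst y'.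
assert (K := proj1 (proj2 (proj2 Hpsi')) (wderive (T g) y)).
rewrite Hc' in K; fold w in K; rewrite (proj2 (proj2 (proj2 Hphi'))), Cmod_R in K.
rewrite Rabs_pos_eq in K by apply norm_ge_0; exact K.
Qed.

(** A test function whose derivative vanishes at [b] only tells the points apart. *)
Lemma norm_wderive_separates (a b : C) (u : E) : unit_disc a -> unit_disc b -> norm u = 1 ->
  (forall g : B0 E, norm (wderive g a) <= norm (wderive g b)) -> a = b.
Proof.
intros Ha Hb Hu H; destruct (linear_B0 Esmooth b u) as [g Hg].
specialize (H g); rewrite !norm_wderive in H by assumption.
unfold weighted_derive in H; rewrite !Hg, !(norm_scalC (V := E)), Hu in H by assumption.
replace (b - b)%C with (RtoC 0) in H by ring; rewrite Cmod_0 in H.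
assert (Wa := weight_pos a Ha); assert (K := Cmod_ge_0 (a - b)).
assert (K0 : Cmod (a - b) = 0) by nra.
apply Cminus_eq_0, Cmod_eq_0, K0.
Qed.

(** The two inequalities for [T] and its inverse compose to an inequality between
    evaluations, which forces the points to correspond. *)
Lemma transport_norm (T Ti : B0 E -> B0 E) (a : C) (u : E) :
  linear_isometry T -> linear_isometry Ti ->
  (forall g, T (Ti g) = g) -> (forall g, Ti (T g) = g) -> norm u = 1 -> unit_disc a ->
  exists y, unit_disc y /\
    forall g : B0 E, norm (wderive (T g) y) = norm (wderive g a).
Proof.
intros HT HTi HTTi HTiT Hu Ha.
destruct (transport_norm_le T Ti a u HT HTi HTTi Hu Ha) as [y [Hy H1]].
destruct (transport_norm_le Ti T y u HTi HT HTiT Hu Hy) as [a' [Ha' H2]].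
assert (Ea : a = a').
{ apply (norm_wderive_separates a a' u Ha Ha' Hu); intros g.
  eapply Rle_trans; [apply H1|]; specialize (H2 (T g)); rewrite HTiT in H2; exact H2. }
subst a'; exists y; split; [exact Hy|]; intros g; apply Rle_antisym; [|apply H1].
specialize (H2 (T g)); rewrite HTiT in H2; exact H2.
Qed.

End Isometry.

(** * Composition with automorphisms *)

Section Composition.

Context {E : CompleteNormedModule C_AbsRing} (Esmooth : smooth E).

Local Notation EN := (CompleteNormedModule.NormedModule C_AbsRing E).
Local Notation vadd := (@plus (NormedModule.AbelianMonoid C_AbsRing EN)).
Local Notation vsub := (@minus (NormedModule.AbelianGroup C_AbsRing EN)).
Local Notation vzero := (@zero (NormedModule.AbelianMonoid C_AbsRing EN)).
Local Notation "c *: x" := (@scal _ (NormedModule.ModuleSpace C_AbsRing EN) (c : C) x)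
  (at level 40).

Lemma is_derive_C_comp (f : C -> E) (s : C -> C) (z m : C) (l : E) :
  is_derive (K := C_AbsRing) f (s z) l -> cder s z m ->
  is_derive (K := C_AbsRing) (fun w => f (s w)) z (m *: l).
Proof.
intros Hf Hs; apply is_derive_C_iff; intros eps He.
assert (Hm := Cmod_ge_0 m); assert (Hl : 0 <= norm l) by apply norm_ge_0.
assert (Hq1 : 0 < eps / (2 * (Cmod m + 1))) by (apply Rdiv_lt_0_compat; lra).
assert (Hq2 : 0 < eps / (2 * (norm l + 1))) by (apply Rdiv_lt_0_compat; lra).
destruct (proj1 (is_derive_C_iff _ _ _) Hf _ Hq1) as [d1 [Hd1 H1]].
destruct (cder_ccont _ _ _ Hs d1 Hd1) as [d2 [Hd2 H2]].
destruct (Hs 1 Rlt_0_1) as [d3 [Hd3 H3]].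
destruct (Hs _ Hq2) as [d4 [Hd4 H4]].
exists (Rmin (Rmin d2 d3) d4); split; [repeat apply Rmin_pos; assumption|]; intros w Hw.
assert (K1 := Rmin_l (Rmin d2 d3) d4); assert (K2 := Rmin_r (Rmin d2 d3) d4).
assert (K3 := Rmin_l d2 d3); assert (K4 := Rmin_r d2 d3).
specialize (H2 w ltac:(lra)); specialize (H3 w ltac:(lra)); specialize (H4 w ltac:(lra)).
specialize (H1 (s w) H2).
set (X := Cmod (w - z)) in *; assert (HX : 0 <= X) by apply Cmod_ge_0.
assert (Hsw : Cmod (s w - s z) <= (Cmod m + 1) * X).
{ assert (T := Cmod_minus_ge (s w - s z) (m * (w - z))).
  rewrite Cmod_mult in T; fold X in T; lra. }
apply Rle_trans with (eps / (2 * (Cmod m + 1)) * Cmod (s w - s z)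
  + Cmod (s w - s z - m * (w - z)) * norm l).
- apply (norm_le_norming (V := E) Esmooth); intros chi Hchi.
  assert (HF := norming_functional _ _ Hchi).
  rewrite !(functional_minus (V := E) chi), !(proj1 (proj2 HF)) by exact HF.
  replace (chi (f (s w)) - chi (f (s z)) - (w - z) * (m * chi l))%C
    with ((chi (f (s w)) - chi (f (s z)) - (s w - s z) * chi l)
      + (s w - s z - m * (w - z)) * chi l)%C by ring.
  rewrite <- (proj1 (proj2 HF)), <- !(functional_minus (V := E) chi) by exact HF.
  eapply Rle_trans; [apply Cmod_triangle|]; apply Rplus_le_compat.
  + eapply Rle_trans; [apply Hchi|exact H1].
  + rewrite Cmod_mult; apply Rmult_le_compat_l; [apply Cmod_ge_0|apply Hchi].
- replace (eps * X) with (eps / (2 * (Cmod m + 1)) * ((Cmod m + 1) * X)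
    + eps / (2 * (norm l + 1)) * X * (norm l + 1)) by (field; split; lra).
  apply Rplus_le_compat.
  + apply Rmult_le_compat_l; [lra|exact Hsw].
  + apply Rmult_le_compat; [apply Cmod_ge_0|exact Hl|exact H4|lra].
Qed.

(** Through functionals this reduces to the scalar case. *)
Lemma eq_of_derive (f g : C -> E) :
  (forall z, unit_disc z -> exists l,
    is_derive (K := C_AbsRing) f z l /\ is_derive (K := C_AbsRing) g z l) ->
  f 0%C = g 0%C -> forall z, unit_disc z -> f z = g z.
Proof.
intros H H0 z Hz; apply (eq_of_norming Esmooth); intros chi x Hchi.
assert (HF := norming_functional _ _ Hchi).
assert (E1 := cder_zero_const (fun w => chi (f w) + RtoC (-1) * chi (g w))%C 1).
cbv beta in E1; specialize (fun K => E1 K z Hz).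
rewrite H0 in E1.
replace (chi (f z)) with ((chi (f z) + RtoC (-1) * chi (g z)) + chi (g z))%C
  by (rewrite RtoC_minus_1; ring).
rewrite E1; [rewrite RtoC_minus_1; ring|].
intros w Hw; destruct (H w Hw) as [l [Hl1 Hl2]].
replace (RtoC 0) with (chi l + RtoC (-1) * chi l)%C by (rewrite RtoC_minus_1; ring).
apply cder_plus; [|apply cder_scal]; apply cder_functional; assumption.
Qed.

Definition vector_isometry (S : E -> E) : Prop :=
  (forall x y, S (vadd x y) = vadd (S x) (S y)) /\
  (forall c x, S (c *: x) = c *: S x) /\
  (forall x, norm (S x) = norm x).

Lemma vector_isometry_minus (S : E -> E) (x y : E) : vector_isometry S ->
  S (vsub x y) = vsub (S x) (S y).
Proof.
intros [S1 [S2 _]]; rewrite !(minusC (V := E)), S1, S2; reflexivity.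
Qed.

Lemma is_derive_isometry (S : E -> E) (f : C -> E) (z : C) (l : E) : vector_isometry S ->
  is_derive (K := C_AbsRing) f z l -> is_derive (K := C_AbsRing) (fun w => S (f w)) z (S l).
Proof.
intros HS Hf; apply is_derive_C_iff; intros eps He.
destruct (proj1 (is_derive_C_iff _ _ _) Hf eps He) as [d [Hd H]].
exists d; split; [exact Hd|]; intros w Hw; specialize (H w Hw).
rewrite <- (proj1 (proj2 HS)), <- !vector_isometry_minus, (proj2 (proj2 HS)) by exact HS.
exact H.
Qed.

Definition transplant (S : E -> E) (s : C -> C) (f : C -> E) (z : C) : E :=
  S (vsub (f (s z)) (f (s 0%C))).

Lemma is_derive_transplant (S : E -> E) (s : C -> C) (f : C -> E) (z m : C) :
  vector_isometry S -> analytic_on_disc f -> unit_disc (s z) -> cder s z m ->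
  is_derive (K := C_AbsRing) (transplant S s f) z (m *: S (vderive f (s z))).
Proof.
intros HS Hf Hsz Hs; unfold transplant.
rewrite <- (proj1 (proj2 HS)).
apply (is_derive_isometry S (fun w => vsub (f (s w)) (f (s 0%C)))); [exact HS|].
assert (H1 := is_derive_C_comp f s z m _ (vderive_correct _ _ (Hf _ Hsz)) Hs).
apply is_derive_C_iff; intros eps He.
destruct (proj1 (is_derive_C_iff _ _ _) H1 eps He) as [d [Hd H]].
exists d; split; [exact Hd|]; intros w Hw; specialize (H w Hw).
assert (E1 : vsub (vsub (f (s w)) (f (s 0%C))) (vsub (f (s z)) (f (s 0%C)))
  = vsub (f (s w)) (f (s z))).
{ apply (eq_of_norming Esmooth); intros chi x Hchi.
  assert (HF := norming_functional _ _ Hchi).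
  rewrite !(functional_minus (V := E) chi) by exact HF; ring. }
rewrite E1; exact H.
Qed.

(** The weight is invariant by the equality case of the Schwarz-Pick lemma. *)
Lemma weighted_derive_transplant (S : E -> E) (s : C -> C) (f : C -> E) (z : C) :
  vector_isometry S -> disc_automorphism s -> analytic_on_disc f -> unit_disc z ->
  weighted_derive (transplant S s f) z = weighted_derive f (s z).
Proof.
intros HS Hs Hf Hz; assert (Hs' := Hs); destruct Hs' as [Ha [Hd _]].
apply holo_analytic in Ha; destruct (Ha z Hz) as [m Hm].
assert (D := is_derive_transplant S s f z m HS Hf (Hd z Hz) Hm).
unfold weighted_derive; rewrite (vderive_unique _ _ _ D), (norm_scalC (V := E)).
rewrite (proj2 (proj2 HS)), <- (schwarz_pick_equality s z m Hs Hz Hm); ring.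
Qed.

Lemma transplant_0 (S : E -> E) (s : C -> C) (f : C -> E) : vector_isometry S ->
  transplant S s f 0%C = vzero.
Proof.
intros HS; unfold transplant; rewrite vector_isometry_minus by exact HS.
exact (minus_eq_zero (G := NormedModule.AbelianGroup _ EN) _).
Qed.

Lemma B0_transplant (S : E -> E) (s : C -> C) (f : B0 E) :
  vector_isometry S -> disc_automorphism s ->
  exists g : B0 E, forall z, unit_disc z -> g z = transplant S s f z.
Proof.
intros HS Hs; assert (Hs' := Hs); destruct Hs' as [Ha [Hdd [Hi Hsu]]].
apply holo_analytic in Ha.
destruct (B0_cutoff (transplant S s f)) as [g Hg].
- intros z Hz; destruct (Ha z Hz) as [m Hm]; eexists.
  apply is_derive_transplant; [exact HS|apply B0_analytic|apply Hdd, Hz|exact Hm].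
- apply transplant_0, HS.
- intros eps; destruct (B0_little _ f eps) as [d Hd]; assert (Hd0 := cond_pos d).
  destruct (automorphism_proper s Ha Hi Hsu (1 - d) ltac:(lra)) as [rho [Hrho HR]].
  assert (Hq : 0 < 1 - rho) by lra.
  exists (mkposreal _ Hq); simpl; intros z Hz Hz2.
  rewrite weighted_derive_transplant by (assumption || apply B0_analytic).
  apply Hd; [apply Hdd, Hz|apply HR; [exact Hz|lra]].
- exists g; intros z Hz; apply Hg, Hz.
Qed.

Lemma B0_norm_transplant (S : E -> E) (s : C -> C) (f g : B0 E) :
  vector_isometry S -> disc_automorphism s ->
  (forall z, unit_disc z -> g z = transplant S s f z) -> B0_norm g = B0_norm f.
Proof.
intros HS Hs Hg.
assert (HW : forall z, unit_disc z -> weighted_derive g z = weighted_derive f (s z)).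
{ intros z Hz.
  rewrite <- (weighted_derive_transplant S s f z HS Hs (B0_analytic _ f) Hz).
  unfold weighted_derive; do 2 f_equal; symmetry; apply vderive_unique.
  apply (is_derive_C_ext_loc g); [|apply vderive_correct, B0_analytic, Hz].
  destruct (unit_disc_nbhd z Hz) as [d [Hd H]]; exists d; split; [exact Hd|].
  intros w Hw; apply Hg, H, Hw. }
apply Lub_Rbar_eqset; intros x; split.
- intros [z [Hz ->]]; exists (s z); split; [apply Hs, Hz|apply HW, Hz].
- intros [w [Hw ->]]; destruct (proj2 (proj2 (proj2 Hs)) w Hw) as [z [Hz <-]].
  exists z; split; [exact Hz|symmetry; apply HW, Hz].
Qed.

Lemma automorphism_inverse (s : C -> C) : disc_automorphism s ->
  exists t, disc_automorphism t /\ forall z, unit_disc z -> t (s z) = z.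
Proof.
intros Hs; destruct (automorphism_form s Hs) as [a [c [Ha [Hc Es]]]].
assert (Hc0 : c <> 0%C) by (apply Cmod_gt_0; lra).
assert (Ha' := unit_disc_opp a Ha).
assert (Hci : Cmod (/ c) = 1) by (rewrite Cmod_inv, Hc by exact Hc0; field).
assert (Hrot : forall z, unit_disc z -> unit_disc (c * z)%C).
{ unfold unit_disc; intros z Hz; rewrite Cmod_mult, Hc; lra. }
set (t := fun w => (/ c * mob (- a) w)%C).
assert (Ht : forall z, unit_disc z -> unit_disc (t z)).
{ intros z Hz; assert (K := mob_disc (- a) z Ha' Hz); unfold unit_disc, t in *.
  rewrite Cmod_mult, Hci; lra. }
assert (Hts : forall z, unit_disc z -> t (s z) = z).
{ intros z Hz; unfold t; rewrite (Es z Hz), mob_opp_mob by auto; field; exact Hc0. }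
assert (Hst : forall z, unit_disc z -> s (t z) = z).
{ intros z Hz; rewrite (Es _ (Ht z Hz)); unfold t.
  replace (c * (/ c * mob (- a) z))%C with (mob (- a) z) by (field; exact Hc0).
  apply mob_mob_opp; assumption. }
exists t; split; [|exact Hts]; split; [|split; [exact Ht|split]].
- apply holo_analytic; apply (holo_mult (fun _ => / c)%C); [apply holo_const|].
  apply holo_mob, Ha'.
- intros z w Hz Hw K; rewrite <- (Hst z Hz), <- (Hst w Hw), K; reflexivity.
- intros w Hw; exists (s w); split; [apply Hs, Hw|apply Hts, Hw].
Qed.

Lemma isometry_injective (S : E -> E) (x y : E) : vector_isometry S -> S x = S y -> x = y.
Proof.
intros HS H.
assert (K : vsub x y = vzero).
{ apply (norm_eq_zero (V := E)); rewrite <- (proj2 (proj2 HS)), vector_isometry_minus, H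
    by exact HS.
  transitivity (norm (vzero)); [f_equal; exact (minus_eq_zero (G := NormedModule.AbelianGroup _ EN) _)|].
  exact (norm_zero (V := E)). }
rewrite <- (minus_plus_cancel (V := E) x y), K; apply plus_zero_l.
Qed.

Lemma isometry_inverse (S : E -> E) : vector_isometry S -> (forall y, exists x, S x = y) ->
  exists R, vector_isometry R /\ forall x, S (R x) = x.
Proof.
intros HS Hsu; destruct (choice _ Hsu) as [R HR]; exists R; split; [|exact HR].
assert (HS' := HS); destruct HS' as [S1 [S2 S3]]; split; [|split].
- intros x y; apply (isometry_injective S); [exact HS|]; rewrite S1, !HR; reflexivity.
- intros c x; apply (isometry_injective S); [exact HS|]; rewrite S2, !HR; reflexivity.
- intros x; rewrite <- S3, HR; reflexivity.
Qed.

Lemma transplant_surjective_isometry (S : E -> E) (s : C -> C) (T : B0 E -> B0 E) :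
  vector_isometry S -> (forall y, exists x, S x = y) -> disc_automorphism s ->
  (forall (f : B0 E) z, unit_disc z -> T f z = transplant S s f z) ->
  linear_isometry T /\ forall g, exists f, T f = g.
Proof.
intros HS Hsu Hs HT; assert (HS' := HS); destruct HS' as [S1 [S2 S3]].
assert (Hext : forall f g : B0 E, (forall z, unit_disc z -> f z = g z) -> f = g).
{ intros f g H; apply B0_ext; intros z; destruct (classic (unit_disc z)) as [Hz|Hz].
  - apply H, Hz.
  - rewrite !B0_off_disc by exact Hz; reflexivity. }
split; [split; [|split]|].
- intros f g; apply Hext; intros z Hz.
  change (T (B0_plus f g) z = vadd (T f z) (T g z)); rewrite !HT by exact Hz.
  unfold transplant; rewrite <- S1; f_equal.
  exact (minus_plus_plus (G := NormedModule.AbelianGroup _ EN) _ _ _ _).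
- intros c f; apply Hext; intros z Hz.
  change (T (B0_scal c f) z = c *: T f z); rewrite !HT by exact Hz.
  unfold transplant; rewrite <- S2; f_equal.
  change (vsub (c *: f (s z)) (c *: f (s 0%C)) = c *: vsub (f (s z)) (f (s 0%C))).
  apply (eq_of_norming Esmooth); intros chi x Hchi.
  assert (HF := norming_functional _ _ Hchi).
  rewrite (proj1 (proj2 HF)), !(functional_minus (V := E) chi), !(proj1 (proj2 HF)) by exact HF.
  ring.
- intros f; apply (B0_norm_transplant S s f (T f) HS Hs), HT.
- intros g; destruct (isometry_inverse S HS Hsu) as [R [HR HSR]].
  destruct (automorphism_inverse s Hs) as [t [Ht Hts]].
  destruct (B0_transplant R t g HR Ht) as [f Hf]; exists f; apply Hext; intros z Hz.
  assert (Hd := proj1 (proj2 Hs)).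
  rewrite (HT f z Hz); unfold transplant at 1.
  rewrite !Hf by (apply Hd; assumption || apply unit_disc_0); unfold transplant.
  rewrite !Hts by (assumption || apply unit_disc_0).
  rewrite vector_isometry_minus, !HSR by exact HS.
  assert (K : g 0%C = vzero) by apply B0_at_0; rewrite K.
  apply (eq_of_norming Esmooth); intros chi x Hchi.
  assert (HF := norming_functional _ _ Hchi).
  assert (Hz0 : chi vzero = 0%C) by exact (functional_zero (V := E) chi HF).
  rewrite !(functional_minus (V := E) chi) by exact HF; rewrite Hz0; ring.
Qed.

End Composition.

(** * The structure of a surjective isometry *)

Lemma identity_automorphism : disc_automorphism (fun z => z).
Proof.
split; [apply holo_analytic; intros z _; exists 1%C; apply cder_id|].
split; [auto|split; [auto|]]; intros w Hw; exists w; auto.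
Qed.

Section Structure.

Context {E : CompleteNormedModule C_AbsRing} (Esmooth : smooth E).

Local Notation EN := (CompleteNormedModule.NormedModule C_AbsRing E).
Local Notation vadd := (@plus (NormedModule.AbelianMonoid C_AbsRing EN)).
Local Notation vsub := (@minus (NormedModule.AbelianGroup C_AbsRing EN)).
Local Notation vzero := (@zero (NormedModule.AbelianMonoid C_AbsRing EN)).
Local Notation "c *: x" := (@scal _ (NormedModule.ModuleSpace C_AbsRing EN) (c : C) x)
  (at level 40).

Lemma B0_norm_zero_eq (f : B0 E) : B0_norm f = Finite 0 -> f = B0_zero.
Proof.
intros H; apply B0_ext; intros z.
destruct (classic (unit_disc z)) as [Hz|Hz]; [|apply B0_off_disc, Hz].
assert (H0 : forall w, unit_disc w -> vderive f w = vzero).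
{ intros w Hw.
  assert (K : weighted_derive f w <= 0).
  { apply (proj1 (B0_norm_le f 0)); [rewrite H; apply Rle_refl|exact Hw]. }
  apply (norm_eq_zero (V := E)).
  unfold weighted_derive in K; assert (Hp := weight_pos w Hw).
  assert (Hn : 0 <= norm (vderive f w)) by apply norm_ge_0; nra. }
apply (eq_of_derive Esmooth f (fun _ => zero)); [|apply B0_at_0|exact Hz].
intros w Hw; exists vzero; split; [|apply is_vderive_zero].
rewrite <- (H0 w Hw); apply vderive_correct, B0_analytic, Hw.
Qed.

Lemma linear_isometry_injective (T : B0 E -> B0 E) (f g : B0 E) :
  linear_isometry T -> T f = T g -> f = g.
Proof.
intros [T1 [T2 T3]] H.
assert (K : B0_plus f (B0_scal (RtoC (-1)) g) = B0_zero).
{ apply B0_norm_zero_eq; rewrite <- T3, T1, T2, H.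
  assert (Z : B0_plus (T g) (B0_scal (RtoC (-1)) (T g)) = B0_zero)
    by exact (B0_plus_opp (T g)).
  rewrite Z; apply is_lub_Rbar_unique.
  assert (W : forall z, weighted_derive (B0_zero (E := E)) z = 0).
  { intros z; unfold weighted_derive.
    assert (D : vderive (B0_zero (E := E)) z = vzero)
      by exact (vderive_unique _ _ _ (is_vderive_zero z)).
    rewrite D, (norm_zero (V := E)); ring. }
  split.
  - intros r [z [_ ->]]; rewrite W; apply Rle_refl.
  - intros b Hb; apply Hb; exists 0%C; split; [apply unit_disc_0|rewrite W; reflexivity]. }
apply B0_ext; intros z.
apply (f_equal (fun h : B0 E => h z)) in K.
change (vadd (f z) (RtoC (-1) *: g z) = vzero) in K.
rewrite <- (minusC (V := E)) in K.
rewrite <- (minus_plus_cancel (V := E) (f z) (g z)), K; apply plus_zero_l.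
Qed.

Lemma linear_isometry_inverse (T : B0 E -> B0 E) :
  linear_isometry T -> (forall g, exists f, T f = g) ->
  exists Ti, linear_isometry Ti /\ (forall g, T (Ti g) = g) /\ (forall f, Ti (T f) = f).
Proof.
intros HT Hsu; destruct (choice _ Hsu) as [Ti HTi].
assert (Hinj := fun f g => linear_isometry_injective T f g HT).
assert (HT' := HT); destruct HT' as [T1 [T2 T3]].
exists Ti; split; [split; [|split]|split; [exact HTi|]].
- intros f g; apply Hinj; rewrite T1, !HTi; reflexivity.
- intros c f; apply Hinj; rewrite T2, !HTi; reflexivity.
- intros f; rewrite <- T3, HTi; reflexivity.
- intros f; apply Hinj; rewrite HTi; reflexivity.
Qed.

Context (Econvex : strictly_convex E).

(** Strict convexity upgrades the scalar maximum principle to vectors. *)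
Lemma strictly_convex_eq (x y : E) (phi : E -> C) :
  norming (V := E) x phi -> norm y = norm x -> phi y = RtoC (norm x) -> y = x.
Proof.
intros Hphi Hn Hy.
destruct (classic (x = vzero)) as [->|Hx].
{ apply (norm_eq_zero (V := E)); rewrite Hn; exact (norm_zero (V := E)). }
assert (Hp := norm_pos (V := E) x Hx).
apply NNPP; intros Hne.
set (k := RtoC (/ norm x)).
assert (Hk : RtoC (norm x) <> 0%C) by (apply RtoC_neq_0; lra).
assert (Hkk : (RtoC (norm x) * k)%C = 1%C).
{ unfold k; rewrite <- RtoC_mult; f_equal; field; lra. }
assert (Hk1 : Cmod k * norm x = 1).
{ unfold k; rewrite Cmod_R, Rabs_pos_eq by (apply Rlt_le, Rinv_0_lt_compat, Hp).
  field; lra. }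
assert (H2 : norm (vadd (k *: x) (k *: y)) < 2).
{ apply Econvex.
  - etransitivity; [apply (norm_scalC (V := E))|exact Hk1].
  - etransitivity; [apply (norm_scalC (V := E))|rewrite Hn; exact Hk1].
  - intros K; apply Hne; symmetry.
    rewrite <- (scalC_1 (V := E) x), <- (scalC_1 (V := E) y), <- Hkk.
    rewrite <- !(scalC_assoc (V := E)); f_equal; exact K. }
assert (K := proj1 (proj2 (proj2 Hphi)) (vadd (k *: x) (k *: y))).
rewrite (proj1 Hphi), !(proj1 (proj2 Hphi)), Hy, (proj2 (proj2 (proj2 Hphi))) in K.
replace (k * RtoC (norm x) + k * RtoC (norm x))%C with (RtoC 2) in K.
- rewrite Cmod_R, Rabs_pos_eq in K by lra; lra.
- rewrite <- (Cmult_comm (RtoC (norm x)) k), Hkk.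
  rewrite <- RtoC_plus; f_equal; ring.
Qed.

(** Knowing that [T] transports evaluations at [s y] to evaluations at [y] with their
    norms, the derivative of [T g] at [y] is [A y] applied to that of [g] at [s y], for a
    linear multiple of an isometry [A y]. Then [s] is holomorphic as a quotient of two
    such derivatives, hence an automorphism, and Schwarz-Pick gives [|s' y|] as the factor
    of [A y]. The isometries [A y / s' y] depend holomorphically on [y], so by the
    maximum principle and strict convexity they are all equal to one isometry [S]. *)
Lemma isometry_is_transplant (T : B0 E -> B0 E) (u : E) :
  linear_isometry T -> (forall g, exists f, T f = g) -> norm u = 1 ->
  exists S s, vector_isometry S /\ (forall y, exists x, S x = y) /\
    disc_automorphism s /\
    forall (f : B0 E) z, unit_disc z -> T f z = transplant S s f z.
Proof.
intros HT Hsu Hu.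
destruct (linear_isometry_inverse T HT Hsu) as [Ti [HTi [HTTi HTiT]]].
(* The point [s y] is the one whose evaluation [T] transports to [y]. *)
assert (Hex : forall y, exists z, unit_disc y -> unit_disc z /\
  forall g : B0 E, norm (wderive (T g) y) = norm (wderive g z)).
{ intros y; destruct (classic (unit_disc y)) as [Hy|Hy]; [|exists y; contradiction].
  destruct (transport_norm Esmooth Ti T y u HTi HT HTiT HTTi Hu Hy) as [z [Hz H]].
  exists z; intros _; split; [exact Hz|]; intros g.
  rewrite <- H, HTiT; reflexivity. }
destruct (choice _ Hex) as [s Hs].
assert (Hsd : forall y, unit_disc y -> unit_disc (s y)) by (intros y Hy; apply Hs, Hy).
assert (Hsn : forall y (g : B0 E), unit_disc y ->
  norm (wderive (T g) y) = norm (wderive g (s y))) by (intros y g Hy; apply Hs, Hy).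
assert (Hsi : forall y y', unit_disc y -> unit_disc y' -> s y = s y' -> y = y').
{ intros y y' Hy Hy' Ey; apply (norm_wderive_separates Esmooth y y' u Hy Hy' Hu).
  intros g; rewrite <- (HTTi g), !Hsn, Ey by assumption; lra. }
assert (Hss : forall z, unit_disc z -> exists y, unit_disc y /\ s y = z).
{ intros z Hz.
  destruct (transport_norm Esmooth T Ti z u HT HTi HTTi HTiT Hu Hz) as [y [Hy H]].
  exists y; split; [exact Hy|].
  apply (norm_wderive_separates Esmooth (s y) z u (Hsd y Hy) Hz Hu).
  intros g; rewrite <- Hsn, H by exact Hy; lra. }
destruct HT as [T1 [T2 T3]].
assert (Hder : forall y (g : B0 E), unit_disc y ->
  (1 - Cmod y ^ 2) * norm (vderive (T g) y) = (1 - Cmod (s y) ^ 2) * norm (vderive g (s y))).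
{ intros y g Hy; assert (K := Hsn y g Hy).
  rewrite !norm_wderive in K by auto; exact K. }
assert (Hdep : forall y (g h : B0 E), unit_disc y ->
  vderive g (s y) = vderive h (s y) -> vderive (T g) y = vderive (T h) y).
{ intros y g h Hy Egh.
  assert (K := Hder y (B0_plus g (B0_scal (RtoC (-1)) h)) Hy).
  rewrite T1, T2, !vderive_plus, !vderive_scal, Egh in K by auto.
  rewrite <- !(minusC (V := E)) in K.
  assert (Z : norm (vsub (vderive h (s y)) (vderive h (s y))) = 0).
  { transitivity (norm vzero);
      [f_equal; exact (minus_eq_zero (G := NormedModule.AbelianGroup _ EN) _)|].
    exact (norm_zero (V := E)). }
  rewrite Z, Rmult_0_r in K; assert (Hw := weight_pos y Hy).
  assert (Z2 : vsub (vderive (T g) y) (vderive (T h) y) = vzero).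
  { apply (norm_eq_zero (V := E)); nra. }
  rewrite <- (minus_plus_cancel (V := E) (vderive (T g) y) (vderive (T h) y)), Z2.
  apply plus_zero_l. }
destruct (choice (fun e (m : B0 E * B0 E) => forall z, unit_disc z ->
  vderive (fst m) z = e /\ vderive (snd m) z = z *: e)) as [m Hm].
{ intros e; destruct (B0_monomials Esmooth e) as [m0 [m1 [m2 H]]].
  exists (m0, m1); intros z Hz; destruct (H z Hz) as [H0 [H1 _]]; auto. }
(* The derivatives of [T g] at [y] and of [g] at [s y] are related by [A y]. *)
set (A := fun y e => vderive (T (fst (m e))) y).
assert (HA : forall y (g : B0 E), unit_disc y ->
  vderive (T g) y = A y (vderive g (s y))).
{ intros y g Hy; apply Hdep; [exact Hy|]; symmetry; apply Hm, Hsd, Hy. }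
assert (HA1 : forall y e e', unit_disc y -> A y (vadd e e') = vadd (A y e) (A y e')).
{ intros y e e' Hy.
  change (A y (vadd e e')
    = vadd (vderive (T (fst (m e))) y) (vderive (T (fst (m e'))) y)).
  rewrite <- (vderive_plus (T (fst (m e))) (T (fst (m e'))) y Hy), <- T1, (HA y _ Hy).
  f_equal; rewrite vderive_plus by auto; f_equal; symmetry; apply Hm; auto. }
assert (HA2 : forall y c e, unit_disc y -> A y (c *: e) = c *: A y e).
{ intros y c e Hy.
  change (A y (c *: e) = c *: vderive (T (fst (m e))) y).
  rewrite <- (vderive_scal c (T (fst (m e))) y Hy), <- T2, (HA y _ Hy).
  f_equal; rewrite vderive_scal by auto; f_equal; symmetry; apply Hm; auto. }
assert (HAn : forall y e, unit_disc y ->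
  (1 - Cmod y ^ 2) * norm (A y e) = (1 - Cmod (s y) ^ 2) * norm e).
{ intros y e Hy; unfold A; rewrite Hder by exact Hy.
  do 2 f_equal; apply Hm, Hsd, Hy. }
(* [T] maps the functions [z * e] and [z ^ 2 / 2 * e] to functions whose derivatives
   [A e] and [s * A e] have quotient [s]. *)
assert (Hsh : holo s).
{ intros y Hy.
  assert (Wy := weight_pos y Hy); assert (Wsy := weight_pos _ (Hsd y Hy)).
  assert (HAu : 0 < norm (A y u)).
  { assert (K := HAn y u Hy); rewrite Hu in K.
    assert (K0 : 0 <= norm (A y u)) by apply norm_ge_0; nra. }
  destruct (norming_exists (V := E) Esmooth (A y u)) as [phi Hphi].
  assert (HF := norming_functional _ _ Hphi).
  set (F0 := deriv (fun w => phi (T (fst (m u)) w))).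
  set (F1 := deriv (fun w => phi (T (snd (m u)) w))).
  assert (HF0 : holo F0) by (apply holo_deriv, holo_functional; [exact HF|apply B0_analytic]).
  assert (HF1 : holo F1) by (apply holo_deriv, holo_functional; [exact HF|apply B0_analytic]).
  assert (E0 : forall w, unit_disc w -> F0 w = phi (A w u)).
  { intros w Hw; apply deriv_functional; [exact HF|apply B0_analytic|exact Hw]. }
  assert (E1 : forall w, unit_disc w -> F1 w = (s w * F0 w)%C).
  { intros w Hw; rewrite E0 by exact Hw; rewrite <- (proj1 (proj2 HF)), <- HA2 by exact Hw.
    transitivity (phi (vderive (T (snd (m u))) w)).
    - apply deriv_functional; [exact HF|apply B0_analytic|exact Hw].
    - rewrite HA by exact Hw; do 2 f_equal; apply Hm, Hsd, Hw. }
  assert (Hne : F0 y <> 0%C).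
  { rewrite E0 by exact Hy; rewrite (proj2 (proj2 (proj2 Hphi))).
    intros K; apply (f_equal fst) in K; simpl in K; lra. }
  destruct (HF0 y Hy) as [l0 Hl0]; destruct (HF1 y Hy) as [l1 Hl1].
  eexists; apply (cder_ext_loc (fun w => F1 w * / F0 w)%C).
  - destruct (cder_ccont _ _ _ Hl0 _ (proj1 (Cmod_gt_0 _) Hne)) as [d1 [Hd1 H1]].
    destruct (unit_disc_nbhd y Hy) as [d2 [Hd2 H2]].
    exists (Rmin d1 d2); split; [apply Rmin_pos; assumption|]; intros w Hw.
    specialize (H1 w (Rlt_le_trans _ _ _ Hw (Rmin_l _ _))).
    specialize (H2 w (Rlt_le_trans _ _ _ Hw (Rmin_r _ _))).
    rewrite E1 by exact H2; field.
    intros K; rewrite K in H1; replace (0 - F0 y)%C with (- F0 y)%C in H1 by ring.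
    rewrite Cmod_opp in H1; lra.
  - apply cder_mult; [exact Hl1|apply cder_inv; [exact Hne|exact Hl0]]. }
assert (Haut : disc_automorphism s).
{ split; [apply holo_analytic, Hsh|split; [exact Hsd|split; [exact Hsi|exact Hss]]]. }
set (ds := deriv s).
assert (Hds : forall y, unit_disc y -> cder s y (ds y)) by (intros y Hy; apply deriv_spec; assumption).
assert (Hsp : forall y, unit_disc y -> (1 - Cmod y ^ 2) * Cmod (ds y) = 1 - Cmod (s y) ^ 2)
  by (intros y Hy; apply (schwarz_pick_equality s y (ds y)); auto).
assert (Hds0 : forall y, unit_disc y -> ds y <> 0%C).
{ intros y Hy K; assert (K2 := Hsp y Hy); rewrite K, Cmod_0, Rmult_0_r in K2.
  assert (W := weight_pos _ (Hsd y Hy)); lra. }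
set (B := fun y e => (/ ds y)%C *: A y e).
assert (HBn : forall y e, unit_disc y -> norm (B y e) = norm e).
{ intros y e Hy; unfold B; rewrite (norm_scalC (V := E)), Cmod_inv by (apply Hds0, Hy).
  assert (K := HAn y e Hy); rewrite <- (Hsp y Hy) in K.
  assert (W := weight_pos y Hy); assert (Hp := proj1 (Cmod_gt_0 _) (Hds0 y Hy)).
  apply Rmult_eq_reg_l with ((1 - Cmod y ^ 2) * Cmod (ds y)); [|nra].
  rewrite <- K; field; lra. }
assert (HBc : forall y e, unit_disc y -> B y e = B 0%C e).
{ intros y e Hy.
  destruct (norming_exists (V := E) Esmooth (B 0%C e)) as [phi Hphi].
  assert (HF := norming_functional _ _ Hphi).
  apply (strictly_convex_eq _ _ phi Hphi).
  - rewrite !HBn by (assumption || apply unit_disc_0); reflexivity.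
  - rewrite <- (proj2 (proj2 (proj2 Hphi))).
    assert (Hk : forall w, unit_disc w ->
      (/ ds w * deriv (fun x => phi (T (fst (m e)) x)) w)%C = phi (B w e)).
    { intros w Hw; unfold B; rewrite (proj1 (proj2 HF)); f_equal.
      apply deriv_functional; [exact HF|apply B0_analytic|exact Hw]. }
    apply (strong_max_modulus_0 (fun w => phi (B w e))); [| |exact Hy].
    + eapply holo_ext; [exact Hk|].
      apply (holo_mult (fun w => / ds w)%C).
      * apply holo_inv; [exact Hds0|apply holo_deriv, Hsh].
      * apply holo_deriv, holo_functional; [exact HF|apply B0_analytic].
    + intros w Hw; rewrite (proj2 (proj2 (proj2 Hphi))), Cmod_R.
      rewrite Rabs_pos_eq by apply norm_ge_0.
      rewrite (HBn 0%C e unit_disc_0), <- (HBn w e Hw); apply Hphi. }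
set (S := B 0%C).
assert (HS : vector_isometry S).
{ split; [|split].
  - intros x y; unfold S, B; rewrite HA1 by apply unit_disc_0.
    exact (scalC_plus_r (V := E) _ _ _).
  - intros c x; unfold S, B; rewrite HA2 by apply unit_disc_0.
    rewrite !(scalC_assoc (V := E)); f_equal; ring.
  - intros x; apply HBn, unit_disc_0. }
assert (HAS : forall y e, unit_disc y -> A y e = ds y *: S e).
{ intros y e Hy; unfold S; rewrite <- (HBc y e Hy); unfold B.
  rewrite (scalC_assoc (V := E)), Cinv_r by (apply Hds0, Hy).
  symmetry; apply (scalC_1 (V := E)). }
exists S, s; split; [exact HS|split; [|split; [exact Haut|]]].
- intros x; exists (ds 0%C *: vderive (Ti (fst (m x))) (s 0%C)).
  rewrite (proj1 (proj2 HS)), <- (HAS 0%C) by apply unit_disc_0.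
  rewrite <- HA, HTTi by apply unit_disc_0; apply Hm, unit_disc_0.
- intros f; apply (eq_of_derive Esmooth (T f) (transplant S s f)).
  + intros z Hz; exists (ds z *: S (vderive f (s z))); split.
    * rewrite <- HAS, <- HA by exact Hz; apply vderive_correct, B0_analytic, Hz.
    * apply (is_derive_transplant Esmooth); auto; apply B0_analytic.
  + rewrite B0_at_0; symmetry; apply transplant_0, HS.
Qed.

End Structure.

Theorem theorem3p5 (E : CompleteNormedModule C_AbsRing)
    (Esmooth : smooth E) (Econvex : strictly_convex E)
    (T : B0 E -> B0 E) :
  surjective_linear_isometry B0_norm T <->
  exists (S : E -> E) (sigma : C -> C),
    surjective_linear_isometry norm S /\
    disc_automorphism sigma /\
    forall (f : B0 E) (z : C), unit_disc z ->
      T f z = S (minus (f (sigma z)) (f (sigma (RtoC 0)))).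
Proof.
split.
- intros [T1 [T2 [T3 T4]]].
  assert (HT : linear_isometry T) by (split; [exact T1|split; [exact T2|exact T3]]).
  destruct (classic (exists u : E, norm u = 1)) as [[u Hu]|HN].
  + destruct (isometry_is_transplant Esmooth Econvex T u HT T4 Hu)
      as [S [s [[S1 [S2 S3]] [S4 [Hs H]]]]].
    exists S, s; split; [|split; [exact Hs|exact H]].
    split; [exact S1|split; [exact S2|split; [exact S3|exact S4]]].
  + (* Without unit vectors [E] is zero, and so is the Bloch space. *)
    assert (Hz : forall x y : E, x = y).
    { assert (H0 : forall x : E, x = zero).
      { intros x; apply NNPP; intros Hx; apply HN; eexists.
        exact (norm_normalize (V := E) x Hx). }
      intros x y; rewrite (H0 x), (H0 y); reflexivity. }
    exists (fun x => x), (fun z => z); split; [|split; [apply identity_automorphism|]].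
    * repeat split; auto; intros y; exists y; reflexivity.
    * intros f z _; apply Hz.
- intros [S [s [[S1 [S2 [S3 S4]]] [Hs H]]]].
  assert (HS : vector_isometry S) by (split; [exact S1|split; [exact S2|exact S3]]).
  destruct (transplant_surjective_isometry Esmooth S s T HS S4 Hs H) as [[T1 [T2 T3]] T4].
  split; [exact T1|split; [exact T2|split; [exact T3|exact T4]]].
Qed.
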